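(* Let $a>0$, $m_1>0$, $m_2,f\in\mathbb{R}$. On the region $\mathcal{R}_s\subset T\mathbb{S}^2_{SH}$ let $\tilde E_{sph,a}=E_{sKep}+\langle\tilde V_{sph,2}\rangle$ be the Hamiltonian of the partially-averaged hemispherical Lagrange problem, obtained by averaging $\tilde V_{sph,2}$ (the sum of the second spherical Kepler potential and the spherical Hooke potential) along the closed orbits of $E_{sKep}$, and let $D$ be the function defined in the context. Then $D$ is a first integral of the partially-averaged system: $$\{\tilde E_{sph,a},D\}=0\quad\text{on }\mathcal{R}_s.$$
   Context: Setting: $\mathbb{S}^2_{SH}=\{Q\in\mathbb{R}^3:\|Q\|=1,\ Q_3<0\}$ is the open lower unit hemisphere with the round metric; points of its tangent bundle are $(Q,Q')$, $Q\cdot Q'=0$. The Poisson bracket is the canonical one of the cotangent bundle, transported by the Legendre transformation of $\frac12\|Q'\|^2$. Centers: Kepler centers $Z_1=\frac{1}{\sqrt{1+a^2}}(0,a,-1)$, $Z_2=\frac{1}{\sqrt{1+a^2}}(0,-a,-1)$, and Hooke center $Z_0=(0,0,-1)$; $\theta_i$ is the central angle between $Q$ and $Z_i$. Energies: $E_{sKep}=\frac12\|Q'\|^2-m_1\sqrt{1+a^2}\cot\theta_1$ and $\tilde V_{sph,2}=-m_2\sqrt{1+a^2}\cot\theta_2+f\tan^2\theta_0$; the energy of the hemispherical Lagrange problem is $\tilde E_{sph}=E_{sKep}+\tilde V_{sph,2}$. (Non-singular orbits of the spherical Kepler problem are closed; the Hooke potential is singular at the equator $Q_3=0$.) Region: $\mathcal{R}_s$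 is the set of points of $T\mathbb{S}^2_{SH}$ whose orbit under $E_{sKep}$ is non-singular (does not collide with $Z_1$), is contained in the hemisphere $\mathbb{S}^2_{SH}$, and does not pass through the other Kepler center $Z_2$. Average: $\langle\tilde V_{sph,2}\rangle(z)=\frac1T\int_0^T\tilde V_{sph,2}(\varphi_t(z))\,dt$, with $\varphi_t$ the flow of $E_{sKep}$ and $T=T(z)$ the period of the orbit of $z$. The function $D$: use the central projection chart $x=-Q_1/Q_3$, $y=-Q_2/Q_3$ with rescaled velocities $\dot x=Q_1Q_3'-Q_3Q_1'$, $\dot y=Q_2Q_3'-Q_3Q_2'$ (velocities with respect to the time of the projectively corresponding Euclidean system, so that $\|Q'\|^2=\dot x^2+\dot y^2+(x\dot y-y\dot x)^2$). Put $\xi=x$, $\eta=(y-a)/\sqrt{1+a^2}$, $\dot\xi=\dot x$, $\dot\eta=\dot y/\sqrt{1+a^2}$. Then $$D=(\xi\dot\eta-\eta\dot\xi)^2-\frac{2a}{\sqrt{1+a^2}}\Big((\xi\dot\eta-\eta\dot\xi)\dot\xi+\frac{m_1\eta}{\sqrt{\xi^2+\eta^2}}\Big).$$ *)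

(* Defs.v *)
From Stdlib Require Import Reals Lra Psatz ClassicalEpsilon.
From Coquelicot Require Import Coquelicot.
Open Scope R_scope.

Record vec3 := Vec { c1 : R; c2 : R; c3 : R }.

Definition dot (u v : vec3) : R := c1 u * c1 v + c2 u * c2 v + c3 u * c3 v.
Definition vnorm (u : vec3) : R := sqrt (dot u u).
Definition vadd (u v : vec3) : vec3 := Vec (c1 u + c1 v) (c2 u + c2 v) (c3 u + c3 v).
Definition vscal (k : R) (u : vec3) : vec3 := Vec (k * c1 u) (k * c2 u) (k * c3 u).

(** [TPt Q Q'] is the pair (Q, Q'). *)
Record tpoint := TPt { pos : vec3; vel : vec3 }.

Definition S2SH (Q : vec3) : Prop := vnorm Q = 1 /\ c3 Q < 0.
Definition TS2SH (z : tpoint) : Prop := S2SH (pos z) /\ dot (pos z) (vel z) = 0.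

(** * Canonical structure of the cotangent bundle

    The central projection (x, y) = (- Q1 / Q3, - Q2 / Q3) is a global chart of
    the hemisphere.  The Legendre transformation of |Q'|^2 / 2 sends (Q, Q') to
    the covector < Q', . >, so the canonical coordinates on the tangent bundle
    are x, y and px = < Q', dQ/dx >, py = < Q', dQ/dy >. *)

Definition proj_x (Q : vec3) : R := - c1 Q / c3 Q.
Definition proj_y (Q : vec3) : R := - c2 Q / c3 Q.

Definition chart (x y : R) : vec3 :=
  let s := sqrt (1 + x ^ 2 + y ^ 2) in Vec (x / s) (y / s) (- 1 / s).

Definition chart_dx (x y : R) : vec3 :=
  Vec (Derive (fun s => c1 (chart s y)) x)
      (Derive (fun s => c2 (chart s y)) x)
      (Derive (fun s => c3 (chart s y)) x).
Definition chart_dy (x y : R) : vec3 :=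
  Vec (Derive (fun s => c1 (chart x s)) y)
      (Derive (fun s => c2 (chart x s)) y)
      (Derive (fun s => c3 (chart x s)) y).

Definition can_x (z : tpoint) : R := proj_x (pos z).
Definition can_y (z : tpoint) : R := proj_y (pos z).
Definition can_px (z : tpoint) : R := dot (vel z) (chart_dx (can_x z) (can_y z)).
Definition can_py (z : tpoint) : R := dot (vel z) (chart_dy (can_x z) (can_y z)).

(** Inverse Legendre transformation: the tangent vector u e1 + v e2 whose
    products with e1 = dQ/dx and e2 = dQ/dy are px and py (Cramer's rule for
    the Gram matrix); see [of_can_correct]. *)
Definition of_can (x y px py : R) : tpoint :=
  let e1 := chart_dx x y in
  let e2 := chart_dy x y in
  let det := dot e1 e1 * dot e2 e2 - dot e1 e2 * dot e1 e2 in
  let u := (dot e2 e2 * px - dot e1 e2 * py) / det in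
  let v := (dot e1 e1 * py - dot e1 e2 * px) / det in
  TPt (chart x y) (vadd (vscal u e1) (vscal v e2)).

Definition along_x (F : tpoint -> R) (z : tpoint) (s : R) : R :=
  F (of_can s (can_y z) (can_px z) (can_py z)).
Definition along_y (F : tpoint -> R) (z : tpoint) (s : R) : R :=
  F (of_can (can_x z) s (can_px z) (can_py z)).
Definition along_px (F : tpoint -> R) (z : tpoint) (s : R) : R :=
  F (of_can (can_x z) (can_y z) s (can_py z)).
Definition along_py (F : tpoint -> R) (z : tpoint) (s : R) : R :=
  F (of_can (can_x z) (can_y z) (can_px z) s).

Definition d_x (F : tpoint -> R) (z : tpoint) : R := Derive (along_x F z) (can_x z).
Definition d_y (F : tpoint -> R) (z : tpoint) : R := Derive (along_y F z) (can_y z).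
Definition d_px (F : tpoint -> R) (z : tpoint) : R := Derive (along_px F z) (can_px z).
Definition d_py (F : tpoint -> R) (z : tpoint) : R := Derive (along_py F z) (can_py z).

(** [Derive] is total: this says that the four derivatives above exist. *)
Definition ex_partials (F : tpoint -> R) (z : tpoint) : Prop :=
  ex_derive (along_x F z) (can_x z) /\ ex_derive (along_y F z) (can_y z) /\
  ex_derive (along_px F z) (can_px z) /\ ex_derive (along_py F z) (can_py z).

Definition poisson (F G : tpoint -> R) (z : tpoint) : R :=
  (d_x F z * d_px G z - d_px F z * d_x G z) +
  (d_y F z * d_py G z - d_py F z * d_y G z).

(** Complete solution, inside the tangent bundle of the hemisphere, of
    Hamilton's equations of [H]. *)
Definition hamiltonian_orbit (H : tpoint -> R) (g : R -> tpoint) : Prop :=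
  forall t : R,
    TS2SH (g t) /\
    is_derive (fun s => can_x (g s)) t (d_px H (g t)) /\
    is_derive (fun s => can_y (g s)) t (d_py H (g t)) /\
    is_derive (fun s => can_px (g s)) t (- d_x H (g t)) /\
    is_derive (fun s => can_py (g s)) t (- d_y H (g t)).

(** * The hemispherical Lagrange problem *)

Definition Z1 (a : R) : vec3 := vscal (1 / sqrt (1 + a ^ 2)) (Vec 0 a (- 1)).
Definition Z2 (a : R) : vec3 := vscal (1 / sqrt (1 + a ^ 2)) (Vec 0 (- a) (- 1)).
Definition Z0 : vec3 := Vec 0 0 (- 1).

(** Central angle of two unit vectors. *)
Definition angle (P Q : vec3) : R := acos (dot P Q).
Definition cot (t : R) : R := cos t / sin t.

Definition EsKep (a m1 : R) (z : tpoint) : R :=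
  / 2 * vnorm (vel z) ^ 2
  - m1 * sqrt (1 + a ^ 2) * cot (angle (pos z) (Z1 a)).

Definition Vsph2 (a m2 f : R) (Q : vec3) : R :=
  - m2 * sqrt (1 + a ^ 2) * cot (angle Q (Z2 a)) + f * tan (angle Q Z0) ^ 2.

(** A solution through [z] that exists, stays in the open hemisphere and avoids
    Z1 for all times is the whole (non-singular) Kepler orbit of [z]. *)
Definition kepler_orbit (a m1 : R) (z : tpoint) (g : R -> tpoint) : Prop :=
  g 0 = z /\
  hamiltonian_orbit (EsKep a m1) g /\
  (forall t : R, pos (g t) <> Z1 a).

Definition Rs (a m1 : R) (z : tpoint) : Prop :=
  exists g : R -> tpoint,
    kepler_orbit a m1 z g /\ (forall t : R, pos (g t) <> Z2 a).

(** The flow t |-> phi_t z (arbitrary where no [kepler_orbit] exists). *)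
Definition kepler_flow (a m1 : R) (z : tpoint) : R -> tpoint :=
  epsilon (inhabits (fun _ : R => z)) (kepler_orbit a m1 z).

Definition is_period (g : R -> tpoint) (T : R) : Prop :=
  0 < T /\ forall t : R, g (t + T) = g t.

Definition is_minimal_period (g : R -> tpoint) (T : R) : Prop :=
  is_period g T /\ forall T' : R, is_period g T' -> T <= T'.

Definition kepler_period (a m1 : R) (z : tpoint) : R :=
  epsilon (inhabits 0) (is_minimal_period (kepler_flow a m1 z)).

Definition average (a m1 : R) (V : vec3 -> R) (z : tpoint) : R :=
  let T := kepler_period a m1 z in
  1 / T * RInt (fun t => V (pos (kepler_flow a m1 z t))) 0 T.

Definition Esph_avg (a m1 m2 f : R) (z : tpoint) : R :=
  EsKep a m1 z + average a m1 (Vsph2 a m2 f) z.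

Definition Dint (a m1 : R) (z : tpoint) : R :=
  let Q := pos z in
  let Q' := vel z in
  let x := proj_x Q in
  let y := proj_y Q in
  let x' := c1 Q * c3 Q' - c3 Q * c1 Q' in
  let y' := c2 Q * c3 Q' - c3 Q * c2 Q' in
  let xi := x in
  let eta := (y - a) / sqrt (1 + a ^ 2) in
  let xi' := x' in
  let eta' := y' / sqrt (1 + a ^ 2) in
  (xi * eta' - eta * xi') ^ 2
  - 2 * a / sqrt (1 + a ^ 2)
    * ((xi * eta' - eta * xi') * xi' + m1 * eta / sqrt (xi ^ 2 + eta ^ 2)).

(** * [of_can] inverts the canonical coordinates *)

Lemma chart_dxE (x y : R) :
  let s := sqrt (1 + x ^ 2 + y ^ 2) in
  chart_dx x y = Vec ((1 + y ^ 2) / s ^ 3) (- (x * y) / s ^ 3) (x / s ^ 3).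
Proof.
intros s.
assert (H : 0 < 1 + x ^ 2 + y ^ 2) by nra.
assert (Hs : 0 < s) by (apply sqrt_lt_R0; exact H).
assert (H2 : s ^ 2 = 1 + x ^ 2 + y ^ 2) by (apply pow2_sqrt; lra).
unfold chart_dx, chart; simpl c1; simpl c2; simpl c3.
f_equal; apply is_derive_unique; auto_derive;
  replace (1 + x * (x * 1) + y * (y * 1)) with (1 + x ^ 2 + y ^ 2) by ring;
  try (fold s; repeat split; lra); fold s.
- clearbody s. replace (1 + y ^ 2) with (s ^ 2 - x ^ 2) by lra. field; lra.
- field; lra.
- field; lra.
Qed.

Lemma chart_dyE (x y : R) :
  let s := sqrt (1 + x ^ 2 + y ^ 2) in
  chart_dy x y = Vec (- (x * y) / s ^ 3) ((1 + x ^ 2) / s ^ 3) (y / s ^ 3).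
Proof.
intros s.
assert (H : 0 < 1 + x ^ 2 + y ^ 2) by nra.
assert (Hs : 0 < s) by (apply sqrt_lt_R0; exact H).
assert (H2 : s ^ 2 = 1 + x ^ 2 + y ^ 2) by (apply pow2_sqrt; lra).
unfold chart_dy, chart; simpl c1; simpl c2; simpl c3.
f_equal; apply is_derive_unique; auto_derive;
  replace (1 + x * (x * 1) + y * (y * 1)) with (1 + x ^ 2 + y ^ 2) by ring;
  try (fold s; repeat split; lra); fold s.
- field; lra.
- clearbody s. replace (1 + x ^ 2) with (s ^ 2 - y ^ 2) by lra. field; lra.
- field; lra.
Qed.

Lemma of_can_correct (x y px py : R) :
  TS2SH (of_can x y px py) /\
  can_x (of_can x y px py) = x /\ can_y (of_can x y px py) = y /\
  can_px (of_can x y px py) = px /\ can_py (of_can x y px py) = py.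
Proof.
assert (H : 0 < 1 + x ^ 2 + y ^ 2) by nra.
set (s := sqrt (1 + x ^ 2 + y ^ 2)).
assert (Hs : 0 < s) by (apply sqrt_lt_R0; exact H).
assert (H2 : s ^ 2 = 1 + x ^ 2 + y ^ 2) by (apply pow2_sqrt; lra).
assert (Hc : chart x y = Vec (x / s) (y / s) (- 1 / s)) by reflexivity.
assert (Hdx := chart_dxE x y). assert (Hdy := chart_dyE x y).
cbv zeta in Hdx, Hdy. fold s in Hdx, Hdy. clearbody s.
assert (Hx : can_x (of_can x y px py) = x).
{ unfold can_x, proj_x, of_can; cbn [pos]. rewrite Hc; cbn [c1 c3]. field; lra. }
assert (Hy : can_y (of_can x y px py) = y).
{ unfold can_y, proj_y, of_can; cbn [pos]. rewrite Hc; cbn [c2 c3]. field; lra. }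
assert (Hd : forall n, s ^ n <> 0) by (intro; apply pow_nonzero; lra).
assert (Hdet : dot (chart_dx x y) (chart_dx x y) * dot (chart_dy x y) (chart_dy x y)
  - dot (chart_dx x y) (chart_dy x y) * dot (chart_dx x y) (chart_dy x y) <> 0).
{ rewrite Hdx, Hdy. unfold dot; cbn [c1 c2 c3].
  match goal with |- ?e <> 0 =>
    replace e with ((1 + x ^ 2 + y ^ 2) ^ 3 / s ^ 12) by (field; lra) end.
  apply Rmult_integral_contrapositive_currified;
    [ apply pow_nonzero; lra | apply Rinv_neq_0_compat, Hd ]. }
split; [| split; [exact Hx | split; [exact Hy |]]].
- split; [split |]; unfold of_can; cbn [pos vel].
  + unfold vnorm. replace (dot _ _) with 1; [apply sqrt_1 |].
    rewrite Hc. unfold dot; cbn [c1 c2 c3].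
    replace (x / s * (x / s) + y / s * (y / s) + -1 / s * (-1 / s))
      with ((1 + x ^ 2 + y ^ 2) / s ^ 2) by (field; lra).
    rewrite <- H2. field; lra.
  + rewrite Hc; cbn [c3]. unfold Rdiv.
    assert (0 < / s) by (apply Rinv_0_lt_compat, Hs). lra.
  + set (u := _ / _). set (v := _ / _). clearbody u v.
    rewrite Hc, Hdx, Hdy. unfold dot, vadd, vscal; cbn [c1 c2 c3].
    field_simplify_eq; [| lra]. ring.
- unfold can_px, can_py. rewrite Hx, Hy. unfold of_can; cbn [pos vel].
  revert Hdet. generalize (chart_dx x y), (chart_dy x y). intros e1 e2 Hdet.
  unfold dot, vadd, vscal in *; cbn [c1 c2 c3].
  split; field; exact Hdet.
Qed.

(* Main.v *)
Require Import Defs.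
From Stdlib Require Import Reals.
From Coquelicot Require Import Coquelicot.
From Stdlib Require Import Lra Psatz ClassicalEpsilon.
Import Defs.
Open Scope R_scope.

(** In the projective variables (xi, eta) a Kepler orbit is an ellipse with focus
    at the origin, with angular momentum C and Laplace vector (A2, A1), and
    D = C^2 - (2 a / b) A1, b = sqrt (1 + a^2).  Let v be the cotangent of
    the central angle to Z1; along the orbit it is the trigonometric polynomial
    v = b0 - b1 sin phi - b2 cos phi of the polar angle phi, and
    phi' = C (1 + v^2).  Hence the period and the average do not require the flow:
    <V> = N / M with N = int V / (1 + v^2) dphi, M = int 1 / (1 + v^2) dphi over
    [0, 2 pi], which depend smoothly on (b0, b1, b2).  These elements form a
    Poisson algebra, and under the flow of D the integrands change by
    (2 a C b2 / b^2) times themselves plus a derivative with respect to phi; the latter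
    comes from a function W of the position with {V, D} + {E_sKep, W} = 0.  So
    {N, D} and {M, D} are the same multiple of N and M, and {N / M, D} = 0.

    A point lies in R_s only if C is nonzero, the conic is an ellipse, and D differs
    from 2 a m1 / b, which means that the ellipse avoids Z2.  These conditions are
    open, so that the formula N / M can be differentiated. *)

(** * Calculus lemmas *)

(** Since D commutes with E_sKep, the abstract argument is {<V>, D} = <{V, D}> = - <{E_sKep, W}> =
    0, the last average being that of a time derivative along a closed orbit. It would require the
    flow of D and the smooth dependence of the Kepler flow on its initial point, whereas here flow
    and period are mere choices made by [epsilon]. Integrals over the polar angle avoid both, but
    the flow of D preserves neither the polar angle nor the density dphi / (1 + v^2). The drift of
    the angle produces the derivative with respect to phi. The multiplier is {C, D} / C: N and M are
    |C| times the integrals of V and of 1 over a period, and it is these integrals that commute with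
    D. *)

Lemma mean_value (f df : R -> R) (x y : R) :
  (forall t, is_derive f t (df t)) ->
  exists c, Rmin x y <= c <= Rmax x y /\ f y - f x = df c * (y - x).
Proof.
intros Hf. apply (MVT_gen f x y df); intros t _.
- apply Hf.
- apply derivable_continuous_pt. exists (df t). apply is_derive_Reals, Hf.
Qed.

Lemma derive_zero_constant (f : R -> R) :
  (forall t, is_derive f t 0) -> forall s t, f s = f t.
Proof.
intros Hf s t. destruct (mean_value f (fun _ => 0) t s Hf) as [c [_ Hc]]. lra.
Qed.

Lemma is_derive_eq (f : R -> R) (t l m : R) : is_derive f t l -> l = m -> is_derive f t m.
Proof. intros H <-. exact H. Qed.

(** A slope bounded below by a positive constant makes G onto and its inverse Lipschitz, hence a
    global inverse, differentiable everywhere. It serves twice: for the polar angle as a function of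
    time, and for time as a function of the polar angle. *)
Lemma inverse_function (G h : R -> R) (m : R) :
  0 < m -> (forall t, is_derive G t (h t)) -> (forall t, continuous h t) ->
  (forall t, m <= h t) ->
  exists Phi : R -> R,
    (forall s, G (Phi s) = s) /\ (forall s, is_derive Phi s (/ h (Phi s))).
Proof.
intros Hm HG Hh Hmh.
assert (HGc : continuity G).
{ intro t. apply derivable_continuous_pt. exists (h t). apply is_derive_Reals, HG. }
assert (Hsurj : forall s, exists t, G t = s).
(* The slope is at least m, so on either side of 0 the function moves away from [G 0] by at least |s
   - G 0| over a length r, and the intermediate value theorem reaches s. *)
{ intro s. set (r := Rabs (s - G 0) / m).
  assert (Hr : 0 <= r) by (apply Rdiv_le_0_compat; [apply Rabs_pos | exact Hm]).
  assert (Hr' : m * r = Rabs (s - G 0)) by (unfold r; field; lra).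
  destruct (mean_value G h 0 r HG) as [c [_ Hc]].
  destruct (mean_value G h (- r) 0 HG) as [d [_ Hd]].
  pose proof (Hmh c). pose proof (Hmh d).
  assert (H1 : m * r <= h c * r) by (apply Rmult_le_compat_r; lra).
  assert (H2 : m * r <= h d * r) by (apply Rmult_le_compat_r; lra).
  assert (Habs : - (m * r) <= s - G 0 <= m * r).
  { rewrite Hr'. split; [| apply Rle_abs].
    pose proof (Rle_abs (- (s - G 0))) as H3. rewrite Rabs_Ropp in H3. lra. }
  destruct (IVT_gen G (- r) r s HGc) as [t [_ Ht]]; [| exists t; exact Ht].
  split.
  - eapply Rle_trans; [apply Rmin_l | lra].
  - eapply Rle_trans; [| apply Rmax_r]. lra. }
set (Phi := fun s => epsilon (inhabits 0) (fun t => G t = s)).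
assert (HPhi : forall s, G (Phi s) = s) by (intro s; apply epsilon_spec, Hsurj).
exists Phi. split; [exact HPhi |]. intro r.
assert (Hmvt : forall s, exists c, Rmin (Phi r) (Phi s) <= c <= Rmax (Phi r) (Phi s) /\
   s - r = h c * (Phi s - Phi r)).
{ intro s. destruct (mean_value G h (Phi r) (Phi s) HG) as [c [Hc1 Hc2]].
  exists c. split; [exact Hc1 |]. rewrite !HPhi in Hc2. exact Hc2. }
assert (Hlip : forall s, m * Rabs (Phi s - Phi r) <= Rabs (s - r)).
{ intro s. destruct (Hmvt s) as [c [_ ->]]. rewrite Rabs_mult.
  apply Rmult_le_compat_r; [apply Rabs_pos |].
  eapply Rle_trans; [apply Hmh | apply Rle_abs]. }
apply is_derive_Reals. intros eps Heps.
assert (Hinv : continuous (fun t => / h t) (Phi r)).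
{ apply continuous_Rinv_comp; [apply Hh | pose proof (Hmh (Phi r)); lra]. }
apply (proj1 (filterlim_locally _ _)) with (eps := mkposreal eps Heps) in Hinv.
destruct Hinv as [d Hd].
assert (Hdm : 0 < m * d) by (apply Rmult_lt_0_compat; [exact Hm | apply cond_pos]).
exists (mkposreal _ Hdm). intros s Hs Hsd. simpl in Hsd.
(* The difference quotient is exactly [/ h c] at a mean value point c, and the Lipschitz bound
   places c within d of [Phi r]. *)
destruct (Hmvt (r + s)) as [c [Hc1 Hc2]].
pose proof (Hlip (r + s)) as Hl. replace (r + s - r) with s in Hl, Hc2 by ring.
assert (Hlt : Rabs (Phi (r + s) - Phi r) < d).
{ apply Rmult_lt_reg_l with m; lra. }
assert (Hc : Rabs (c - Phi r) < d).
{ eapply Rle_lt_trans; [| exact Hlt]. revert Hc1. unfold Rmin, Rmax, Rabs.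
  destruct (Rle_dec _ _); destruct (Rcase_abs (c - Phi r));
    destruct (Rcase_abs (Phi (r + s) - Phi r)); lra. }
pose proof (Hmh c).
replace ((Phi (r + s) - Phi r) / s) with (/ h c).
- specialize (Hd c Hc). exact Hd.
- revert Hc2. generalize (Phi (r + s) - Phi r). intros d' Hd'.
  apply Rmult_eq_reg_l with s; [| exact Hs]. rewrite Hd' at 1. field. lra.
Qed.

Lemma RInt_period_shift (f : R -> R) (T x : R) :
  (forall t, continuous f t) -> (forall t, f (t + T) = f t) ->
  RInt f x (x + T) = RInt f 0 T.
Proof.
intros Hf Hper.
assert (Hex : forall u v, ex_RInt f u v)
  by (intros u v; apply (ex_RInt_continuous (V := R_CompleteNormedModule));
      intros z _; apply Hf).
assert (Hshift : RInt f T (x + T) = RInt f 0 x).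
{ replace T with (1 * 0 + T) at 1 by ring. replace (x + T) with (1 * x + T) by ring.
  rewrite <- RInt_comp_lin by apply Hex. apply RInt_ext. intros t _.
  unfold scal; simpl; unfold mult; simpl. replace (1 * t + T) with (t + T) by ring.
  rewrite Hper. ring. }
pose proof (RInt_Chasles f 0 x (x + T) (Hex _ _) (Hex _ _)) as H1.
pose proof (RInt_Chasles f 0 T (x + T) (Hex _ _) (Hex _ _)) as H2.
unfold plus in *; simpl in *. lra.
Qed.

Lemma cos_sin_angle (c s : R) :
  c ^ 2 + s ^ 2 = 1 -> exists t, c = cos t /\ s = sin t.
Proof.
intros H.
assert (Hc : -1 <= c <= 1) by nra.
destruct (Rle_dec 0 s) as [Hs | Hs].
- exists (acos c). rewrite cos_acos, sin_acos by exact Hc. split; [reflexivity |].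
  replace (1 - c²) with (s ^ 2) by (unfold Rsqr; lra). rewrite sqrt_pow2; lra.
- exists (- acos c). rewrite cos_neg, sin_neg, cos_acos, sin_acos by exact Hc.
  split; [reflexivity |].
  replace (1 - c²) with ((- s) ^ 2) by (unfold Rsqr; lra). rewrite sqrt_pow2; lra.
Qed.

Lemma is_derive_continuous (f : R -> R) (x l : R) : is_derive f x l -> continuous f x.
Proof.
intros H. apply (ex_derive_continuous (K := R_AbsRing) (V := R_NormedModule)).
exists l. exact H.
Qed.

Lemma is_derive_div_const (f : R -> R) (t l c : R) :
  is_derive f t l -> is_derive (fun s => f s / c) t (l / c).
Proof.
intros H. apply (is_derive_scal_l (K := R_AbsRing) (V := R_NormedModule) f t l (/ c) H).
Qed.

(** * Continuous differentiability at a point *)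

(** Differentiation under the integral sign needs a derivative on a neighbourhood of the parameter,
    continuous at the parameter itself. This notion records just that and is stable under the
    algebraic operations. *)
Definition C1_at (f : R -> R) (s l : R) : Prop :=
  exists df : R -> R, locally s (fun t => is_derive f t (df t)) /\
    continuous df s /\ df s = l.

Lemma C1_at_derive (f : R -> R) (s l : R) : C1_at f s l -> is_derive f s l.
Proof.
intros [df [H1 [_ <-]]]. exact (locally_singleton _ _ H1).
Qed.

Lemma C1_at_continuous (f : R -> R) (s l : R) : C1_at f s l -> continuous f s.
Proof. intros H. eapply is_derive_continuous. apply (C1_at_derive _ _ _ H). Qed.

Lemma C1_at_const (c s : R) : C1_at (fun _ => c) s 0.
Proof.
exists (fun _ => 0). repeat split; [| apply continuous_const].
apply filter_forall. intro t. apply (is_derive_const (V := R_NormedModule)).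
Qed.

Lemma C1_at_id (s : R) : C1_at (fun t => t) s 1.
Proof.
exists (fun _ => 1). repeat split; [| apply continuous_const].
apply filter_forall. intro t. apply (is_derive_id (K := R_AbsRing)).
Qed.

Lemma C1_at_plus (f g : R -> R) (s l m : R) :
  C1_at f s l -> C1_at g s m -> C1_at (fun t => f t + g t) s (l + m).
Proof.
intros [df [F1 [F2 F3]]] [dg [G1 [G2 G3]]].
exists (fun t => df t + dg t). repeat split.
- generalize (filter_and _ _ F1 G1). apply filter_imp. intros t [A B].
  apply (is_derive_plus (V := R_NormedModule)); assumption.
- apply (continuous_plus (V := R_NormedModule)); assumption.
- congruence.
Qed.

Lemma C1_at_mult (f g : R -> R) (s l m : R) :
  C1_at f s l -> C1_at g s m -> C1_at (fun t => f t * g t) s (l * g s + f s * m).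
Proof.
intros Hf Hg.
pose proof (C1_at_derive _ _ _ Hf) as Hf'. pose proof (C1_at_derive _ _ _ Hg) as Hg'.
destruct Hf as [df [F1 [F2 F3]]]. destruct Hg as [dg [G1 [G2 G3]]].
exists (fun t => df t * g t + f t * dg t). repeat split.
- generalize (filter_and _ _ F1 G1). apply filter_imp. intros t [A B].
  apply (is_derive_mult f g t _ _ A B). intros; apply Rmult_comm.
- apply (continuous_plus (V := R_NormedModule));
    apply (continuous_mult (K := R_AbsRing)); try assumption;
    eapply is_derive_continuous; eassumption.
- congruence.
Qed.

Lemma C1_at_comp (g dg f : R -> R) (s l : R) :
  C1_at f s l -> locally (f s) (fun u => is_derive g u (dg u)) ->
  continuous dg (f s) -> C1_at (fun t => g (f t)) s (l * dg (f s)).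
Proof.
intros Hf Hg Hdg.
pose proof (C1_at_derive _ _ _ Hf) as Hf'.
destruct Hf as [df [F1 [F2 F3]]].
assert (Hc : continuous f s) by exact (is_derive_continuous _ _ _ Hf').
exists (fun t => df t * dg (f t)). repeat split.
- generalize (filter_and _ _ F1 (Hc _ Hg)). apply filter_imp. intros t [A B].
  apply (is_derive_comp (V := R_NormedModule)); assumption.
- apply (continuous_mult (K := R_AbsRing)); [assumption |].
  apply (continuous_comp f dg); assumption.
- congruence.
Qed.

Lemma locally_neq0 (x : R) : x <> 0 -> locally x (fun y => y <> 0).
Proof.
intros Hx. assert (H : 0 < Rabs x) by (apply Rabs_pos_lt, Hx).
exists (mkposreal _ H). intros y Hy. change (Rabs (y - x) < Rabs x) in Hy.
intros ->. rewrite Rminus_0_l, Rabs_Ropp in Hy. lra.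
Qed.

Lemma locally_gt (x c : R) : c < x -> locally x (fun y => c < y).
Proof. intros H. exact (open_gt c x H). Qed.

Lemma C1_at_inv (f : R -> R) (s l : R) :
  C1_at f s l -> f s <> 0 -> C1_at (fun t => / f t) s (l * (- 1 / f s ^ 2)).
Proof.
intros Hf H0.
apply (C1_at_comp Rinv (fun u => - 1 / u ^ 2) f); [exact Hf | |].
- generalize (locally_neq0 _ H0). apply filter_imp. intros u Hu.
  auto_derive; [exact Hu | field; exact Hu].
- apply (ex_derive_continuous (K := R_AbsRing) (V := R_NormedModule)). auto_derive.
  rewrite Rmult_1_r. apply Rmult_integral_contrapositive_currified; exact H0.
Qed.

Lemma C1_at_sqrt (f : R -> R) (s l : R) :
  C1_at f s l -> 0 < f s -> C1_at (fun t => sqrt (f t)) s (l * / (2 * sqrt (f s))).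
Proof.
intros Hf H0.
apply (C1_at_comp sqrt (fun u => / (2 * sqrt u)) f); [exact Hf | |].
- generalize (locally_gt _ _ H0). apply filter_imp. intros u Hu.
  auto_derive; [exact Hu | ring].
- apply (ex_derive_continuous (K := R_AbsRing) (V := R_NormedModule)). auto_derive.
  split; [exact H0 |]. split; [| exact I].
  pose proof (sqrt_lt_R0 _ H0). lra.
Qed.

Lemma C1_at_eq (f : R -> R) (s l m : R) : C1_at f s l -> l = m -> C1_at f s m.
Proof. intros H <-. exact H. Qed.

Lemma C1_at_minus (f g : R -> R) (s l m : R) :
  C1_at f s l -> C1_at g s m -> C1_at (fun t => f t - g t) s (l - m).
Proof.
intros Hf Hg.
destruct (C1_at_plus _ _ _ _ _ Hf (C1_at_mult _ _ _ _ _ (C1_at_const (- 1) s) Hg))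
  as [df [H1 [H2 H3]]].
exists df. refine (conj _ (conj H2 _)); [| rewrite H3; ring].
assert (HE : forall r : R, f r + - 1 * g r = f r - g r) by (intro r; ring).
revert H1. apply filter_imp. intros t. apply (is_derive_ext _ _ _ _ HE).
Qed.

Lemma C1_at_div (f g : R -> R) (s l m : R) :
  C1_at f s l -> C1_at g s m -> g s <> 0 ->
  C1_at (fun t => f t / g t) s ((l * g s - f s * m) / g s ^ 2).
Proof.
intros Hf Hg H0. eapply C1_at_eq.
- apply C1_at_mult; [exact Hf | apply C1_at_inv; eassumption].
- cbv beta. field. exact H0.
Qed.

(** * Differentiation under the integral sign along a family of conics *)

(** Linear in its coefficients, so its derivative along a curve of coefficients is again a
    [conic]. *)
Definition conic (b0 b1 b2 t : R) : R := b0 - b1 * sin t - b2 * cos t.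

(** Regularity of f is asked only at the points of the conics for parameters near s, because the
    potential is singular where a conic would meet the second centre or leave the hemisphere. *)
Lemma is_derive_RInt_conic (f fu : R -> R -> R) (b0 b1 b2 : R -> R) (s l0 l1 l2 x y : R) :
  C1_at b0 s l0 -> C1_at b1 s l1 -> C1_at b2 s l2 ->
  locally s (fun r => forall t,
    is_derive (fun u => f u t) (conic (b0 r) (b1 r) (b2 r) t)
      (fu (conic (b0 r) (b1 r) (b2 r) t) t)) ->
  locally s (fun r => forall t,
    continuity_2d_pt f (conic (b0 r) (b1 r) (b2 r) t) t /\
    continuity_2d_pt fu (conic (b0 r) (b1 r) (b2 r) t) t) ->
  is_derive (fun r => RInt (fun t => f (conic (b0 r) (b1 r) (b2 r) t) t) x y) s
    (RInt (fun t => fu (conic (b0 s) (b1 s) (b2 s) t) t * conic l0 l1 l2 t) x y).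
Proof.
intros [d0 [H0 [C0 E0]]] [d1 [H1 [C1 E1]]] [d2 [H2 [C2 E2]]] Hd Hcont.
set (u := fun r t => conic (b0 r) (b1 r) (b2 r) t) in *.
assert (Hder : locally s (fun r => forall t, is_derive (fun r => f (u r t) t) r
   (fu (u r t) t * conic (d0 r) (d1 r) (d2 r) t))).
{ generalize (filter_and _ _ (filter_and _ _ H0 H1) (filter_and _ _ H2 Hd)).
  apply filter_imp. intros r [[A0 A1] [A2 A]] t.
  rewrite Rmult_comm.
  apply (is_derive_comp (V := R_NormedModule) (fun v => f v t) (fun r => u r t) r);
    [apply A |].
  unfold u, conic. auto_derive.
  - repeat split; eexists; eassumption.
  - rewrite (is_derive_unique (fun r : R => b0 r) _ _ A0),
      (is_derive_unique (fun r : R => b1 r) _ _ A1),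
      (is_derive_unique (fun r : R => b2 r) _ _ A2). unfold conic. ring. }
assert (Hb : forall t, continuity_2d_pt (fun r v => u r v) s t).
{ assert (forall b d, locally s (fun r => is_derive b r (d r)) -> continuity_pt b s) as Hc.
  { intros b d Hb. apply derivable_continuous_pt. exists (d s).
    apply is_derive_Reals. exact (locally_singleton _ _ Hb). }
  intro t. unfold u, conic.
  apply continuity_2d_pt_minus; [apply continuity_2d_pt_minus |].
  - apply (continuity_1d_2d_pt_comp b0 (fun r _ => r));
      [exact (Hc _ _ H0) | apply continuity_2d_pt_id1].
  - apply continuity_2d_pt_mult.
    + apply (continuity_1d_2d_pt_comp b1 (fun r _ => r));
      [exact (Hc _ _ H1) | apply continuity_2d_pt_id1].
    + apply (continuity_1d_2d_pt_comp sin (fun _ v => v));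
      [apply continuity_sin | apply continuity_2d_pt_id2].
  - apply continuity_2d_pt_mult.
    + apply (continuity_1d_2d_pt_comp b2 (fun r _ => r));
      [exact (Hc _ _ H2) | apply continuity_2d_pt_id1].
    + apply (continuity_1d_2d_pt_comp cos (fun _ v => v));
      [apply continuity_cos | apply continuity_2d_pt_id2]. }
assert (Hcomp2 : forall (h : R -> R -> R) t, continuity_2d_pt h (u s t) t ->
   continuity_2d_pt (fun r v => h (u r v) v) s t).
{ intros h t Hh. apply continuity_2d_pt_filterlim.
  apply (continuous_comp_2 (fun z : R * R => u (fst z) (snd z)) (fun z => snd z) h).
  - exact (proj1 (continuity_2d_pt_filterlim _ _ _) (Hb t)).
  - apply continuous_snd.
  - exact (proj1 (continuity_2d_pt_filterlim _ _ _) Hh). }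
replace (RInt _ x y) with
  (RInt (fun t => Derive (fun r => f (u r t) t) s) x y).
2:{ apply RInt_ext. intros t _. pose proof (locally_singleton _ _ Hder t) as D.
    etransitivity; [exact (is_derive_unique _ _ _ D) |].
    rewrite E0, E1, E2. reflexivity. }
apply (is_derive_RInt_param (fun r t => f (u r t) t)).
- generalize Hder. apply filter_imp. intros r Hr t _. eexists. apply Hr.
- intros t _.
  assert (Hconic : continuity_2d_pt
    (fun r v => fu (u r v) v * conic (d0 r) (d1 r) (d2 r) v) s t).
  { apply continuity_2d_pt_mult.
    - apply Hcomp2. apply (locally_singleton _ _ Hcont t).
    - assert (forall d, continuous d s -> continuity_2d_pt (fun r _ => d r) s t) as Hc.
      { intros d Hd'. apply (continuity_1d_2d_pt_comp d (fun r _ => r));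
        [apply continuity_pt_filterlim; exact Hd' | apply continuity_2d_pt_id1]. }
      unfold conic. apply continuity_2d_pt_minus; [apply continuity_2d_pt_minus |].
      + apply Hc, C0.
      + apply continuity_2d_pt_mult; [apply Hc, C1 |].
        apply (continuity_1d_2d_pt_comp sin (fun _ v => v));
          [apply continuity_sin | apply continuity_2d_pt_id2].
      + apply continuity_2d_pt_mult; [apply Hc, C2 |].
        apply (continuity_1d_2d_pt_comp cos (fun _ v => v));
          [apply continuity_cos | apply continuity_2d_pt_id2]. }
  (* The explicit formula is known to be the derivative only for r near s, so its continuity is
     transferred to [Derive] locally. *)
  refine (continuity_2d_pt_ext_loc _ _ _ _ _ Hconic).
  destruct Hder as [d Hder]. exists d. intros r v Hr _.
  symmetry. apply is_derive_unique. apply Hder. exact Hr.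
- generalize Hcont. apply filter_imp. intros r Hr.
  apply (ex_RInt_continuous (V := R_CompleteNormedModule)). intros t _.
  apply (continuous_comp_2 (fun t => u r t) (fun t => t) f).
  + apply (ex_derive_continuous (K := R_AbsRing) (V := R_NormedModule)). unfold u, conic.
    auto_derive. exact I.
  + apply continuous_id.
  + exact (proj1 (continuity_2d_pt_filterlim _ _ _) (proj1 (Hr t))).
Qed.

(** * The functions in canonical coordinates *)

Definition bfac (a : R) : R := sqrt (1 + a ^ 2).

Lemma bfac_pos (a : R) : 0 < bfac a.
Proof. apply sqrt_lt_R0. nra. Qed.

Lemma bfac_sqr (a : R) : bfac a ^ 2 = 1 + a ^ 2.
Proof. apply pow2_sqrt. nra. Qed.

Lemma vec3_ext (u v : vec3) : c1 u = c1 v -> c2 u = c2 v -> c3 u = c3 v -> u = v.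
Proof. destruct u, v; simpl; intros; congruence. Qed.

(** The Gram matrix of the chart has determinant 1 / s^6, so Cramer's rule collapses to a velocity
    linear in the momenta. All later computations start from this form, which is free of
    [Derive]. *)
Lemma of_canE (x y p q : R) :
  let s := sqrt (1 + x ^ 2 + y ^ 2) in
  of_can x y p q =
    TPt (Vec (x / s) (y / s) (- 1 / s)) (Vec (s * p) (s * q) (s * (x * p + y * q))).
Proof.
intros s. assert (H : 0 < 1 + x ^ 2 + y ^ 2) by nra.
assert (Hs : 0 < s) by (apply sqrt_lt_R0; exact H).
assert (H2 : s ^ 2 = 1 + x ^ 2 + y ^ 2) by (apply pow2_sqrt; lra).
assert (Hdx := chart_dxE x y). assert (Hdy := chart_dyE x y).
cbv zeta in Hdx, Hdy. unfold of_can; cbv zeta. rewrite Hdx, Hdy. unfold chart. fold s.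
clearbody s. clear Hdx Hdy.
unfold dot, vadd, vscal; cbn [c1 c2 c3].
assert (Hy : y ^ 2 = s ^ 2 - 1 - x ^ 2) by lra.
assert (Hd : (1 + y ^ 2) / s ^ 3 * ((1 + y ^ 2) / s ^ 3) +
   - (x * y) / s ^ 3 * (- (x * y) / s ^ 3) + x / s ^ 3 * (x / s ^ 3) = (1 + y ^ 2) / s ^ 4).
{ field_simplify_eq; [| lra]. rewrite H2. ring. }
assert (He : - (x * y) / s ^ 3 * (- (x * y) / s ^ 3) +
   (1 + x ^ 2) / s ^ 3 * ((1 + x ^ 2) / s ^ 3) + y / s ^ 3 * (y / s ^ 3) = (1 + x ^ 2) / s ^ 4).
{ field_simplify_eq; [| lra]. rewrite H2. ring. }
assert (Hf : (1 + y ^ 2) / s ^ 3 * (- (x * y) / s ^ 3) +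
   - (x * y) / s ^ 3 * ((1 + x ^ 2) / s ^ 3) + x / s ^ 3 * (y / s ^ 3) = - (x * y) / s ^ 4).
{ field_simplify_eq; [| lra]. rewrite H2. ring. }
rewrite Hd, He, Hf. clear Hd He Hf.
assert (Hdet : (1 + y ^ 2) / s ^ 4 * ((1 + x ^ 2) / s ^ 4) -
  - (x * y) / s ^ 4 * (- (x * y) / s ^ 4) = / s ^ 6).
{ replace (/ s ^ 6) with (s ^ 2 / s ^ 8) by (field; lra). rewrite H2. field. lra. }
rewrite Hdet. clear Hdet.
f_equal. f_equal.
- transitivity ((1 + x ^ 2 + y ^ 2) * p / s); [field; lra | rewrite <- H2; field; lra].
- transitivity ((1 + x ^ 2 + y ^ 2) * q / s); [field; lra | rewrite <- H2; field; lra].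
- transitivity ((1 + x ^ 2 + y ^ 2) * (x * p + y * q) / s);
    [field; lra | rewrite <- H2; field; lra].
Qed.

(** Tangency determines the third component of the velocity from the other two. Together with
    [of_can_correct] this makes the canonical coordinates a bijection, so an abstract orbit can be
    recovered from them. *)
Lemma of_can_coordinates (z : tpoint) :
  TS2SH z -> of_can (can_x z) (can_y z) (can_px z) (can_py z) = z.
Proof.
destruct z as [[q1 q2 q3] [v1 v2 v3]]. intros [[Hn H3] Ht].
unfold vnorm, dot in *. cbn [pos vel c1 c2 c3] in *.
assert (Hn' : q1 * q1 + q2 * q2 + q3 * q3 = 1).
{ rewrite <- (sqrt_sqrt (q1 * q1 + q2 * q2 + q3 * q3)) by nra. rewrite Hn. ring. }
assert (Hx : can_x (TPt (Vec q1 q2 q3) (Vec v1 v2 v3)) = - q1 / q3) by reflexivity.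
assert (Hy : can_y (TPt (Vec q1 q2 q3) (Vec v1 v2 v3)) = - q2 / q3) by reflexivity.
assert (Hs : sqrt (1 + (- q1 / q3) ^ 2 + (- q2 / q3) ^ 2) = - / q3).
{ apply sqrt_lem_1.
  - pose proof (pow2_ge_0 (- q1 / q3)). pose proof (pow2_ge_0 (- q2 / q3)). lra.
  - pose proof (Rinv_lt_0_compat _ H3). lra.
  - transitivity ((q1 * q1 + q2 * q2 + q3 * q3) / q3 ^ 2);
      [rewrite Hn'; field; lra | field; lra]. }
unfold can_px, can_py. rewrite Hx, Hy, of_canE, chart_dxE, chart_dyE, Hs.
cbn [pos vel]. unfold dot; cbn [c1 c2 c3].
assert (Hv3 : v3 = - (q1 * v1 + q2 * v2) / q3) by (apply Rmult_eq_reg_r with q3;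
  [field_simplify; lra | lra]).
assert (E1 : v1 * ((1 + (- q2 / q3) ^ 2) / (- / q3) ^ 3) +
   v2 * (- (- q1 / q3 * (- q2 / q3)) / (- / q3) ^ 3) + v3 * (- q1 / q3 / (- / q3) ^ 3)
   = - q3 * v1).
{ rewrite Hv3. transitivity (- q3 * v1 * (q1 * q1 + q2 * q2 + q3 * q3)); [field; lra |].
  rewrite Hn'. ring. }
assert (E2 : v1 * (- (- q1 / q3 * (- q2 / q3)) / (- / q3) ^ 3) +
   v2 * ((1 + (- q1 / q3) ^ 2) / (- / q3) ^ 3) + v3 * (- q2 / q3 / (- / q3) ^ 3)
   = - q3 * v2).
{ rewrite Hv3. transitivity (- q3 * v2 * (q1 * q1 + q2 * q2 + q3 * q3)); [field; lra |].
  rewrite Hn'. ring. }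
rewrite E1, E2. f_equal; apply vec3_ext; cbn [c1 c2 c3]; try (field; lra).
rewrite Hv3. field. lra.
Qed.

Lemma pos_coordinates (z : tpoint) : TS2SH z -> pos z = chart (can_x z) (can_y z).
Proof. intros Hz. rewrite <- (of_can_coordinates z Hz) at 1. reflexivity. Qed.

Lemma cot_acos (d : R) : -1 <= d <= 1 -> cot (acos d) = d / sqrt (1 - d ^ 2).
Proof.
intros Hd. unfold cot. rewrite cos_acos, sin_acos by exact Hd.
replace (d²) with (d ^ 2) by (unfold Rsqr; ring). reflexivity.
Qed.

Definition eta (a y : R) : R := (y - a) / bfac a.
Definition rho (a x y : R) : R := sqrt (x ^ 2 + eta a y ^ 2).

(** Dividing by [rho = 0] is harmless here: at the centre both sides are [0]. *)
Lemma cot_chart (a x y : R) :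
  bfac a * cot (angle (chart x y) (Z1 a)) = (1 + a * y) / rho a x y.
Proof.
set (s := sqrt (1 + x ^ 2 + y ^ 2)). assert (H : 0 < 1 + x ^ 2 + y ^ 2) by nra.
assert (Hs : 0 < s) by (apply sqrt_lt_R0; exact H).
assert (H2 : s ^ 2 = 1 + x ^ 2 + y ^ 2) by (apply pow2_sqrt; lra).
pose proof (bfac_pos a) as Hb. pose proof (bfac_sqr a) as Hb2.
unfold angle. assert (Hd : dot (chart x y) (Z1 a) = (1 + a * y) / (bfac a * s)).
{ unfold chart, Z1, dot, vscal; cbn [c1 c2 c3]. fold s (bfac a). field; lra. }
(* From (1 + a^2)(1 + x^2 + y^2) - (1 + a y)^2 = b^2 (x^2 + eta^2), the sine of the central angle to
   Z1 is rho / s. This is why the affine variable eta = (y - a) / b is the right one. *)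
rewrite Hd. assert (Hr : 1 - ((1 + a * y) / (bfac a * s)) ^ 2 = (rho a x y / s) ^ 2).
{ unfold Rdiv at 2. rewrite Rpow_mult_distr. unfold rho.
  rewrite pow2_sqrt by (pose proof (pow2_ge_0 x); pose proof (pow2_ge_0 (eta a y)); lra).
  unfold eta. field_simplify_eq; [| lra]. ring [H2 Hb2]. }
assert (Hr0 : 0 <= rho a x y) by apply sqrt_pos.
rewrite cot_acos.
- rewrite Hr, sqrt_pow2 by (apply Rdiv_le_0_compat; lra).
  destruct (Req_dec (rho a x y) 0) as [E | E].
  + rewrite E. unfold Rdiv. rewrite !Rmult_0_l, !Rinv_0. ring.
  + field. lra.
- pose proof (pow2_ge_0 (rho a x y / s)). rewrite <- Hr in H0. nra.
Qed.

Definition kepler_energy (a m1 x y p q : R) : R :=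
  / 2 * (1 + x ^ 2 + y ^ 2) * (p ^ 2 + q ^ 2 + (x * p + y * q) ^ 2)
  - m1 * ((1 + a * y) / rho a x y).

Lemma EsKep_of_can (a m1 x y p q : R) :
  EsKep a m1 (of_can x y p q) = kepler_energy a m1 x y p q.
Proof.
unfold EsKep, kepler_energy. rewrite <- cot_chart. fold (bfac a).
replace (pos (of_can x y p q)) with (chart x y) by reflexivity.
rewrite of_canE. cbn [vel]. unfold vnorm.
rewrite pow2_sqrt; unfold dot; cbn [c1 c2 c3];
  [| repeat apply Rplus_le_le_0_compat; apply Rle_0_sqr].
assert (H2 : sqrt (1 + x ^ 2 + y ^ 2) ^ 2 = 1 + x ^ 2 + y ^ 2)
  by (apply pow2_sqrt; nra).
revert H2. generalize (sqrt (1 + x ^ 2 + y ^ 2)). intros s H2.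
rewrite <- H2. ring.
Qed.

Definition rho2 (a x y : R) : R := sqrt (x ^ 2 + ((y + a) / bfac a) ^ 2).

(** The second centre is the first one for - a, so [cot_chart] applies again; the tangent of the
    angle to the pole is the Euclidean norm in the chart. *)
Lemma Vsph2_chart (a m2 f x y : R) :
  Vsph2 a m2 f (chart x y) = - m2 * ((1 - a * y) / rho2 a x y) + f * (x ^ 2 + y ^ 2).
Proof.
unfold Vsph2. fold (bfac a).
assert (Hb : bfac (- a) = bfac a)
  by (unfold bfac; replace ((- a) ^ 2) with (a ^ 2) by ring; reflexivity).
assert (HZ : Z2 a = Z1 (- a))
  by (unfold Z1, Z2; fold (bfac a) (bfac (- a)); rewrite Hb; reflexivity).
assert (Hr : rho2 a x y = rho (- a) x y)
  by (unfold rho2, rho, eta; rewrite Hb; replace (y - - a) with (y + a) by ring; reflexivity).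
rewrite HZ, Hr. replace (1 - a * y) with (1 + - a * y) by ring.
rewrite <- cot_chart, Hb.
set (s := sqrt (1 + x ^ 2 + y ^ 2)). assert (H : 1 <= 1 + x ^ 2 + y ^ 2) by nra.
assert (Hs : 1 <= s) by (rewrite <- sqrt_1; apply sqrt_le_1_alt; exact H).
assert (H2 : s ^ 2 = 1 + x ^ 2 + y ^ 2) by (apply pow2_sqrt; lra).
assert (Hd : dot (chart x y) Z0 = / s)
  by (unfold chart, Z0, dot; cbn [c1 c2 c3]; fold s; field; lra).
assert (Hi : 0 < / s <= 1).
{ split; [apply Rinv_0_lt_compat; lra | rewrite <- Rinv_1; apply Rinv_le_contravar; lra]. }
assert (Ht : tan (angle (chart x y) Z0) ^ 2 = x ^ 2 + y ^ 2).
{ unfold angle. rewrite Hd. unfold tan. rewrite sin_acos, cos_acos by lra.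
  unfold Rdiv. rewrite Rpow_mult_distr, pow2_sqrt by (unfold Rsqr; nra).
  transitivity (s ^ 2 - 1); [unfold Rsqr; field; lra | lra]. }
rewrite Ht. ring.
Qed.

(** [vx] and [vy] are the projective velocities of xi and eta, [ang] their angular momentum C.
    [lap1] and [lap2] are the eta and xi components A1 and A2 of the Laplace vector, with the sign
    for which it points to the apocentre. *)
Definition vx (x y p q : R) : R := p + x * (x * p + y * q).
Definition vy (a x y p q : R) : R := (q + y * (x * p + y * q)) / bfac a.
Definition ang (a x y p q : R) : R := x * vy a x y p q - eta a y * vx x y p q.
Definition lap1 (a m1 x y p q : R) : R :=
  ang a x y p q * vx x y p q + m1 * (eta a y / rho a x y).
Definition lap2 (a m1 x y p q : R) : R :=
  m1 * (x / rho a x y) - ang a x y p q * vy a x y p q.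

Lemma Dint_of_can (a m1 x y p q : R) :
  Dint a m1 (of_can x y p q) =
    ang a x y p q ^ 2 - 2 * a / bfac a * lap1 a m1 x y p q.
Proof.
set (s := sqrt (1 + x ^ 2 + y ^ 2)). assert (H : 0 < 1 + x ^ 2 + y ^ 2) by nra.
assert (Hs : 0 < s) by (apply sqrt_lt_R0; exact H).
assert (Hx : proj_x (pos (of_can x y p q)) = x) by apply of_can_correct.
assert (Hy : proj_y (pos (of_can x y p q)) = y) by apply of_can_correct.
pose proof (bfac_pos a) as Hb.
unfold Dint. rewrite Hx, Hy. rewrite of_canE. fold s (bfac a). cbn [pos vel c1 c2 c3].
replace (x / s * (s * (x * p + y * q)) - -1 / s * (s * p)) with (vx x y p q)
  by (unfold vx; field; lra).
replace (y / s * (s * (x * p + y * q)) - -1 / s * (s * q)) with (bfac a * vy a x y p q)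
  by (unfold vy; field; lra).
replace (bfac a * vy a x y p q / bfac a) with (vy a x y p q) by (field; lra).
fold (eta a y). fold (ang a x y p q). fold (rho a x y). unfold lap1.
unfold Rdiv. ring.
Qed.

(** * Hamilton's equations in the planar chart *)

Lemma rho_sqr (a x y : R) : rho a x y ^ 2 = x ^ 2 + eta a y ^ 2.
Proof.
unfold rho. apply pow2_sqrt.
pose proof (pow2_ge_0 x). pose proof (pow2_ge_0 (eta a y)). lra.
Qed.

Lemma is_derive_rho_x (a x y : R) :
  0 < rho a x y -> is_derive (fun s => rho a s y) x (x / rho a x y).
Proof.
intros H. assert (0 < x ^ 2 + eta a y ^ 2).
{ rewrite <- rho_sqr. apply pow_lt, H. }
unfold rho in *. auto_derive;
  replace (x * (x * 1) + eta a y * (eta a y * 1)) with (x ^ 2 + eta a y ^ 2) by ring.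
- assumption.
- field. lra.
Qed.

Lemma is_derive_rho_y (a x y : R) :
  0 < rho a x y ->
  is_derive (fun s => rho a x s) y (eta a y / (bfac a * rho a x y)).
Proof.
intros H. pose proof (bfac_pos a) as Hb. assert (0 < x ^ 2 + eta a y ^ 2).
{ rewrite <- rho_sqr. apply pow_lt, H. }
unfold rho in *. unfold eta at 1. auto_derive;
  replace (x * (x * 1) + (y + - a) * / bfac a * ((y + - a) * / bfac a * 1))
    with (x ^ 2 + eta a y ^ 2) by (unfold eta; field; lra).
- assumption.
- unfold eta in *. field. split; lra.
Qed.

Definition kepler_dx (a m1 x y p q : R) : R :=
  x * (p ^ 2 + q ^ 2 + (x * p + y * q) ^ 2)
  + (1 + x ^ 2 + y ^ 2) * (x * p + y * q) * p
  + m1 * (1 + a * y) * (x / rho a x y ^ 3).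
Definition kepler_dy (a m1 x y p q : R) : R :=
  y * (p ^ 2 + q ^ 2 + (x * p + y * q) ^ 2)
  + (1 + x ^ 2 + y ^ 2) * (x * p + y * q) * q
  - m1 * (a / rho a x y - (1 + a * y) * (eta a y / (bfac a * rho a x y ^ 3))).

Lemma is_derive_potential (A N r : R -> R) (m t dA dN dr : R) :
  is_derive A t dA -> is_derive N t dN -> is_derive r t dr -> r t <> 0 ->
  is_derive (fun s => A s - m * (N s / r s)) t
    (dA - m * ((dN * r t - N t * dr) / r t ^ 2)).
Proof.
intros HA HN Hr H0. auto_derive.
- repeat split; try (eexists; eassumption). exact H0.
- rewrite (is_derive_unique (fun s : R => A s) _ _ HA),
    (is_derive_unique (fun s : R => N s) _ _ HN),
    (is_derive_unique (fun s : R => r s) _ _ Hr).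
  field. exact H0.
Qed.

Lemma kepler_energy_partials (a m1 x y p q : R) : 0 < rho a x y ->
  is_derive (fun s => kepler_energy a m1 s y p q) x (kepler_dx a m1 x y p q) /\
  is_derive (fun s => kepler_energy a m1 x s p q) y (kepler_dy a m1 x y p q) /\
  is_derive (fun s => kepler_energy a m1 x y s q) p
    ((1 + x ^ 2 + y ^ 2) * vx x y p q) /\
  is_derive (fun s => kepler_energy a m1 x y p s) q
    ((1 + x ^ 2 + y ^ 2) * (bfac a * vy a x y p q)).
Proof.
intros H. pose proof (bfac_pos a) as Hb.
pose proof (is_derive_rho_x a x y H) as Hx. pose proof (is_derive_rho_y a x y H) as Hy.
unfold kepler_energy, kepler_dx, kepler_dy, vx, vy.
refine (conj _ (conj _ (conj _ _))); eapply is_derive_eq.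
- apply (is_derive_potential
    (fun s => / 2 * (1 + s ^ 2 + y ^ 2) * (p ^ 2 + q ^ 2 + (s * p + y * q) ^ 2))
    (fun s => 1 + a * y) (fun s => rho a s y));
    [auto_derive; [exact I | reflexivity] | auto_derive; [exact I | reflexivity]
    | exact Hx | lra].
- field. lra.
- apply (is_derive_potential
    (fun s => / 2 * (1 + x ^ 2 + s ^ 2) * (p ^ 2 + q ^ 2 + (x * p + s * q) ^ 2))
    (fun s => 1 + a * s) (fun s => rho a x s));
    [auto_derive; [exact I | reflexivity] | auto_derive; [exact I | reflexivity]
    | exact Hy | lra].
- field. lra.
- auto_derive; [exact I | reflexivity].
- field.
- auto_derive; [exact I | reflexivity].
- field. lra.
Qed.

(** The projective correspondence: central projection sends great circles to lines, hence forces
    through Z1 to forces through the origin of the (xi, eta) plane, and the rescaling of eta makes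
    them Newtonian. Only the time changes, by the factor s. *)
Lemma hamilton_planar (a m1 : R) (X Y P Q : R -> R) (t : R) :
  let x := X t in let y := Y t in let p := P t in let q := Q t in
  let s := 1 + x ^ 2 + y ^ 2 in
  0 < rho a x y ->
  is_derive X t (s * vx x y p q) -> is_derive Y t (s * (bfac a * vy a x y p q)) ->
  is_derive P t (- kepler_dx a m1 x y p q) -> is_derive Q t (- kepler_dy a m1 x y p q) ->
  is_derive (fun r => vx (X r) (Y r) (P r) (Q r)) t (- m1 * s * (x / rho a x y ^ 3)) /\
  is_derive (fun r => vy a (X r) (Y r) (P r) (Q r)) t
    (- m1 * s * (eta a y / rho a x y ^ 3)).
Proof.
intros x y p q s H HX HY HP HQ.
pose proof (bfac_pos a) as Hb. pose proof (bfac_sqr a) as Hb2.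
pose proof (rho_sqr a x y) as Hr2.
assert (Hy : y = a + bfac a * eta a y) by (unfold eta; field; lra).
unfold vx at 1, vy at 1.
split; (eapply is_derive_eq; [auto_derive; [repeat apply conj; first [exact I
    | exact (ex_intro _ _ HX) | exact (ex_intro _ _ HY)
    | exact (ex_intro _ _ HP) | exact (ex_intro _ _ HQ)] | reflexivity] |]);
rewrite ?(is_derive_unique (fun r : R => X r) _ _ HX),
  ?(is_derive_unique (fun r : R => Y r) _ _ HY),
  ?(is_derive_unique (fun r : R => P r) _ _ HP), ?(is_derive_unique (fun r : R => Q r) _ _ HQ);
fold x y p q.
- unfold kepler_dx, kepler_dy, vx, vy, s.
  replace (a / rho a x y) with (a * (x ^ 2 + eta a y ^ 2) / rho a x y ^ 3)
    by (rewrite <- Hr2; field; lra).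
  clear Hr2. revert Hy H Hb Hb2. clear. generalize (eta a y) (rho a x y) (bfac a).
  intros e r b -> H Hb Hb2. field_simplify_eq; [| lra]. ring [Hb2].
- unfold kepler_dx, kepler_dy, vx, vy, s.
  replace (a / rho a x y) with (a * (x ^ 2 + eta a y ^ 2) / rho a x y ^ 3)
    by (rewrite <- Hr2; field; lra).
  clear Hr2. revert Hy H Hb Hb2. clear. generalize (eta a y) (rho a x y) (bfac a).
  intros e r b -> H Hb Hb2. field_simplify_eq; [| lra]. ring [Hb2].
Qed.

(** The velocity is the momentum multiplied by the identity plus the rank-one matrix of (x, y); this
    is the inverse matrix by the Sherman-Morrison formula. The argument w is the velocity of y, that
    is b times that of eta. *)
Definition mom_x (x y v w : R) : R := (v + y * (y * v - x * w)) / (1 + x ^ 2 + y ^ 2).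
Definition mom_y (x y v w : R) : R := (w + x * (x * w - y * v)) / (1 + x ^ 2 + y ^ 2).

Lemma velocity_momentum (a x y v w : R) :
  vx x y (mom_x x y v (bfac a * w)) (mom_y x y v (bfac a * w)) = v /\
  vy a x y (mom_x x y v (bfac a * w)) (mom_y x y v (bfac a * w)) = w.
Proof.
pose proof (bfac_pos a). assert (1 + x ^ 2 + y ^ 2 <> 0) by nra.
unfold vx, vy, mom_x, mom_y. split; field; try split; lra.
Qed.

(** The converse of [hamilton_planar], needed because orbits are constructed in the plane and then
    have to satisfy Hamilton's equations. *)
Lemma planar_hamilton (a m1 : R) (X Y U W : R -> R) (t : R) :
  let x := X t in let y := Y t in
  let p := fun r => mom_x (X r) (Y r) (U r) (bfac a * W r) in
  let q := fun r => mom_y (X r) (Y r) (U r) (bfac a * W r) in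
  let s := 1 + x ^ 2 + y ^ 2 in
  0 < rho a x y ->
  is_derive X t (s * U t) -> is_derive Y t (s * (bfac a * W t)) ->
  is_derive U t (- m1 * s * (x / rho a x y ^ 3)) ->
  is_derive W t (- m1 * s * (eta a y / rho a x y ^ 3)) ->
  is_derive p t (- kepler_dx a m1 x y (p t) (q t)) /\
  is_derive q t (- kepler_dy a m1 x y (p t) (q t)).
Proof.
intros x y p q s H HX HY HU HW.
pose proof (bfac_pos a) as Hb. pose proof (bfac_sqr a) as Hb2.
pose proof (rho_sqr a x y) as Hr2.
assert (Hs : 0 < s) by (unfold s; nra).
assert (Hy : y = a + bfac a * eta a y) by (unfold eta; field; lra).
assert (Hsy : s = (1 + y ^ 2) + x ^ 2) by (unfold s; ring).
unfold p at 1, q at 2, mom_x at 1, mom_y at 1.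
split; (eapply is_derive_eq; [auto_derive;
  [repeat apply conj; try exact I; try (eexists; eassumption);
   replace (1 + X t * (X t * 1) + Y t * (Y t * 1)) with s by (unfold s, x, y; ring); lra
  | reflexivity] |]);
rewrite ?(is_derive_unique (fun r : R => X r) _ _ HX),
  ?(is_derive_unique (fun r : R => Y r) _ _ HY),
  ?(is_derive_unique (fun r : R => U r) _ _ HU), ?(is_derive_unique (fun r : R => W r) _ _ HW);
unfold kepler_dx, kepler_dy, p, q, mom_x, mom_y; fold x y s;
replace (1 + x * (x * 1) + y * (y * 1)) with s by (unfold s; ring);
replace (a / rho a x y) with (a * (x ^ 2 + eta a y ^ 2) / rho a x y ^ 3)
    by (rewrite <- Hr2; field; lra);
clear Hr2; generalize (U t) (W t); intros u w;
assert (Hs0 : s <> 0) by lra; clear Hs;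
revert Hy Hsy H Hb Hb2 Hs0; clear; generalize (eta a y) (rho a x y) (bfac a) s;
  clear s; clearbody x y; intros e r b s Hy Hsy H Hb Hb2 Hs0.
- field_simplify_eq; [| lra]. subst s. subst y. ring [Hb2].
- field_simplify_eq; [| lra]. subst s. subst y. ring [Hb2].
Qed.

(** * First integrals and polar form of the Kepler motion *)

Definition radius (x h : R) : R := sqrt (x ^ 2 + h ^ 2).

Lemma radius_sqr (x h : R) : radius x h ^ 2 = x ^ 2 + h ^ 2.
Proof. apply pow2_sqrt. nra. Qed.

Lemma is_derive_radius (X H : R -> R) (t dX dH : R) :
  0 < radius (X t) (H t) -> is_derive X t dX -> is_derive H t dH ->
  is_derive (fun r => radius (X r) (H r)) t
    ((X t * dX + H t * dH) / radius (X t) (H t)).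
Proof.
intros Hr HX HH. assert (0 < X t ^ 2 + H t ^ 2).
{ rewrite <- radius_sqr. apply pow_lt, Hr. }
unfold radius in *. auto_derive;
  replace (X t * (X t * 1) + H t * (H t * 1)) with (X t ^ 2 + H t ^ 2) by ring.
- repeat apply conj; try exact I; try assumption; eexists; eassumption.
- rewrite (is_derive_unique (fun r : R => X r) _ _ HX),
    (is_derive_unique (fun r : R => H r) _ _ HH). field. lra.
Qed.

(** The Kepler flow in the variables (xi, eta) and their projective velocities,
    but with respect to spherical time, whence the factor [s]. *)
Definition planar_kepler (a m1 : R) (X H U W : R -> R) : Prop :=
  forall t, let r := radius (X t) (H t) in
    let s := 1 + X t ^ 2 + (a + bfac a * H t) ^ 2 in
    0 < r /\ is_derive X t (s * U t) /\ is_derive H t (s * W t) /\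
    is_derive U t (- m1 * s * (X t / r ^ 3)) /\
    is_derive W t (- m1 * s * (H t / r ^ 3)).

(** The unit vector towards the particle turns at rate w = C s / r^2. Working with this vector
    avoids choosing a polar angle before one has been constructed. *)
Lemma direction_derive (a m1 : R) (X H U W : R -> R) (t : R) :
  planar_kepler a m1 X H U W ->
  let r := radius (X t) (H t) in
  let s := 1 + X t ^ 2 + (a + bfac a * H t) ^ 2 in
  let w := (X t * W t - H t * U t) * (s / r ^ 2) in
  is_derive (fun q => X q / radius (X q) (H q)) t (- w * (H t / r)) /\
  is_derive (fun q => H q / radius (X q) (H q)) t (w * (X t / r)).
Proof.
intros Hp r s w. destruct (Hp t) as [Hr [HX [HH _]]]. fold r in Hr. fold s in HX, HH.
pose proof (is_derive_radius X H t _ _ Hr HX HH) as HR. fold r in HR.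
pose proof (radius_sqr (X t) (H t)) as Hr2. fold r in Hr2.
split; eapply is_derive_eq.
- apply (is_derive_div X (fun q => radius (X q) (H q)) t _ _ HX HR). fold r. lra.
- fold r. unfold w, s. field_simplify_eq; [| lra]. ring [Hr2].
- apply (is_derive_div H (fun q => radius (X q) (H q)) t _ _ HH HR). fold r. lra.
- fold r. unfold w, s. field_simplify_eq; [| lra]. ring [Hr2].
Qed.

(** The force is central, so C is constant; then the velocity and the rotated unit direction have
    proportional derivatives, with the constant ratio m1 / C. The time factor s is common to both
    and drops out, so the integrals are those of the plane. *)
Lemma first_integrals (a m1 : R) (X H U W : R -> R) :
  planar_kepler a m1 X H U W ->
  let C := X 0 * W 0 - H 0 * U 0 in
  let r := fun t => radius (X t) (H t) in
  forall t, X t * W t - H t * U t = C /\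
    C * U t + m1 * (H t / r t) = C * U 0 + m1 * (H 0 / r 0) /\
    m1 * (X t / r t) - C * W t = m1 * (X 0 / r 0) - C * W 0.
Proof.
intros Hp C r.
assert (HC : forall t, X t * W t - H t * U t = C).
{ intro t. apply (derive_zero_constant (fun t => X t * W t - H t * U t)). clear t. intro t.
  destruct (Hp t) as [Hr [HX [HH [HU HW]]]].
  eapply is_derive_eq.
  - auto_derive; [repeat apply conj; try exact I; eexists; eassumption | reflexivity].
  - rewrite (is_derive_unique (fun r : R => X r) _ _ HX),
      (is_derive_unique (fun r : R => H r) _ _ HH),
      (is_derive_unique (fun r : R => U r) _ _ HU),
      (is_derive_unique (fun r : R => W r) _ _ HW). field. lra. }
intro t. split; [apply HC |]. split.
- apply (derive_zero_constant (fun t => C * U t + m1 * (H t / r t))). clear t. intro t.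
  destruct (direction_derive a m1 X H U W t Hp) as [_ Hd]. rewrite HC in Hd.
  destruct (Hp t) as [Hr [HX [HH [HU HW]]]].
  eapply is_derive_eq.
  + apply (is_derive_plus (V := R_NormedModule)); apply is_derive_scal; [exact HU | exact Hd].
  + unfold plus; simpl. field. lra.
- apply (derive_zero_constant (fun t => m1 * (X t / r t) - C * W t)). clear t. intro t.
  destruct (direction_derive a m1 X H U W t Hp) as [Hd _]. rewrite HC in Hd.
  destruct (Hp t) as [Hr [HX [HH [HU HW]]]].
  eapply is_derive_eq.
  + apply (is_derive_minus (V := R_NormedModule)); apply is_derive_scal; [exact Hd | exact HW].
  + unfold minus, plus, opp; simpl. field. lra.
Qed.

(** [theta = - atan (b / r + a sin phi)] is, up to a constant, the central angle
    from the centre; along a radial solution it is bounded while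
    [theta'' <= - m1 b]. *)
Lemma angular_momentum_neq0 (a m1 : R) (X H U W : R -> R) :
  0 < m1 -> planar_kepler a m1 X H U W -> X 0 * W 0 - H 0 * U 0 <> 0.
Proof.
intros Hm Hp HC0. pose proof (bfac_pos a) as Hb. pose proof (bfac_sqr a) as Hb2.

assert (HC : forall t, X t * W t - H t * U t = 0).
{ intro t. rewrite <- HC0. apply (first_integrals a m1 X H U W Hp t). }
set (r := fun t => radius (X t) (H t)).
set (psi := fun t => bfac a / r t + a * (H t / r t)).
set (v := fun t => U t * (X t / r t) + W t * (H t / r t)).
assert (Hdir : forall t, is_derive (fun q => X q / r q) t 0 /\
                         is_derive (fun q => H q / r q) t 0).
{ intro t. destruct (direction_derive a m1 X H U W t Hp) as [H1 H2].
  rewrite HC, Rmult_0_l in H1, H2. rewrite Ropp_0, Rmult_0_l in H1. rewrite Rmult_0_l in H2.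
  exact (conj H1 H2). }
assert (Hs : forall t, 1 + X t ^ 2 + (a + bfac a * H t) ^ 2 = r t ^ 2 * (1 + psi t ^ 2)).
{ intro t. destruct (Hp t) as [Hr _]. pose proof (radius_sqr (X t) (H t)) as Hr2.
  unfold psi, r. field_simplify; [| lra]. rewrite Hr2. ring [Hb2]. }
assert (Hv : forall t, is_derive v t (- m1 * (1 + psi t ^ 2))).
{ intro t. destruct (Hp t) as [Hr [HX [HH [HU HW]]]]. destruct (Hdir t) as [H1 H2].
  rewrite Hs in HU, HW. unfold v. eapply is_derive_eq.
  - apply (is_derive_plus (V := R_NormedModule));
      [apply (is_derive_mult _ _ _ _ _ HU H1); intros; apply Rmult_comm
      | apply (is_derive_mult _ _ _ _ _ HW H2); intros; apply Rmult_comm].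
  - pose proof (radius_sqr (X t) (H t)) as Hr2.
    unfold plus, mult; simpl. fold (r t) in Hr2, Hr |- *.
    field_simplify_eq; [| lra]. ring [Hr2]. }
assert (Htheta : forall t, is_derive (fun q => - atan (psi q)) t (bfac a * v t)).
{ intro t. destruct (Hp t) as [Hr [HX [HH _]]]. destruct (Hdir t) as [_ H2].
  pose proof (is_derive_radius X H t _ _ Hr HX HH) as HR. fold r in HR.
  rewrite Hs in HR.
  assert (Hpsi : is_derive psi t (- bfac a * (1 + psi t ^ 2) * v t)).
  { unfold psi at 1. eapply is_derive_eq.
    - apply (is_derive_plus (V := R_NormedModule)).
      + eapply (is_derive_div (fun _ => bfac a) r t 0); [| exact HR | unfold r; lra].
        apply (is_derive_const (V := R_NormedModule)).
      + apply is_derive_scal. exact H2.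
    - unfold plus; simpl. unfold v. fold (r t). field. unfold r; lra. }
  eapply is_derive_eq.
  - apply (is_derive_opp (V := R_NormedModule)).
    apply (is_derive_comp (V := R_NormedModule)); [| exact Hpsi].
    apply is_derive_Reals, derivable_pt_lim_atan.
  - unfold opp, scal; simpl. unfold mult; simpl. unfold Rsqr. field. nra. }
(* As v' <= - m1, the radial velocity v is at most - 1 from time t0 on. *)
set (t0 := (Rabs (v 0) + 1) / m1).
assert (Ht0 : 0 <= t0) by (apply Rdiv_le_0_compat; [pose proof (Rabs_pos (v 0)); lra | lra]).
assert (Hv1 : forall t, t0 <= t -> v t <= - 1).
{ intros t Ht. destruct (mean_value v _ 0 t Hv) as [c [_ Hc]].
  assert (m1 * t0 = Rabs (v 0) + 1) by (unfold t0; field; lra).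
  pose proof (Rle_abs (v 0)).
  assert (m1 * t0 <= m1 * t) by (apply Rmult_le_compat_l; lra).
  assert (0 <= m1 * t * psi c ^ 2).
  { apply Rmult_le_pos; [apply Rmult_le_pos; lra | apply pow2_ge_0]. }
  lra. }
(* After t0 the angle decreases at speed at least b, hence by at least PI over a time PI / b; but
   two values of [atan] differ by less than PI. *)
set (t1 := t0 + PI / bfac a). pose proof PI_RGT_0.
assert (Ht1 : t0 <= t1) by (unfold t1; pose proof (Rdiv_lt_0_compat _ _ H0 Hb); lra).
destruct (mean_value _ _ t0 t1 Htheta) as [c [Hc1 Hc2]].
rewrite Rmin_left in Hc1 by exact Ht1. pose proof (Hv1 c (proj1 Hc1)).
replace (bfac a * v c * (t1 - t0)) with (v c * PI) in Hc2 by (unfold t1; field; lra).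
assert (v c * PI <= - 1 * PI) by (apply Rmult_le_compat_r; lra).
pose proof (atan_bound (psi t0)). pose proof (atan_bound (psi t1)). lra.
Qed.

(** The conic 1 / r = inv_radius, and the cotangent [psi] of the central angle
    from the Kepler centre along it. *)
Definition inv_radius (m1 k A1 A2 t : R) : R := (m1 - A1 * sin t - A2 * cos t) / k.
Definition psi (a m1 k A1 A2 t : R) : R :=
  conic (bfac a * m1 / k) (bfac a * A1 / k - a) (bfac a * A2 / k) t.

Lemma psiE (a m1 k A1 A2 t : R) : k <> 0 ->
  psi a m1 k A1 A2 t = bfac a * inv_radius m1 k A1 A2 t + a * sin t.
Proof. intros Hk. unfold psi, conic, inv_radius. field. exact Hk. Qed.

Lemma psi_continuous (a m1 k A1 A2 t : R) : continuous (psi a m1 k A1 A2) t.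
Proof.
apply (ex_derive_continuous (K := R_AbsRing) (V := R_NormedModule)).
unfold psi, conic. auto_derive. exact I.
Qed.

(** The scalar product of the Laplace vector with the position is A1 h + A2 x = m1 r - C^2; division
    by C^2 r gives the focal equation of the conic. *)
Lemma polar_conic (m1 x h u w t : R) :
  let r := radius x h in let C := x * w - h * u in
  0 < r -> C <> 0 -> x = r * cos t -> h = r * sin t ->
  inv_radius m1 (C ^ 2) (C * u + m1 * (h / r)) (m1 * (x / r) - C * w) t = / r.
Proof.
intros r C Hr HC Hx Hh. pose proof (sin2_cos2 t) as Ht. unfold Rsqr in Ht.
unfold inv_radius.
replace (h / r) with (sin t) by (rewrite Hh; field; lra).
replace (x / r) with (cos t) by (rewrite Hx; field; lra).
apply Rmult_eq_reg_r with (C ^ 2 * r); [| apply Rmult_integral_contrapositive_currified;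
  [apply pow_nonzero; exact HC | lra]].
transitivity (r * m1 * (1 - (sin t * sin t + cos t * cos t)) +
   C * ((r * cos t) * w - (r * sin t) * u)); [field; exact HC |].
rewrite Ht, <- Hx, <- Hh. fold C. field. lra.
Qed.

(** The sine of the central angle is r divided by the root of the left-hand side, and [psi] is its
    cotangent, so this is 1 / sin^2 = 1 + cot^2. It turns the rate C s / r^2 of the polar angle into
    C (1 + psi^2). *)
Lemma time_factor (a m1 k A1 A2 t r : R) :
  k <> 0 -> 0 < r -> inv_radius m1 k A1 A2 t = / r ->
  1 + (r * cos t) ^ 2 + (a + bfac a * (r * sin t)) ^ 2 =
    r ^ 2 * (1 + psi a m1 k A1 A2 t ^ 2).
Proof.
intros Hk Hr Hu. rewrite psiE by exact Hk. rewrite Hu.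
pose proof (bfac_sqr a) as Hb2.
assert (Hc : cos t ^ 2 = 1 - sin t ^ 2) by (pose proof (sin2_cos2 t); unfold Rsqr in *; lra).
field_simplify_eq; [| lra]. ring [Hc Hb2].
Qed.

(** A continuous polar angle is obtained by integrating its prospective rate w. The scalar product
    of (cos phi, sin phi) with the unit direction has derivative zero and starts at 1, and two unit
    vectors with scalar product 1 coincide. *)
Lemma polar_motion (a m1 : R) (X H U W : R -> R) :
  planar_kepler a m1 X H U W ->
  let r := fun t => radius (X t) (H t) in
  let C := X 0 * W 0 - H 0 * U 0 in
  let A1 := C * U 0 + m1 * (H 0 / r 0) in
  let A2 := m1 * (X 0 / r 0) - C * W 0 in
  C <> 0 ->
  exists phi : R -> R, forall t,
    is_derive phi t (C * (1 + psi a m1 (C ^ 2) A1 A2 (phi t) ^ 2)) /\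
    X t = r t * cos (phi t) /\ H t = r t * sin (phi t) /\
    inv_radius m1 (C ^ 2) A1 A2 (phi t) = / r t.
Proof.
intros Hp r C A1 A2 HC.
assert (Hr : forall t, 0 < r t) by (intro t; apply (Hp t)).
assert (Hr2 : forall t, r t ^ 2 = X t ^ 2 + H t ^ 2) by (intro t; apply radius_sqr).
set (w := fun t => C * ((1 + X t ^ 2 + (a + bfac a * H t) ^ 2) / r t ^ 2)).
assert (Hdir : forall t, is_derive (fun q => X q / r q) t (- w t * (H t / r t)) /\
                         is_derive (fun q => H q / r q) t (w t * (X t / r t))).
{ intro t. destruct (direction_derive a m1 X H U W t Hp) as [H1 H2].
  rewrite (proj1 (first_integrals a m1 X H U W Hp t)) in H1, H2. split; assumption. }
assert (Hw : forall t, continuous w t).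
{ intro t. destruct (Hp t) as [_ [HX [HH _]]]. unfold w.
  apply (ex_derive_continuous (K := R_AbsRing) (V := R_NormedModule)).
  assert (HR : ex_derive r t)
    by (eexists; apply (is_derive_radius X H t _ _ (Hr t) HX HH)).
  auto_derive. repeat apply conj; try exact I; try (eexists; eassumption); try exact HR.
  rewrite Rmult_1_r. pose proof (Hr t). nra. }
destruct (cos_sin_angle (X 0 / r 0) (H 0 / r 0)) as [phi0 [Hc0 Hs0]].
{ pose proof (Hr 0). field_simplify_eq; [| lra]. rewrite Hr2. ring. }
set (phi := fun t => phi0 + RInt w 0 t).
assert (Hphi : forall t, is_derive phi t (w t)).
{ intro t. unfold phi. rewrite <- (Rplus_0_l (w t)).
  apply (is_derive_plus (V := R_NormedModule));
    [apply (is_derive_const (V := R_NormedModule)) |].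
  apply (is_derive_RInt (V := R_NormedModule) w (fun t => RInt w 0 t) 0); [| apply Hw].
  apply filter_forall. intro y. apply (RInt_correct (V := R_CompleteNormedModule)).
  apply (ex_RInt_continuous (V := R_CompleteNormedModule)). intros z _. apply Hw. }
assert (Hphi0 : phi 0 = phi0) by (unfold phi; rewrite RInt_point; unfold zero; simpl; ring).
assert (Hone : forall t, X t / r t * cos (phi t) + H t / r t * sin (phi t) = 1).
{ intro t.
  transitivity (X 0 / r 0 * cos (phi 0) + H 0 / r 0 * sin (phi 0)).
  - apply (derive_zero_constant
      (fun t => X t / r t * cos (phi t) + H t / r t * sin (phi t))). clear t. intro t.
    destruct (Hdir t) as [H1 H2].
    assert (Hcos : is_derive (fun q => cos (phi q)) t (w t * (- sin (phi t)))).
    { apply (is_derive_comp (V := R_NormedModule)); [| apply Hphi].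
      apply is_derive_Reals, derivable_pt_lim_cos. }
    assert (Hsin : is_derive (fun q => sin (phi q)) t (w t * cos (phi t))).
    { apply (is_derive_comp (V := R_NormedModule)); [| apply Hphi].
      apply is_derive_Reals, derivable_pt_lim_sin. }
    eapply is_derive_eq.
    + apply (is_derive_plus (V := R_NormedModule));
      [apply (is_derive_mult _ _ _ _ _ H1 Hcos); intros; apply Rmult_comm
      | apply (is_derive_mult _ _ _ _ _ H2 Hsin); intros; apply Rmult_comm].
    + unfold plus, mult; simpl. ring.
  - rewrite Hphi0, Hc0, Hs0. pose proof (sin2_cos2 phi0). unfold Rsqr in *. lra. }
assert (Hpol : forall t, X t = r t * cos (phi t) /\ H t = r t * sin (phi t)).
{ intro t. pose proof (Hr t) as Hrt. pose proof (sin2_cos2 (phi t)) as Hsc.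
  assert (Hn : (X t / r t) ^ 2 + (H t / r t) ^ 2 = 1)
    by (field_simplify_eq; [rewrite Hr2; ring | lra]).
  pose proof (Hone t) as Ho. unfold Rsqr in Hsc.
  assert (X t / r t = cos (phi t) /\ H t / r t = sin (phi t)) as [E1 E2].
  { assert (Hz : (X t / r t - cos (phi t)) ^ 2 + (H t / r t - sin (phi t)) ^ 2 = 0) by nra.
    pose proof (pow2_ge_0 (X t / r t - cos (phi t))).
    pose proof (pow2_ge_0 (H t / r t - sin (phi t))).
    split; apply Rminus_diag_uniq, Rsqr_0_uniq; unfold Rsqr; lra. }
  rewrite <- E1, <- E2. split; field; lra. }
exists phi. intro t. destruct (Hpol t) as [HX HH].
assert (Hu : inv_radius m1 (C ^ 2) A1 A2 (phi t) = / r t).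
{ destruct (first_integrals a m1 X H U W Hp t) as [E0 [E1 E2]].
  fold C in E0, E1, E2. fold A1 in E1. fold A2 in E2.
  pose proof (polar_conic m1 (X t) (H t) (U t) (W t) (phi t)) as Hq. cbv zeta in Hq.
  rewrite E0, E1, E2 in Hq. apply Hq; [apply Hr | exact HC | exact HX | exact HH]. }
split; [| split; [exact HX | split; [exact HH | exact Hu]]].
eapply is_derive_eq; [apply Hphi |]. unfold w. rewrite HX, HH at 1.
rewrite (time_factor a m1 (C ^ 2) A1 A2 (phi t) (r t));
  [field; apply Rgt_not_eq, Hr | apply pow_nonzero, HC | apply Hr | exact Hu].
Qed.

(** The rate of phi has modulus at least |C|, so a motion defined for all times sweeps every angle.
    For negative C the argument is applied to - phi. *)
Lemma polar_surjective (F : R -> R) (phi : R -> R) (C : R) :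
  C <> 0 -> (forall t, continuous F t) ->
  (forall t, is_derive phi t (C * (1 + F (phi t) ^ 2))) ->
  forall y, exists t, phi t = y.
Proof.
intros HC HF Hphi y.
assert (Hc : forall t, continuous (fun t => Rabs C * (1 + F (phi t) ^ 2)) t).
{ intro t. apply (continuous_mult (K := R_AbsRing)); [apply continuous_const |].
  apply (continuous_plus (V := R_NormedModule)); [apply continuous_const |].
  apply (continuous_comp (fun t => F (phi t)) (fun v => v ^ 2)).
  - apply (continuous_comp phi F); [| apply HF].
    eapply is_derive_continuous. apply Hphi.
  - apply (ex_derive_continuous (K := R_AbsRing) (V := R_NormedModule)).
    auto_derive. exact I. }
assert (Hlow : forall t, Rabs C <= Rabs C * (1 + F (phi t) ^ 2)).
{ intro t. pose proof (Rabs_pos C). pose proof (pow2_ge_0 (F (phi t))). nra. }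
destruct (Rlt_dec 0 C) as [Hpos | Hneg].
- destruct (inverse_function phi (fun t => Rabs C * (1 + F (phi t) ^ 2)) (Rabs C)
    (Rabs_pos_lt C HC)) with (2 := Hc) (3 := Hlow)
    as [Psi [HPsi _]].
  + intro t. rewrite (Rabs_pos_eq C) by lra. apply Hphi.
  + exists (Psi y). apply HPsi.
- destruct (inverse_function (fun t => - phi t) (fun t => Rabs C * (1 + F (phi t) ^ 2))
    (Rabs C) (Rabs_pos_lt C HC))
    with (2 := Hc) (3 := Hlow) as [Psi [HPsi _]].
  + intro t. rewrite (Rabs_left C) by lra. rewrite <- Ropp_mult_distr_l.
    apply (is_derive_opp (V := R_NormedModule)). apply Hphi.
  + exists (Psi (- y)). pose proof (HPsi (- y)). lra.
Qed.

(** * From orbits in the tangent bundle to the planar system, and the region *)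

Lemma EsKep_partials (a m1 : R) (z : tpoint) :
  let x := can_x z in let y := can_y z in let p := can_px z in let q := can_py z in
  0 < rho a x y ->
  is_derive (along_x (EsKep a m1) z) x (kepler_dx a m1 x y p q) /\
  is_derive (along_y (EsKep a m1) z) y (kepler_dy a m1 x y p q) /\
  is_derive (along_px (EsKep a m1) z) p ((1 + x ^ 2 + y ^ 2) * vx x y p q) /\
  is_derive (along_py (EsKep a m1) z) q ((1 + x ^ 2 + y ^ 2) * (bfac a * vy a x y p q)).
Proof.
intros x y p q Hr. destruct (kepler_energy_partials a m1 x y p q Hr) as [H1 [H2 [H3 H4]]].
refine (conj _ (conj _ (conj _ _)));
  [revert H1 | revert H2 | revert H3 | revert H4]; apply is_derive_ext;
  intro s; symmetry; apply EsKep_of_can.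
Qed.

Lemma chart_injective (x y x' y' : R) : chart x y = chart x' y' -> x = x' /\ y = y'.
Proof.
intros H. destruct (of_can_correct x y 0 0) as [_ [E1 [E2 _]]].
destruct (of_can_correct x' y' 0 0) as [_ [E1' [E2' _]]].
unfold can_x, can_y, of_can in *; cbn [pos] in *. rewrite H in E1, E2.
split; congruence.
Qed.

Lemma Z1_chart (a : R) : Z1 a = chart 0 a.
Proof.
unfold Z1, chart, vscal; cbn [c1 c2 c3]. fold (bfac a).
replace (sqrt (1 + 0 ^ 2 + a ^ 2)) with (bfac a)
  by (unfold bfac; replace (1 + 0 ^ 2 + a ^ 2) with (1 + a ^ 2) by ring; reflexivity).
pose proof (bfac_pos a). apply vec3_ext; cbn [c1 c2 c3]; field; lra.
Qed.

Lemma Z2_chart (a : R) : Z2 a = chart 0 (- a).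
Proof.
rewrite <- Z1_chart. unfold Z1, Z2. replace ((- a) ^ 2) with (a ^ 2) by ring. reflexivity.
Qed.

Lemma rho_pos_iff (a x y : R) : 0 < rho a x y <-> chart x y <> Z1 a.
Proof.
rewrite Z1_chart. pose proof (bfac_pos a) as Hb. split.
- intros Hr Hc. destruct (chart_injective _ _ _ _ Hc) as [-> ->].
  pose proof (rho_sqr a 0 a) as H2. unfold eta in H2.
  replace ((a - a) / bfac a) with 0 in H2 by (field; lra). nra.
- intros Hc. destruct (Rle_lt_or_eq_dec 0 (rho a x y) (sqrt_pos _)) as [| H0];
    [assumption | exfalso; apply Hc].
  pose proof (rho_sqr a x y) as H2. rewrite <- H0 in H2.
  assert (Hx : x = 0) by nra. assert (He : eta a y = 0) by nra.
  assert (y = a + bfac a * eta a y) by (unfold eta; field; lra).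
  rewrite He in H. rewrite Hx, H. f_equal; ring.
Qed.

Lemma is_derive_eta (a : R) (Y : R -> R) (t l : R) :
  is_derive Y t l -> is_derive (fun s => eta a (Y s)) t (l / bfac a).
Proof.
intros HY. unfold eta. auto_derive; [eexists; exact HY |].
rewrite (is_derive_unique (fun s : R => Y s) _ _ HY). unfold Rdiv. ring.
Qed.

Lemma orbit_planar (a m1 : R) (g : R -> tpoint) :
  hamiltonian_orbit (EsKep a m1) g -> (forall t, pos (g t) <> Z1 a) ->
  planar_kepler a m1 (fun t => can_x (g t)) (fun t => eta a (can_y (g t)))
    (fun t => vx (can_x (g t)) (can_y (g t)) (can_px (g t)) (can_py (g t)))
    (fun t => vy a (can_x (g t)) (can_y (g t)) (can_px (g t)) (can_py (g t))).
Proof.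
intros Hg Hpos t. cbv zeta. destruct (Hg t) as [HT [HX [HY [HP HQ]]]].
assert (Hr : 0 < rho a (can_x (g t)) (can_y (g t))).
{ apply rho_pos_iff. rewrite <- pos_coordinates by exact HT. apply Hpos. }
destruct (EsKep_partials a m1 (g t) Hr) as [D1 [D2 [D3 D4]]].
unfold d_x, d_y, d_px, d_py in *.
rewrite (is_derive_unique _ _ _ D3) in HX. rewrite (is_derive_unique _ _ _ D4) in HY.
rewrite (is_derive_unique _ _ _ D1) in HP. rewrite (is_derive_unique _ _ _ D2) in HQ.
pose proof (bfac_pos a) as Hb.
replace (a + bfac a * eta a (can_y (g t))) with (can_y (g t)) by (unfold eta; field; lra).
change (radius (can_x (g t)) (eta a (can_y (g t)))) with (rho a (can_x (g t)) (can_y (g t))).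
destruct (hamilton_planar a m1 _ _ _ _ t Hr HX HY HP HQ) as [HU HW].
split; [exact Hr | split; [exact HX | split; [| split; [exact HU | exact HW]]]].
eapply is_derive_eq; [apply (is_derive_eta a _ _ _ HY) | field; lra].
Qed.

(** The last condition says that the Kepler conic avoids the second centre,
    which lies on it exactly when [D = 2 a m1 / b]. *)
Definition admissible (a m1 x y p q : R) : Prop :=
  0 < rho a x y /\ ang a x y p q <> 0 /\
  lap1 a m1 x y p q ^ 2 + lap2 a m1 x y p q ^ 2 < m1 ^ 2 /\
  ang a x y p q ^ 2 - 2 * a / bfac a * lap1 a m1 x y p q <> 2 * a / bfac a * m1.

(** It suffices to test the angle of the Laplace vector, where 1 / r takes its least value (m1 -
    |A|) / k. *)
Lemma inv_radius_pos_all (m1 k A1 A2 : R) : 0 < m1 -> 0 < k ->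
  (forall t, 0 < inv_radius m1 k A1 A2 t) -> A1 ^ 2 + A2 ^ 2 < m1 ^ 2.
Proof.
intros Hm Hk Hu. set (A := sqrt (A1 ^ 2 + A2 ^ 2)).
assert (HA2 : A ^ 2 = A1 ^ 2 + A2 ^ 2)
  by (apply pow2_sqrt; pose proof (pow2_ge_0 A1); pose proof (pow2_ge_0 A2); lra).
assert (HA : 0 <= A) by apply sqrt_pos.
rewrite <- HA2. destruct (Req_dec A 0) as [-> | HA0]; [nra |].
destruct (cos_sin_angle (A2 / A) (A1 / A)) as [t [Hc Hs]].
{ field_simplify_eq; [lra | exact HA0]. }
specialize (Hu t). unfold inv_radius in Hu. rewrite <- Hc, <- Hs in Hu.
replace ((m1 - A1 * (A1 / A) - A2 * (A2 / A)) / k) with ((m1 - A) / k) in Hu.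
- assert (0 < (m1 - A) / k * k) by (apply Rmult_lt_0_compat; lra).
  replace ((m1 - A) / k * k) with (m1 - A) in H by (field; lra). nra.
- field_simplify_eq; [| split; lra]. rewrite HA2. ring.
Qed.

(** Completeness of the orbit is what is used: every polar angle is attained at some time, so
    properties of the single orbit through z become properties of the whole conic. *)
Lemma Rs_admissible (a m1 : R) (z : tpoint) : 0 < a -> 0 < m1 -> Rs a m1 z ->
  admissible a m1 (can_x z) (can_y z) (can_px z) (can_py z).
Proof.
intros Ha Hm [g [[<- [Hg H1]] H2]]. pose proof (bfac_pos a) as Hb.
pose proof (orbit_planar a m1 g Hg H1) as Hp.
pose proof (angular_momentum_neq0 a m1 _ _ _ _ Hm Hp) as HC.
destruct (polar_motion a m1 _ _ _ _ Hp HC) as [phi Hphi].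
change (ang a (can_x (g 0)) (can_y (g 0)) (can_px (g 0)) (can_py (g 0)) <> 0) in HC.
assert (Hr : forall t, 0 < rho a (can_x (g t)) (can_y (g t))) by (intro t; apply (Hp t)).
set (C := ang a (can_x (g 0)) (can_y (g 0)) (can_px (g 0)) (can_py (g 0))) in *.
set (A1 := lap1 a m1 (can_x (g 0)) (can_y (g 0)) (can_px (g 0)) (can_py (g 0))).
set (A2 := lap2 a m1 (can_x (g 0)) (can_y (g 0)) (can_px (g 0)) (can_py (g 0))).
assert (Hk : 0 < C ^ 2) by (pose proof (pow2_ge_0 C); pose proof (pow_nonzero C 2 HC); lra).
assert (Hsurj : forall s, exists t, phi t = s).
{ apply (polar_surjective (psi a m1 (C ^ 2) A1 A2) phi C HC).
  - intro t. apply psi_continuous.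
  - intro t. exact (proj1 (Hphi t)). }
refine (conj (Hr 0) (conj HC (conj _ _))); fold C A1 A2.
- apply (inv_radius_pos_all m1 (C ^ 2)); [exact Hm | exact Hk |].
  intro s. destruct (Hsurj s) as [t <-]. destruct (Hphi t) as [_ [_ [_ Hu]]].
  change (inv_radius m1 (C ^ 2) A1 A2 (phi t) = / rho a (can_x (g t)) (can_y (g t))) in Hu.
  rewrite Hu. apply Rinv_0_lt_compat, Hr.
(* Seen from the focus, Z2 is the point xi = 0, eta = - 2 a / b, in the direction - PI / 2. There
   the conic has r = C^2 / (m1 + A1), and the excluded value of D makes this 2 a / b. *)
- intros HD. destruct (Hsurj (- (PI / 2))) as [t Ht].
  destruct (Hphi t) as [_ [HX [HY Hu]]].
  change (inv_radius m1 (C ^ 2) A1 A2 (phi t) = / rho a (can_x (g t)) (can_y (g t))) in Hu.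
  change (can_x (g t) = rho a (can_x (g t)) (can_y (g t)) * cos (phi t)) in HX.
  change (eta a (can_y (g t)) = rho a (can_x (g t)) (can_y (g t)) * sin (phi t)) in HY.
  apply (H2 t). destruct (Hg t) as [HT _]. rewrite (pos_coordinates _ HT), Z2_chart.
  rewrite Ht, cos_neg, cos_PI2 in HX. rewrite Ht, sin_neg, sin_PI2 in HY.
  rewrite Ht in Hu. unfold inv_radius in Hu. rewrite sin_neg, sin_PI2, cos_neg, cos_PI2 in Hu.
  specialize (Hr t). set (r := rho a (can_x (g t)) (can_y (g t))) in *.
  assert (Hr' : r = 2 * a / bfac a).
  { assert (HA1 : C ^ 2 = 2 * a / bfac a * (m1 + A1)) by lra.
    assert (m1 + A1 <> 0) by (intro H0; rewrite H0 in HA1; lra).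
    rewrite <- (Rinv_inv r), <- Hu, HA1. field. repeat split; lra. }
  rewrite Hr' in HX, HY.
  assert (Hy : can_y (g t) = a + bfac a * eta a (can_y (g t))) by (unfold eta; field; lra).
  rewrite HY in Hy. replace (can_y (g t)) with (- a) by (rewrite Hy; field; lra).
  rewrite HX. f_equal. ring.
Qed.

(** * The Kepler flow and its period *)

(** Position from the focal equation, velocity from solving the two Laplace components for it, which
    describes the circular hodograph. *)
Definition kepler_state (a m1 C A1 A2 t : R) : tpoint :=
  let r := / inv_radius m1 (C ^ 2) A1 A2 t in
  let x := r * cos t in
  let y := a + bfac a * (r * sin t) in
  let v := (A1 - m1 * sin t) / C in
  let w := bfac a * ((m1 * cos t - A2) / C) in
  of_can x y (mom_x x y v w) (mom_y x y v w).

Lemma momentum_velocity (a x y p q : R) :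
  mom_x x y (vx x y p q) (bfac a * vy a x y p q) = p /\
  mom_y x y (vx x y p q) (bfac a * vy a x y p q) = q.
Proof.
pose proof (bfac_pos a). assert (1 + x ^ 2 + y ^ 2 <> 0) by nra.
unfold vx, vy, mom_x, mom_y. split; field; split; lra.
Qed.

Lemma kepler_state_of_can (a m1 x y p q t : R) :
  let r := rho a x y in
  let C := ang a x y p q in
  let A1 := lap1 a m1 x y p q in
  let A2 := lap2 a m1 x y p q in
  0 < r -> C <> 0 -> x = r * cos t -> eta a y = r * sin t ->
  inv_radius m1 (C ^ 2) A1 A2 t = / r ->
  kepler_state a m1 C A1 A2 t = of_can x y p q.
Proof.
intros r C A1 A2 Hr HC Hx Hy Hu. pose proof (bfac_pos a) as Hb.
unfold kepler_state. rewrite Hu, Rinv_inv, <- Hx, <- Hy.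
replace (a + bfac a * eta a y) with y by (unfold eta; field; lra).
assert (Hc : x / r = cos t) by (rewrite Hx; field; lra).
assert (Hs : eta a y / r = sin t) by (rewrite Hy; field; lra).
replace ((A1 - m1 * sin t) / C) with (vx x y p q)
  by (unfold A1, lap1; fold r C; rewrite Hs; field; exact HC).
replace ((m1 * cos t - A2) / C) with (vy a x y p q)
  by (unfold A2, lap2; fold r C; rewrite Hc; field; exact HC).
destruct (momentum_velocity a x y p q) as [-> ->]. reflexivity.
Qed.

Lemma inv_radius_pos (m1 k A1 A2 t : R) :
  0 < m1 -> 0 < k -> A1 ^ 2 + A2 ^ 2 < m1 ^ 2 -> 0 < inv_radius m1 k A1 A2 t.
Proof.
intros Hm Hk HA. unfold inv_radius. apply Rdiv_lt_0_compat; [| exact Hk].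
pose proof (sin2_cos2 t) as Ht. unfold Rsqr in Ht.
assert ((A1 * sin t + A2 * cos t) ^ 2 <= A1 ^ 2 + A2 ^ 2).
{ replace (A1 ^ 2 + A2 ^ 2) with ((A1 ^ 2 + A2 ^ 2) * (sin t * sin t + cos t * cos t))
    by (rewrite Ht; ring).
  pose proof (pow2_ge_0 (A1 * cos t - A2 * sin t)). lra. }
assert (A1 * sin t + A2 * cos t < m1); [| lra].
apply Rnot_le_lt. intro. nra.
Qed.

Lemma polar_angle (a m1 x y p q : R) :
  0 < rho a x y -> ang a x y p q <> 0 ->
  exists t, x = rho a x y * cos t /\ eta a y = rho a x y * sin t /\
    inv_radius m1 (ang a x y p q ^ 2) (lap1 a m1 x y p q) (lap2 a m1 x y p q) t
      = / rho a x y.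
Proof.
intros Hr HC. pose proof (rho_sqr a x y) as Hr2.
destruct (cos_sin_angle (x / rho a x y) (eta a y / rho a x y)) as [t [Hc Hs]].
{ field_simplify_eq; [| lra]. lra. }
assert (Hx : x = rho a x y * cos t) by (rewrite <- Hc; field; lra).
assert (Hy : eta a y = rho a x y * sin t) by (rewrite <- Hs; field; lra).
exists t. split; [exact Hx | split; [exact Hy |]].
exact (polar_conic m1 x (eta a y) (vx x y p q) (vy a x y p q) t Hr HC Hx Hy).
Qed.

(** Uniqueness of orbits enters here without a theorem on differential equations: the three first
    integrals and the polar angle determine the state. It holds for whatever orbit the choice in
    [kepler_flow] returns. *)
Lemma orbit_state (a m1 x y p q : R) (g : R -> tpoint) :
  let C := ang a x y p q in
  let A1 := lap1 a m1 x y p q in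
  let A2 := lap2 a m1 x y p q in
  C <> 0 -> kepler_orbit a m1 (of_can x y p q) g ->
  exists phi : R -> R, forall t,
    is_derive phi t (C * (1 + psi a m1 (C ^ 2) A1 A2 (phi t) ^ 2)) /\
    g t = kepler_state a m1 C A1 A2 (phi t).
Proof.
intros C A1 A2 HC [H0 [Hg Hpos]].
pose proof (orbit_planar a m1 g Hg Hpos) as Hp.
destruct (of_can_correct x y p q) as [_ [Ex [Ey [Epx Epy]]]].
rewrite <- H0 in Ex, Ey, Epx, Epy.
pose proof (polar_motion a m1 _ _ _ _ Hp) as Hm. cbv zeta beta in Hm.
pose proof (first_integrals a m1 _ _ _ _ Hp) as Hf. cbv zeta beta in Hf.
rewrite Ex, Ey, Epx, Epy in Hm, Hf.
destruct (Hm HC) as [phi Hphi]. exists phi. intro t.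
destruct (Hphi t) as [D [HX [HY Hu]]]. split; [exact D |].
destruct (Hf t) as [F0 [F1 F2]].
assert (E0 : ang a (can_x (g t)) (can_y (g t)) (can_px (g t)) (can_py (g t)) = C)
  by exact F0.
assert (E1 : lap1 a m1 (can_x (g t)) (can_y (g t)) (can_px (g t)) (can_py (g t)) = A1)
  by (unfold lap1; rewrite E0; exact F1).
assert (E2 : lap2 a m1 (can_x (g t)) (can_y (g t)) (can_px (g t)) (can_py (g t)) = A2)
  by (unfold lap2; rewrite E0; exact F2).
destruct (Hg t) as [HT _]. rewrite <- (of_can_coordinates _ HT) at 1.
rewrite <- E0, <- E1, <- E2. symmetry. apply kepler_state_of_can.
- apply (Hp t).
- rewrite E0. exact HC.
- exact HX.
- exact HY.
- rewrite E0, E1, E2. exact Hu.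
Qed.

Definition time_density (a m1 k A1 A2 t : R) : R := / (1 + psi a m1 k A1 A2 t ^ 2).

Lemma time_density_continuous (a m1 k A1 A2 t : R) :
  continuous (time_density a m1 k A1 A2) t.
Proof.
unfold time_density. apply continuous_Rinv_comp; [| nra].
apply (continuous_plus (V := R_NormedModule)); [apply continuous_const |].
apply (continuous_comp (psi a m1 k A1 A2) (fun v => v ^ 2)); [apply psi_continuous |].
apply (ex_derive_continuous (K := R_AbsRing) (V := R_NormedModule)). auto_derive. exact I.
Qed.

(** [psi] is a bounded trigonometric polynomial. The lower bound is the one that [inverse_function]
    demands of the slope of [time_law]. *)
Lemma time_density_lower (a m1 k A1 A2 : R) :
  exists m, 0 < m /\ forall t, m <= time_density a m1 k A1 A2 t.
Proof.
set (B := Rabs (bfac a * m1 / k) + Rabs (bfac a * A1 / k - a) + Rabs (bfac a * A2 / k)).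
assert (HB : forall t, Rabs (psi a m1 k A1 A2 t) <= B).
{ intro t. unfold psi, conic, B, Rminus.
  assert (forall u v, Rabs v <= 1 -> Rabs (- (u * v)) <= Rabs u) as Hle.
  { intros u v Hv. rewrite Rabs_Ropp, Rabs_mult.
    pose proof (Rabs_pos u). pose proof (Rabs_pos v). nra. }
  eapply Rle_trans; [apply Rabs_triang |]. apply Rplus_le_compat.
  - eapply Rle_trans; [apply Rabs_triang |]. apply Rplus_le_compat; [apply Rle_refl |].
    apply Hle, Rabs_le, SIN_bound.
  - apply Hle, Rabs_le, COS_bound. }
exists (/ (1 + B ^ 2)). split; [apply Rinv_0_lt_compat; nra |].
intro t. unfold time_density. apply Rinv_le_contravar; [nra |].
apply Rplus_le_compat_l. rewrite <- (pow2_abs (psi a m1 k A1 A2 t)).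
apply pow_incr. split; [apply Rabs_pos | apply HB].
Qed.

Lemma time_density_pos (a m1 k A1 A2 t : R) : 0 < time_density a m1 k A1 A2 t.
Proof. apply Rinv_0_lt_compat. nra. Qed.

(** The counterpart of Kepler's equation: C times the time elapsed, as a function of the polar
    angle. *)
Definition time_law (a m1 k A1 A2 t : R) : R := RInt (time_density a m1 k A1 A2) 0 t.

Lemma time_density_ex_RInt (a m1 k A1 A2 u v : R) :
  ex_RInt (time_density a m1 k A1 A2) u v.
Proof.
apply (ex_RInt_continuous (V := R_CompleteNormedModule)). intros z _.
apply time_density_continuous.
Qed.

Lemma is_derive_time_law (a m1 k A1 A2 t : R) :
  is_derive (time_law a m1 k A1 A2) t (time_density a m1 k A1 A2 t).
Proof.
apply (is_derive_RInt (V := R_NormedModule) _ (time_law a m1 k A1 A2) 0).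
- apply filter_forall. intro y. apply (RInt_correct (V := R_CompleteNormedModule)).
  apply time_density_ex_RInt.
- apply time_density_continuous.
Qed.

Lemma sin_shift (t : R) : sin (t + 2 * PI) = sin t.
Proof. rewrite sin_plus, sin_2PI, cos_2PI. ring. Qed.

Lemma cos_shift (t : R) : cos (t + 2 * PI) = cos t.
Proof. rewrite cos_plus, sin_2PI, cos_2PI. ring. Qed.

Lemma time_density_shift (a m1 k A1 A2 t : R) :
  time_density a m1 k A1 A2 (t + 2 * PI) = time_density a m1 k A1 A2 t.
Proof. unfold time_density, psi, conic. rewrite sin_shift, cos_shift. reflexivity. Qed.

Lemma kepler_state_shift (a m1 C A1 A2 t : R) :
  kepler_state a m1 C A1 A2 (t + 2 * PI) = kepler_state a m1 C A1 A2 t.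
Proof.
unfold kepler_state, inv_radius. rewrite sin_shift, cos_shift. reflexivity.
Qed.

Lemma time_law_shift (a m1 k A1 A2 t : R) :
  time_law a m1 k A1 A2 (t + 2 * PI) =
    time_law a m1 k A1 A2 t + time_law a m1 k A1 A2 (2 * PI).
Proof.
pose proof (RInt_period_shift (time_density a m1 k A1 A2) (2 * PI) t
  (time_density_continuous a m1 k A1 A2) (time_density_shift a m1 k A1 A2)) as H.
unfold time_law. rewrite <- H. symmetry.
apply (RInt_Chasles (V := R_CompleteNormedModule)); apply time_density_ex_RInt.
Qed.

Lemma time_law_increasing (a m1 k A1 A2 s t : R) :
  s < t -> time_law a m1 k A1 A2 s < time_law a m1 k A1 A2 t.
Proof.
intros H. destruct (mean_value _ _ s t (is_derive_time_law a m1 k A1 A2)) as [c [_ Hc]].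
assert (0 < time_density a m1 k A1 A2 c * (t - s)); [| lra].
apply Rmult_lt_0_compat; [apply time_density_pos | lra].
Qed.

Lemma time_law_injective (a m1 k A1 A2 s t : R) :
  time_law a m1 k A1 A2 s = time_law a m1 k A1 A2 t -> s = t.
Proof.
intros H. destruct (Rtotal_order s t) as [L | [E | L]]; [| exact E |];
  apply (time_law_increasing a m1 k A1 A2) in L; lra.
Qed.

Lemma time_law_motion (a m1 k A1 A2 C : R) (phi : R -> R) :
  (forall t, is_derive phi t (C * (1 + psi a m1 k A1 A2 (phi t) ^ 2))) ->
  forall t, time_law a m1 k A1 A2 (phi t) = time_law a m1 k A1 A2 (phi 0) + C * t.
Proof.
intros Hphi t.
assert (H : forall t, is_derive (fun t => time_law a m1 k A1 A2 (phi t)) t C).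
{ intro s. eapply is_derive_eq.
  - apply (is_derive_comp (V := R_NormedModule)); [apply is_derive_time_law | apply Hphi].
  - unfold scal; simpl. unfold mult; simpl. unfold time_density. field. nra. }
destruct (mean_value _ (fun _ => C) 0 t H) as [c [_ Hc]]. lra.
Qed.

(** * Construction of the orbit by quadrature *)

Lemma planar_orbit (a m1 : R) (X Y U W : R -> R) :
  (forall t, let x := X t in let y := Y t in let s := 1 + x ^ 2 + y ^ 2 in
    0 < rho a x y /\
    is_derive X t (s * U t) /\ is_derive Y t (s * (bfac a * W t)) /\
    is_derive U t (- m1 * s * (x / rho a x y ^ 3)) /\
    is_derive W t (- m1 * s * (eta a y / rho a x y ^ 3))) ->
  let g := fun t => of_can (X t) (Y t) (mom_x (X t) (Y t) (U t) (bfac a * W t))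
                      (mom_y (X t) (Y t) (U t) (bfac a * W t)) in
  hamiltonian_orbit (EsKep a m1) g /\ (forall t, pos (g t) <> Z1 a).
Proof.
intros Hder g.
set (P := fun t => mom_x (X t) (Y t) (U t) (bfac a * W t)).
set (Q := fun t => mom_y (X t) (Y t) (U t) (bfac a * W t)).
assert (Hc : forall t, TS2SH (g t) /\ can_x (g t) = X t /\ can_y (g t) = Y t /\
   can_px (g t) = P t /\ can_py (g t) = Q t) by (intro t; apply of_can_correct).
split; intro t; destruct (Hder t) as [Hr [HX [HY [HU HW]]]].
- destruct (Hc t) as [HT [Ex [Ey [Ep Eq]]]].
  destruct (EsKep_partials a m1 (g t)) as [D1 [D2 [D3 D4]]]; [rewrite Ex, Ey; exact Hr |].
  destruct (planar_hamilton a m1 X Y U W t Hr HX HY HU HW) as [HP HQ].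
  destruct (velocity_momentum a (X t) (Y t) (U t) (W t)) as [Ev Ew].
  unfold d_x, d_y, d_px, d_py.
  rewrite (is_derive_unique _ _ _ D1), (is_derive_unique _ _ _ D2),
    (is_derive_unique _ _ _ D3), (is_derive_unique _ _ _ D4).
  rewrite Ex, Ey, Ep, Eq. fold (P t) (Q t) in Ev, Ew. rewrite Ev, Ew.
  refine (conj HT (conj _ (conj _ (conj _ _))));
    [ apply (is_derive_ext X) | apply (is_derive_ext Y)
    | apply (is_derive_ext P) | apply (is_derive_ext Q) ];
    try assumption; intro s; symmetry; apply (Hc s).
- change (pos (g t)) with (chart (X t) (Y t)). apply rho_pos_iff. exact Hr.
Qed.

(** Differentiating the average at a point of the region involves nearby points, for which
    membership in the region is not given. At these the flow must still be a genuine orbit, so one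
    is built from admissibility alone by inverting the time law. *)
Lemma kepler_orbit_exists (a m1 x y p q : R) :
  0 < m1 -> admissible a m1 x y p q -> exists g, kepler_orbit a m1 (of_can x y p q) g.
Proof.
intros Hm [Hr [HC [HA _]]].
destruct (polar_angle a m1 x y p q Hr HC) as [t0 [Hx0 [Hy0 Hu0]]].
pose proof (kepler_state_of_can a m1 x y p q t0 Hr HC Hx0 Hy0 Hu0) as Hstate.
revert HC HA Hstate. clear - Hm.
generalize (ang a x y p q) (lap1 a m1 x y p q) (lap2 a m1 x y p q).
intros C A1 A2 HC HA Hstate.
pose proof (bfac_pos a) as Hb.
assert (Hk : 0 < C ^ 2) by (pose proof (pow2_ge_0 C); pose proof (pow_nonzero C 2 HC); lra).
destruct (time_density_lower a m1 (C ^ 2) A1 A2) as [m [Hm0 Hlow]].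
destruct (inverse_function _ _ m Hm0 (is_derive_time_law a m1 (C ^ 2) A1 A2)
  (time_density_continuous a m1 (C ^ 2) A1 A2) Hlow) as [inv [Hinv Dinv]].
(* Along the motion the time law grows linearly with slope C, starting from the angle t0 of the
   given point. *)
set (phi := fun t => inv (time_law a m1 (C ^ 2) A1 A2 t0 + C * t)).
assert (Hphi : forall t, is_derive phi t (C * (1 + psi a m1 (C ^ 2) A1 A2 (phi t) ^ 2))).
{ intro t. unfold phi at 1. eapply is_derive_eq.
  - apply (is_derive_comp (V := R_NormedModule)); [apply Dinv |].
    auto_derive; [exact I | reflexivity].
  - fold (phi t). unfold scal; simpl. unfold mult; simpl. unfold time_density.
    rewrite Rinv_inv. ring. }
assert (Hphi0 : phi 0 = t0).
{ unfold phi. apply (time_law_injective a m1 (C ^ 2) A1 A2). rewrite Hinv. ring. }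
set (u := fun t => inv_radius m1 (C ^ 2) A1 A2 (phi t)).
assert (Hu : forall t, 0 < u t) by (intro t; apply inv_radius_pos; assumption).
set (X := fun t => / u t * cos (phi t)).
set (Y := fun t => a + bfac a * (/ u t * sin (phi t))).
set (U := fun t => (A1 - m1 * sin (phi t)) / C).
set (W := fun t => (m1 * cos (phi t) - A2) / C).
assert (Heta : forall t, eta a (Y t) = / u t * sin (phi t))
  by (intro t; unfold eta, Y; field; split; [apply Rgt_not_eq, Hu | lra]).
assert (Hrho : forall t, rho a (X t) (Y t) = / u t).
{ intro t. unfold rho. rewrite Heta. unfold X.
  replace ((/ u t * cos (phi t)) ^ 2 + (/ u t * sin (phi t)) ^ 2) with ((/ u t) ^ 2).
  - apply sqrt_pow2. left. apply Rinv_0_lt_compat, Hu.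
  - pose proof (sin2_cos2 (phi t)) as H. unfold Rsqr in H.
    transitivity ((/ u t) ^ 2 * (sin (phi t) * sin (phi t) + cos (phi t) * cos (phi t)));
      [rewrite H |]; ring. }
assert (Hs : forall t, 1 + X t ^ 2 + Y t ^ 2 =
   (/ u t) ^ 2 * (1 + psi a m1 (C ^ 2) A1 A2 (phi t) ^ 2)).
{ intro t. unfold X, Y. apply time_factor; [lra | apply Rinv_0_lt_compat, Hu |].
  rewrite Rinv_inv. reflexivity. }
assert (Hsin : forall t, is_derive (fun s => sin (phi s)) t
   (C * (1 + psi a m1 (C ^ 2) A1 A2 (phi t) ^ 2) * cos (phi t))).
{ intro t. apply (is_derive_comp (V := R_NormedModule)); [| apply Hphi].
  apply is_derive_Reals, derivable_pt_lim_sin. }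
assert (Hcos : forall t, is_derive (fun s => cos (phi s)) t
   (C * (1 + psi a m1 (C ^ 2) A1 A2 (phi t) ^ 2) * - sin (phi t))).
{ intro t. apply (is_derive_comp (V := R_NormedModule)); [| apply Hphi].
  apply is_derive_Reals, derivable_pt_lim_cos. }
assert (Hder : forall t, is_derive X t ((1 + X t ^ 2 + Y t ^ 2) * U t) /\
   is_derive Y t ((1 + X t ^ 2 + Y t ^ 2) * (bfac a * W t)) /\
   is_derive U t (- m1 * (1 + X t ^ 2 + Y t ^ 2) * (X t / rho a (X t) (Y t) ^ 3)) /\
   is_derive W t (- m1 * (1 + X t ^ 2 + Y t ^ 2) * (eta a (Y t) / rho a (X t) (Y t) ^ 3))).
{ intro t. rewrite Hs, Hrho, Heta. specialize (Hsin t). specialize (Hcos t).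
  assert (Du : is_derive u t
     ((0 - A1 * (C * (1 + psi a m1 (C ^ 2) A1 A2 (phi t) ^ 2) * cos (phi t))
     - A2 * (C * (1 + psi a m1 (C ^ 2) A1 A2 (phi t) ^ 2) * - sin (phi t))) / C ^ 2)).
  { unfold u, inv_radius. eapply is_derive_eq.
    - apply is_derive_div_const.
      apply (is_derive_minus (V := R_NormedModule));
        [apply (is_derive_minus (V := R_NormedModule)) |];
        [apply (is_derive_const (V := R_NormedModule)) | |]; apply is_derive_scal; eassumption.
    - unfold scal, minus, plus, opp, zero; simpl. unfold mult; simpl. field. exact HC. }
  (* The focal equation solved for m1: substituting it is what identifies the derivative of the
     position with the hodograph velocity. *)
  assert (Hm1 : m1 = u t * C ^ 2 + A1 * sin (phi t) + A2 * cos (phi t))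
    by (unfold u, inv_radius; field; exact HC).
  assert (Hc2 : cos (phi t) ^ 2 = 1 - sin (phi t) ^ 2)
    by (pose proof (sin2_cos2 (phi t)) as H; unfold Rsqr in H; lra).
  specialize (Hu t). unfold X, Y, U, W.
  refine (conj _ (conj _ (conj _ _))).
  - eapply is_derive_eq.
    + apply (is_derive_mult (fun s => / u s) (fun s => cos (phi s)));
        [apply is_derive_inv; [exact Du | lra] | exact Hcos | intros; apply Rmult_comm].
    + unfold plus, mult; simpl. revert Hm1 Hc2 HC Hu. clear.
      generalize (psi a m1 (C ^ 2) A1 A2 (phi t)) (u t) (sin (phi t)) (cos (phi t)).
      intros ps v S K Hm1 Hc2 HC Hu. field_simplify_eq; [| lra]. ring [Hm1 Hc2].
  - eapply is_derive_eq.
    + apply (is_derive_plus (V := R_NormedModule));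
        [apply (is_derive_const (V := R_NormedModule)) |].
      apply is_derive_scal. apply (is_derive_mult (fun s => / u s) (fun s => sin (phi s)));
        [apply is_derive_inv; [exact Du | lra] | exact Hsin | intros; apply Rmult_comm].
    + unfold plus, mult, zero; simpl. revert Hm1 Hc2 HC Hu. clear.
      generalize (psi a m1 (C ^ 2) A1 A2 (phi t)) (u t) (sin (phi t)) (cos (phi t)).
      intros ps v S K Hm1 Hc2 HC Hu. field_simplify_eq; [| lra]. ring [Hm1 Hc2].
  - eapply is_derive_eq.
    + apply is_derive_div_const.
      apply (is_derive_minus (V := R_NormedModule));
        [apply (is_derive_const (V := R_NormedModule)) | apply is_derive_scal; exact Hsin].
    + unfold scal, minus, plus, opp, zero; simpl. unfold mult; simpl. field. split; lra.
  - eapply is_derive_eq.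
    + apply is_derive_div_const.
      apply (is_derive_minus (V := R_NormedModule));
        [apply is_derive_scal; exact Hcos | apply (is_derive_const (V := R_NormedModule))].
    + unfold scal, minus, plus, opp, zero; simpl. unfold mult; simpl. field. split; lra. }
exists (fun t => kepler_state a m1 C A1 A2 (phi t)).
refine (conj _ _); [rewrite Hphi0; exact Hstate |].
apply (planar_orbit a m1 X Y U W). intro t.
split; [rewrite Hrho; apply Rinv_0_lt_compat, Hu | apply Hder].
Qed.

(** * The minimal period and the average over the polar angle *)

Lemma cos_sin_eq_close (s t : R) :
  cos s = cos t -> sin s = sin t -> Rabs (s - t) < 2 * PI -> s = t.
Proof.
intros Hc Hs Hst. apply NNPP. intro Hne.
assert (H1 : cos (2 * ((s - t) / 2)) = 1).
{ replace (2 * ((s - t) / 2)) with (s - t) by field. rewrite cos_minus, Hc, Hs.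
  pose proof (sin2_cos2 t) as H. unfold Rsqr in H. lra. }
rewrite cos_2a_sin in H1.
assert (H2 : sin ((s - t) / 2) = 0) by nra.
apply Rabs_def2 in Hst.
destruct (Rlt_dec 0 (s - t)) as [L | L].
- pose proof (sin_gt_0 ((s - t) / 2)). lra.
- pose proof (sin_lt_0_var ((s - t) / 2)). lra.
Qed.

Lemma kepler_state_injective (a m1 C A1 A2 s t : R) :
  0 < inv_radius m1 (C ^ 2) A1 A2 s -> 0 < inv_radius m1 (C ^ 2) A1 A2 t ->
  kepler_state a m1 C A1 A2 s = kepler_state a m1 C A1 A2 t ->
  cos s = cos t /\ sin s = sin t.
Proof.
intros Hs Ht H. apply (f_equal pos) in H. pose proof (bfac_pos a) as Hb.
unfold kepler_state in H. cbn [pos of_can] in H.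
apply Rinv_0_lt_compat in Hs. apply Rinv_0_lt_compat in Ht.
revert H Hs Ht.
generalize (/ inv_radius m1 (C ^ 2) A1 A2 s) (/ inv_radius m1 (C ^ 2) A1 A2 t).
intros r r' H Hr Hr'. destruct (chart_injective _ _ _ _ H) as [Hx Hy].
assert (Hy' : r * sin s = r' * sin t) by (apply Rmult_eq_reg_l with (bfac a); lra).
assert (E : r = r').
{ pose proof (sin2_cos2 s) as H1. pose proof (sin2_cos2 t) as H2. unfold Rsqr in *.
  assert (r ^ 2 = r' ^ 2).
  { transitivity ((r * sin s) ^ 2 + (r * cos s) ^ 2).
    - transitivity (r ^ 2 * (sin s * sin s + cos s * cos s)); [rewrite H1 |]; ring.
    - rewrite Hx, Hy'.
      transitivity (r' ^ 2 * (sin t * sin t + cos t * cos t)); [|rewrite H2]; ring. }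
  nra. }
rewrite E in Hx, Hy'. split; apply Rmult_eq_reg_l with r'; lra.
Qed.

(** The time law is injective and advances by its value at 2 PI per turn. The sign of C gives the
    sense of rotation; in the negative case the equation is stated backwards so that only forward
    shifts by 2 PI occur. *)
Lemma motion_after_period (a m1 C A1 A2 : R) (phi : R -> R) (t : R) :
  let k := C ^ 2 in let T := time_law a m1 k A1 A2 (2 * PI) / Rabs C in
  C <> 0 ->
  (forall t, is_derive phi t (C * (1 + psi a m1 k A1 A2 (phi t) ^ 2))) ->
  (0 < C /\ phi (t + T) = phi t + 2 * PI) \/ (C < 0 /\ phi t = phi (t + T) + 2 * PI).
Proof.
intros k T HC Hphi. pose proof (time_law_motion a m1 k A1 A2 C phi Hphi) as HL.
pose proof (Rabs_pos_lt C HC) as HC'.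
assert (HT : Rabs C * T = time_law a m1 k A1 A2 (2 * PI)) by (unfold T; field; lra).
pose proof (HL t) as H1. pose proof (HL (t + T)) as H2.
destruct (Rlt_dec 0 C) as [L | L]; [left | right]; (split; [lra |]);
  apply (time_law_injective a m1 k A1 A2); rewrite time_law_shift.
- rewrite (Rabs_pos_eq C) in HT by lra. lra.
- rewrite (Rabs_left C) in HT by lra. lra.
Qed.

(** During a shorter time T' the angle would move by less than a full turn. Equal states have equal
    directions, so the angle would not have moved at all, and the time law would give C T' = 0. *)
Lemma motion_minimal_period (a m1 C A1 A2 : R) (phi : R -> R) (g : R -> tpoint) :
  let k := C ^ 2 in
  0 < m1 -> C <> 0 -> A1 ^ 2 + A2 ^ 2 < m1 ^ 2 ->
  (forall t, is_derive phi t (C * (1 + psi a m1 k A1 A2 (phi t) ^ 2))) ->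
  (forall t, g t = kepler_state a m1 C A1 A2 (phi t)) ->
  is_minimal_period g (time_law a m1 k A1 A2 (2 * PI) / Rabs C).
Proof.
intros k Hm HC HA Hphi Hg.
pose proof (time_law_motion a m1 k A1 A2 C phi Hphi) as HL.
pose proof (Rabs_pos_lt C HC) as HC'. pose proof PI_RGT_0 as HPI.
assert (Hk : 0 < k)
  by (unfold k; pose proof (pow2_ge_0 C); pose proof (pow_nonzero C 2 HC); lra).
assert (HM : 0 < time_law a m1 k A1 A2 (2 * PI)).
{ replace 0 with (time_law a m1 k A1 A2 0) at 1
    by (unfold time_law; rewrite RInt_point; reflexivity).
  apply time_law_increasing. lra. }
set (T := time_law a m1 k A1 A2 (2 * PI) / Rabs C).
split.
- split; [apply Rdiv_lt_0_compat; assumption |]. intro t. rewrite !Hg.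
  destruct (motion_after_period a m1 C A1 A2 phi t HC Hphi) as [[_ E] | [_ E]];
    fold k T in E; rewrite E, kepler_state_shift; reflexivity.
- intros T' [HT' Hper]. apply Rnot_lt_le. intro Hlt.
  pose proof (Hper 0) as H0. rewrite Rplus_0_l, !Hg in H0.
  apply kepler_state_injective in H0; [| apply inv_radius_pos; assumption ..].
  assert (Habs : Rabs C * T' < time_law a m1 k A1 A2 (2 * PI)).
  { apply (Rmult_lt_compat_l (Rabs C)) in Hlt; [| exact HC'].
    replace (Rabs C * T) with (time_law a m1 k A1 A2 (2 * PI)) in Hlt
      by (unfold T; field; lra). exact Hlt. }
  assert (Habs' : Rabs (time_law a m1 k A1 A2 (phi T') - time_law a m1 k A1 A2 (phi 0))
     < time_law a m1 k A1 A2 (2 * PI)).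
  { rewrite HL. replace (_ + C * T' - _) with (C * T') by ring.
    rewrite Rabs_mult, (Rabs_pos_eq T') by lra. exact Habs. }
  apply Rabs_def2 in Habs'.
  assert (E : phi T' = phi 0).
  { apply cos_sin_eq_close; [apply H0 | apply H0 |]. apply Rabs_def1.
    - apply Rnot_le_lt. intro L.
      assert (time_law a m1 k A1 A2 (phi 0 + 2 * PI) <= time_law a m1 k A1 A2 (phi T')).
      { destruct (Req_dec (phi 0 + 2 * PI) (phi T')) as [-> | N]; [apply Rle_refl |].
        left. apply time_law_increasing. lra. }
      rewrite time_law_shift in H. lra.
    - apply Rnot_le_lt. intro L.
      assert (time_law a m1 k A1 A2 (phi T' + 2 * PI) <= time_law a m1 k A1 A2 (phi 0)).
      { destruct (Req_dec (phi T' + 2 * PI) (phi 0)) as [-> | N]; [apply Rle_refl |].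
        left. apply time_law_increasing. lra. }
      rewrite time_law_shift in H. lra. }
  pose proof (HL T') as H1. rewrite E in H1.
  assert (C * T' = 0) by lra. apply Rmult_integral in H. lra.
Qed.

(** Integrating along the motion turns [dt] into [dphi / (C (1 + psi ^ 2))]. *)
Lemma motion_average (a m1 C A1 A2 : R) (phi V : R -> R) :
  let k := C ^ 2 in let T := time_law a m1 k A1 A2 (2 * PI) / Rabs C in
  C <> 0 ->
  (forall t, is_derive phi t (C * (1 + psi a m1 k A1 A2 (phi t) ^ 2))) ->
  (forall t, continuous V t) -> (forall t, V (t + 2 * PI) = V t) ->
  1 / T * RInt (fun t => V (phi t)) 0 T =
    RInt (fun t => V t * time_density a m1 k A1 A2 t) 0 (2 * PI)
      / time_law a m1 k A1 A2 (2 * PI).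
Proof.
intros k T HC Hphi HV Hper.
set (h := fun t => V t * time_density a m1 k A1 A2 t).
assert (Hh : forall t, continuous h t).
{ intro t. apply (continuous_mult (K := R_AbsRing));
    [apply HV | apply time_density_continuous]. }
assert (Hhp : forall t, h (t + 2 * PI) = h t).
{ intro t. unfold h. rewrite Hper, time_density_shift. reflexivity. }
assert (Hphic : forall t, continuous phi t)
  by (intro t; eapply is_derive_continuous; apply Hphi).
assert (Hcomp : RInt (fun t => V (phi t)) 0 T = RInt h (phi 0) (phi T) / C).
{ rewrite <- (RInt_comp (V := R_CompleteNormedModule) h phi
    (fun t => C * (1 + psi a m1 k A1 A2 (phi t) ^ 2))).
  - transitivity (RInt (fun t => scal C (V (phi t))) 0 T / C).
    + assert (Hsc : RInt (fun t => scal C (V (phi t))) 0 T =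
        C * RInt (fun t => V (phi t)) 0 T).
      { apply (RInt_scal (V := R_CompleteNormedModule)).
        apply (ex_RInt_continuous (V := R_CompleteNormedModule)). intros t _.
        apply (continuous_comp phi V); [apply Hphic | apply HV]. }
      rewrite Hsc. set (I := RInt (fun t => V (phi t)) 0 T : R).
      change (I = C * I / C). field. exact HC.
    + f_equal. apply RInt_ext. intros t _. unfold scal; simpl. unfold mult; simpl.
      unfold h, time_density.
      match goal with |- ?x = ?y => change (@eq R x y) end. field. nra.
  - intros t _. apply Hh.
  - intros t _. split; [apply Hphi |].
    apply (continuous_mult (K := R_AbsRing)); [apply continuous_const |].
    apply (continuous_plus (V := R_NormedModule)); [apply continuous_const |].
    apply (continuous_comp (fun t => psi a m1 k A1 A2 (phi t)) (fun v => v ^ 2)).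
    + apply (continuous_comp phi (psi a m1 k A1 A2)); [apply Hphic | apply psi_continuous].
    + apply (ex_derive_continuous (K := R_AbsRing) (V := R_NormedModule)).
      auto_derive. exact I. }
pose proof (Rabs_pos_lt C HC) as HC'. pose proof PI_RGT_0 as HPI.
assert (HM : 0 < time_law a m1 k A1 A2 (2 * PI)).
{ replace 0 with (time_law a m1 k A1 A2 0) at 1
    by (unfold time_law; rewrite RInt_point; reflexivity).
  apply time_law_increasing. lra. }
assert (HI : RInt h (phi 0) (phi T) / C = RInt h 0 (2 * PI) / Rabs C).
{ destruct (motion_after_period a m1 C A1 A2 phi 0 HC Hphi) as [[L E] | [L E]];
    fold k T in E; rewrite Rplus_0_l in E; rewrite E.
  - rewrite RInt_period_shift by assumption. rewrite Rabs_pos_eq by lra. reflexivity.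
  (* For retrograde motion the limits of integration are reversed; the resulting sign turns the
     divisor C into |C|. *)
  - rewrite <- (opp_RInt_swap (V := R_CompleteNormedModule)).
    + rewrite RInt_period_shift by assumption. rewrite Rabs_left by lra.
      unfold opp; simpl. field. lra.
    + apply (ex_RInt_continuous (V := R_CompleteNormedModule)). intros z _. apply Hh. }
rewrite Hcomp, HI. unfold T. field. split; lra.
Qed.

(** * The average as a quotient of integrals over the polar angle *)

(** Up to the factor 1 / sqrt (1 + v^2), the position has coordinates (cos t, sin t, v) in an
    orthonormal frame with last axis Z1. Divided by 1 + a^2, [mix2] and [num2] are the last two
    coordinates after rotation of Z1 to Z2, the sine and cosine of the angle between them being 2 a
    / (1 + a^2) and (1 - a^2) / (1 + a^2). Hence the cotangent of the angle to Z2 is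
    [num2 / sqrt den2]. Likewise v - a sin t is proportional to the coordinate along Z0. *)
Definition num2 (a v t : R) : R := (1 - a ^ 2) * v - 2 * a * sin t.
Definition mix2 (a v t : R) : R := (1 - a ^ 2) * sin t + 2 * a * v.
Definition den2 (a v t : R) : R := (1 + a ^ 2) ^ 2 * cos t ^ 2 + mix2 a v t ^ 2.

(** The potential [Vsph2] at the point of polar angle [t] around the first
    centre whose central angle to that centre has cotangent [v]. *)
Definition pot (a m2 f v t : R) : R :=
  - m2 * (bfac a * num2 a v t / sqrt (den2 a v t))
  + f * (((1 + a ^ 2) * cos t ^ 2 + (a * v + sin t) ^ 2) / (v - a * sin t) ^ 2).

Lemma Vsph2_polar (a m2 f v t : R) : 0 < v - a * sin t ->
  let r := bfac a / (v - a * sin t) in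
  Vsph2 a m2 f (chart (r * cos t) (a + bfac a * (r * sin t))) = pot a m2 f v t.
Proof.
intros Hd r. set (d := v - a * sin t) in *. pose proof (bfac_pos a) as Hb.
pose proof (bfac_sqr a) as Hb2.
assert (Hv : v = d + a * sin t) by (unfold d; ring).
assert (Hy : a + bfac a * (r * sin t) = (a * v + sin t) / d).
{ replace (bfac a * (r * sin t)) with (bfac a ^ 2 * sin t / d) by (unfold r; field; lra).
  rewrite Hb2, Hv. field. lra. }
rewrite Vsph2_chart. unfold pot. fold d. f_equal; f_equal.
- assert (Hr2 : sqrt (den2 a v t) =
    bfac a * d * rho2 a (r * cos t) (a + bfac a * (r * sin t))).
  { unfold rho2. rewrite <- (sqrt_pow2 (bfac a * d)) by nra.
    rewrite <- sqrt_mult_alt by apply pow2_ge_0. f_equal. rewrite Hy.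
    unfold den2, mix2, r. rewrite <- Hb2. rewrite Hv.
    field_simplify_eq; [| lra]. ring [Hb2]. }
  rewrite Hr2, Hy. set (r2 := rho2 _ _ _).
  replace (1 - a * ((a * v + sin t) / d)) with (num2 a v t / d)
    by (unfold num2; rewrite Hv; field; lra).
  destruct (Req_dec r2 0) as [-> | N].
  + rewrite Rmult_0_r. unfold Rdiv. rewrite Rinv_0. ring.
  + field. repeat split; lra.
- rewrite Hy. replace ((r * cos t) ^ 2) with (bfac a ^ 2 * cos t ^ 2 / d ^ 2)
    by (unfold r; field; lra).
  rewrite Hb2. field. lra.
Qed.

(** The first quantity is b / r. If [den2] vanishes, then cos t = 0 and [mix2] = 0; for sin t = 1
    the latter equals 1 + a^2 + 2 a b / r > 0, and for sin t = - 1 it forces r = 2 a / b, that is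
    the point Z2, which the condition on D excludes. *)
Lemma conic_domain (a m1 C A1 A2 t : R) :
  0 < a -> 0 < m1 -> C <> 0 -> A1 ^ 2 + A2 ^ 2 < m1 ^ 2 ->
  C ^ 2 - 2 * a / bfac a * A1 <> 2 * a / bfac a * m1 ->
  0 < psi a m1 (C ^ 2) A1 A2 t - a * sin t /\ 0 < den2 a (psi a m1 (C ^ 2) A1 A2 t) t.
Proof.
intros Ha Hm HC HA HD. pose proof (bfac_pos a) as Hb. pose proof (bfac_sqr a) as Hb2.
assert (Hk : 0 < C ^ 2) by (pose proof (pow2_ge_0 C); pose proof (pow_nonzero C 2 HC); lra).
pose proof (inv_radius_pos m1 (C ^ 2) A1 A2 t Hm Hk HA) as Hu.
pose proof (psiE a m1 (C ^ 2) A1 A2 t) as Hpsi. specialize (Hpsi ltac:(lra)).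
set (v := psi a m1 (C ^ 2) A1 A2 t) in *.
set (u := inv_radius m1 (C ^ 2) A1 A2 t) in *.
assert (Hbu : 0 < bfac a * u) by (apply Rmult_lt_0_compat; assumption).
split; [lra |].
assert (Hnn : 0 <= den2 a v t).
{ unfold den2. apply Rplus_le_le_0_compat;
    [apply Rmult_le_pos; apply pow2_ge_0 | apply pow2_ge_0]. }
destruct Hnn as [| H0]; [assumption | exfalso]. unfold den2 in H0.
assert (Hc : cos t = 0).
{ assert (0 < (1 + a ^ 2) ^ 2) by (apply pow_lt; nra).
  pose proof (pow2_ge_0 (mix2 a v t)). pose proof (pow2_ge_0 (cos t)). nra. }
assert (He : mix2 a v t = 0).
{ rewrite Hc in H0. nra. }
unfold mix2 in He. rewrite Hpsi in He.
pose proof (sin2_cos2 t) as Hs. unfold Rsqr in Hs. rewrite Hc in Hs.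
assert (Hs' : sin t = 1 \/ sin t = - 1).
{ assert ((sin t - 1) * (sin t + 1) = 0) by lra. apply Rmult_integral in H.
  destruct H; [left | right]; lra. }
destruct Hs' as [E | E]; rewrite E in He; [nra |].
assert (Hub : 2 * a * u = bfac a).
{ apply Rmult_eq_reg_l with (bfac a); [| lra].
  transitivity (bfac a ^ 2); [rewrite Hb2; lra | ring]. }
apply HD. unfold u, inv_radius in Hub. rewrite E, Hc in Hub.
assert (Hub' : 2 * a * (m1 + A1) = bfac a * C ^ 2).
{ rewrite <- Hub. field. exact HC. }
assert (C ^ 2 = 2 * a / bfac a * (m1 + A1)); [| lra].
apply Rmult_eq_reg_l with (bfac a); [| lra]. rewrite <- Hub'. field. lra.
Qed.

(** * Partial derivatives of the potential and of its correction *)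

Definition half_den2_dt (a v t : R) : R :=
  ((1 - a ^ 2) * mix2 a v t - (1 + a ^ 2) ^ 2 * sin t) * cos t.

Definition pot_dv (a m2 f v t : R) : R :=
  - m2 * (bfac a * ((1 - a ^ 2) * den2 a v t - 2 * a * mix2 a v t * num2 a v t)
    / sqrt (den2 a v t) ^ 3)
  + f * ((2 * a * (a * v + sin t) * (v - a * sin t)
      - 2 * ((1 + a ^ 2) * cos t ^ 2 + (a * v + sin t) ^ 2)) / (v - a * sin t) ^ 3).

Definition pot_dt (a m2 f v t : R) : R :=
  - m2 * (bfac a * (- 2 * a * cos t * den2 a v t - num2 a v t * half_den2_dt a v t)
    / sqrt (den2 a v t) ^ 3)
  + f * (((- 2 * (1 + a ^ 2) * cos t * sin t + 2 * (a * v + sin t) * cos t)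
      * (v - a * sin t)
      + 2 * a * cos t * ((1 + a ^ 2) * cos t ^ 2 + (a * v + sin t) ^ 2))
    / (v - a * sin t) ^ 3).

(** The function by which [D] has to be corrected to become a first integral
    of the problem with both centres and the Hooke term. *)
Definition corr (a m2 f v t : R) : R :=
  - m2 * (- (2 * a / bfac a) * mix2 a v t / sqrt (den2 a v t))
  + f * (- 2 * a ^ 2 * cos t ^ 2 / (v - a * sin t) ^ 2).

Definition corr_dv (a m2 f v t : R) : R :=
  - m2 * (- (4 * a ^ 2 / bfac a) * ((1 + a ^ 2) ^ 2 * cos t ^ 2) / sqrt (den2 a v t) ^ 3)
  + f * (4 * a ^ 2 * cos t ^ 2 / (v - a * sin t) ^ 3).

Definition corr_dt (a m2 f v t : R) : R :=
  - m2 * (- (2 * a / bfac a) * ((1 - a ^ 2) * cos t * den2 a v t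
      - mix2 a v t * half_den2_dt a v t) / sqrt (den2 a v t) ^ 3)
  + f * ((4 * a ^ 2 * cos t * sin t * (v - a * sin t) - 4 * a ^ 3 * cos t ^ 3)
      / (v - a * sin t) ^ 3).

Lemma sqrt_den2_sqr (a v t : R) : 0 < den2 a v t -> sqrt (den2 a v t) ^ 2 = den2 a v t.
Proof. intros H. apply pow2_sqrt. lra. Qed.

Lemma is_derive_div_sqrt (n Q : R -> R) (t dn hQ : R) :
  is_derive n t dn -> is_derive Q t (2 * hQ) -> 0 < Q t ->
  is_derive (fun s => n s / sqrt (Q s)) t ((dn * Q t - n t * hQ) / sqrt (Q t) ^ 3).
Proof.
intros Hn HQ H0. pose proof (sqrt_lt_R0 _ H0) as Hq.
assert (Hq2 : sqrt (Q t) ^ 2 = Q t) by (apply pow2_sqrt; lra).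
auto_derive; [repeat apply conj; try exact I; try exact H0; try lra; eexists; eassumption |].
rewrite (is_derive_unique (fun s : R => n s) _ _ Hn),
  (is_derive_unique (fun s : R => Q s) _ _ HQ).
revert Hq Hq2. generalize (sqrt (Q t)). intros q Hq <-. field. lra.
Qed.

Lemma is_derive_div_sqr (n d : R -> R) (t dn dd : R) :
  is_derive n t dn -> is_derive d t dd -> d t <> 0 ->
  is_derive (fun s => n s / d s ^ 2) t ((dn * d t - 2 * n t * dd) / d t ^ 3).
Proof.
intros Hn Hd H0.
auto_derive; [repeat apply conj; try exact I; try (eexists; eassumption) |].
- rewrite Rmult_1_r. apply Rmult_integral_contrapositive_currified; exact H0.
- rewrite (is_derive_unique (fun s : R => n s) _ _ Hn),
    (is_derive_unique (fun s : R => d s) _ _ Hd).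
  field. exact H0.
Qed.

Lemma is_derive_den2 (a t l : R) (g : R -> R) :
  is_derive g t l ->
  is_derive (fun s => num2 a (g s) s) t ((1 - a ^ 2) * l - 2 * a * cos t) /\
  is_derive (fun s => mix2 a (g s) s) t ((1 - a ^ 2) * cos t + 2 * a * l) /\
  is_derive (fun s => den2 a (g s) s) t
    (2 * (half_den2_dt a (g t) t + 2 * a * mix2 a (g t) t * l)) /\
  is_derive (fun s => g s - a * sin s) t (l - a * cos t) /\
  is_derive (fun s => (1 + a ^ 2) * cos s ^ 2 + (a * g s + sin s) ^ 2) t
    (- 2 * (1 + a ^ 2) * cos t * sin t + 2 * (a * g t + sin t) * (a * l + cos t)) /\
  is_derive (fun s => - 2 * a ^ 2 * cos s ^ 2) t (4 * a ^ 2 * cos t * sin t).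
Proof.
intros Hg. unfold den2, half_den2_dt, num2, mix2.
refine (conj _ (conj _ (conj _ (conj _ (conj _ _)))));
  (eapply is_derive_eq; [auto_derive; [repeat apply conj; try exact I; eexists; exact Hg
  | reflexivity] |]);
  rewrite ?(is_derive_unique (fun s : R => g s) _ _ Hg); ring.
Qed.

Lemma is_derive_pot (a m2 f t l : R) (g : R -> R) :
  is_derive g t l -> 0 < g t - a * sin t -> 0 < den2 a (g t) t ->
  is_derive (fun s => pot a m2 f (g s) s) t
    (pot_dv a m2 f (g t) t * l + pot_dt a m2 f (g t) t) /\
  is_derive (fun s => corr a m2 f (g s) s) t
    (corr_dv a m2 f (g t) t * l + corr_dt a m2 f (g t) t).
Proof.
intros Hg Hd HQ. pose proof (bfac_pos a) as Hb.
pose proof (sqrt_lt_R0 _ HQ) as Hq.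
destruct (is_derive_den2 a t l g Hg) as [Dn [Dm [DQ [Dd [DN Dc]]]]].
assert (Hd0 : g t - a * sin t <> 0) by lra.
split; eapply is_derive_eq.
- apply (is_derive_plus (V := R_NormedModule)); apply is_derive_scal;
    [eapply is_derive_ext; [intro s; symmetry; apply Rmult_assoc |]; apply is_derive_scal;
     apply (is_derive_div_sqrt _ _ t _ _ Dn DQ HQ)
    | apply (is_derive_div_sqr _ _ t _ _ DN Dd Hd0)].
- unfold plus; simpl. unfold pot_dv, pot_dt. field. split; lra.
- apply (is_derive_plus (V := R_NormedModule)); apply is_derive_scal;
    [eapply is_derive_ext; [intro s; symmetry; apply Rmult_assoc |]; apply is_derive_scal;
     apply (is_derive_div_sqrt _ _ t _ _ Dm DQ HQ)
    | apply (is_derive_div_sqr _ _ t _ _ Dc Dd Hd0)].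
- unfold plus; simpl. unfold corr_dv, corr_dt. revert Hq Hd0.
  replace ((1 + a ^ 2) ^ 2 * cos t ^ 2) with (den2 a (g t) t - mix2 a (g t) t ^ 2)
    by (unfold den2; ring).
  intros. field. repeat split; lra.
Qed.

Lemma is_derive_pot_v (a m2 f v t : R) :
  0 < v - a * sin t -> 0 < den2 a v t ->
  is_derive (fun u => pot a m2 f u t) v (pot_dv a m2 f v t).
Proof.
intros Hd HQ. assert (Hd0 : v - a * sin t <> 0) by lra.
pose proof (sqrt_lt_R0 _ HQ) as Hq.
unfold pot. eapply is_derive_eq.
- apply (is_derive_plus (V := R_NormedModule)); apply is_derive_scal;
    [eapply is_derive_ext; [intro s; symmetry; apply Rmult_assoc |]; apply is_derive_scal;
     apply (is_derive_div_sqrt (fun u => num2 a u t) (fun u => den2 a u t) v (1 - a ^ 2)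
       (2 * a * mix2 a v t)); [| | exact HQ]
    | apply (is_derive_div_sqr (fun u => (1 + a ^ 2) * cos t ^ 2 + (a * u + sin t) ^ 2)
       (fun u => u - a * sin t) v (2 * a * (a * v + sin t)) 1); [| | exact Hd0]];
  unfold num2, den2, mix2; auto_derive; trivial; ring.
- unfold plus; simpl. unfold pot_dv. field. split; lra.
Qed.

(** The identity {V, D} + {E_sKep, W} = 0 divided by C is affine in the slope of v along the conic.
    As V and W depend on position only, the coefficient of this slope and the remaining term must
    agree separately, which gives these two equations. *)
Lemma pot_corr (a m2 f v t : R) :
  let e := 2 * a / bfac a ^ 2 in
  0 < v - a * sin t -> 0 < den2 a v t ->
  pot_dt a m2 f v t * (e * cos t) = (1 + v ^ 2) * corr_dv a m2 f v t /\
  (1 + v ^ 2) * (e * cos t) * pot_dv a m2 f v t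
  + pot_dt a m2 f v t * (2 * ((1 - a ^ 2) / bfac a ^ 2) + 2 * e * v * sin t)
    = (1 + v ^ 2) * corr_dt a m2 f v t.
Proof.
intros e Hd HQ. pose proof (bfac_pos a) as Hb. pose proof (bfac_sqr a) as Hb2.
pose proof (sqrt_den2_sqr a v t HQ) as Hq2. pose proof (sqrt_lt_R0 _ HQ) as Hq.
unfold e, pot_dt, pot_dv, corr_dv, corr_dt. revert Hq2 Hq. generalize (sqrt (den2 a v t)).
intros q Hq2 Hq. unfold half_den2_dt, num2, den2, mix2 in *.
assert (Hs2 : sin t ^ 2 = 1 - cos t ^ 2)
  by (pose proof (sin2_cos2 t) as H; unfold Rsqr in H; lra).
assert (Hd' : v - a * sin t <> 0) by lra.
revert Hb Hb2 Hs2 Hd' Hq. clear. generalize (bfac a) (sin t) (cos t).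
intros b s c Hb Hb2 Hs2 Hd Hq.
split.
- field_simplify_eq; [| repeat split; lra]. ring [Hb2 Hs2].
- field_simplify_eq; [| repeat split; lra]. ring [Hb2 Hs2].
Qed.

(** * Joint continuity in the cotangent and the polar angle *)

Lemma continuity_2d_pt_pow (f : R -> R -> R) (n : nat) (x y : R) :
  continuity_2d_pt f x y -> continuity_2d_pt (fun u v => f u v ^ n) x y.
Proof.
intros Hf. induction n as [| n IH]; simpl.
- apply continuity_2d_pt_const.
- apply continuity_2d_pt_mult; assumption.
Qed.

Lemma continuity_2d_pt_div (f g : R -> R -> R) (x y : R) :
  continuity_2d_pt f x y -> continuity_2d_pt g x y -> g x y <> 0 ->
  continuity_2d_pt (fun u v => f u v / g u v) x y.
Proof.
intros Hf Hg H0. apply continuity_2d_pt_mult; [exact Hf |].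
apply continuity_2d_pt_inv; assumption.
Qed.

Lemma continuity_2d_pt_snd (f : R -> R) (x y : R) :
  continuity f -> continuity_2d_pt (fun _ v => f v) x y.
Proof.
intros Hf. apply (continuity_1d_2d_pt_comp f (fun _ v => v)); [apply Hf |].
apply continuity_2d_pt_id2.
Qed.

Lemma continuity_2d_pt_sqrt (f : R -> R -> R) (x y : R) :
  continuity_2d_pt f x y -> 0 < f x y -> continuity_2d_pt (fun u v => sqrt (f u v)) x y.
Proof.
intros Hf H0. apply (continuity_1d_2d_pt_comp sqrt f); [| exact Hf].
apply continuity_pt_sqrt. lra.
Qed.

Ltac continuity_2d :=
  repeat match goal with
  | |- continuity_2d_pt (fun _ _ => _ + _) _ _ => apply continuity_2d_pt_plus
  | |- continuity_2d_pt (fun _ _ => _ - _) _ _ => apply continuity_2d_pt_minus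
  | |- continuity_2d_pt (fun _ _ => _ * _) _ _ => apply continuity_2d_pt_mult
  | |- continuity_2d_pt (fun _ _ => _ / _) _ _ => apply continuity_2d_pt_div
  | |- continuity_2d_pt (fun _ _ => - _) _ _ => apply continuity_2d_pt_opp
  | |- continuity_2d_pt (fun _ _ => _ ^ _) _ _ => apply continuity_2d_pt_pow
  | |- continuity_2d_pt (fun _ _ => sqrt _) _ _ => apply continuity_2d_pt_sqrt
  | |- continuity_2d_pt (fun _ t => sin t) _ _ =>
      apply (continuity_2d_pt_snd sin); exact continuity_sin
  | |- continuity_2d_pt (fun _ t => cos t) _ _ =>
      apply (continuity_2d_pt_snd cos); exact continuity_cos
  | |- continuity_2d_pt (fun v _ => v) _ _ => apply continuity_2d_pt_id1
  | |- continuity_2d_pt _ _ _ => apply continuity_2d_pt_const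
  end.

Lemma pot_continuity_2d (a m2 f v t : R) :
  0 < v - a * sin t -> 0 < den2 a v t ->
  continuity_2d_pt (pot a m2 f) v t /\ continuity_2d_pt (pot_dv a m2 f) v t.
Proof.
intros Hd HQ. pose proof (sqrt_lt_R0 _ HQ) as Hq.
assert (Hd0 : forall n, (v - a * sin t) ^ n <> 0) by (intro; apply pow_nonzero; lra).
assert (Hq0 : forall n, sqrt (den2 a v t) ^ n <> 0) by (intro; apply pow_nonzero; lra).
unfold pot, pot_dv, num2, den2, mix2 in *.
split; continuity_2d; try assumption; try apply Hd0; try apply Hq0; lra.
Qed.

(** [V / (1 + v ^ 2)] is the integrand of [V] after the change of variable
    from time to polar angle, up to the angular momentum. *)
Definition weighted (V : R -> R -> R) (v t : R) : R := V v t / (1 + v ^ 2).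
Definition weighted_dv (V Vv : R -> R -> R) (v t : R) : R :=
  Vv v t / (1 + v ^ 2) - 2 * v * V v t / (1 + v ^ 2) ^ 2.

Lemma weighted_regular (V Vv : R -> R -> R) (v t : R) :
  is_derive (fun u => V u t) v (Vv v t) ->
  continuity_2d_pt V v t -> continuity_2d_pt Vv v t ->
  is_derive (fun u => weighted V u t) v (weighted_dv V Vv v t) /\
  continuity_2d_pt (weighted V) v t /\ continuity_2d_pt (weighted_dv V Vv) v t.
Proof.
intros HV C1 C2. assert (H0 : 1 + v ^ 2 <> 0) by nra.
unfold weighted, weighted_dv. refine (conj _ (conj _ _)).
- eapply is_derive_eq.
  + apply (is_derive_div (fun u => V u t) (fun u => 1 + u ^ 2) v _ (2 * v) HV); [| exact H0].
    auto_derive; [exact I | ring].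
  + field. exact H0.
- apply continuity_2d_pt_div; [exact C1 | continuity_2d | exact H0].
- apply continuity_2d_pt_minus; apply continuity_2d_pt_div;
    try apply continuity_2d_pt_mult; try assumption; continuity_2d;
    try apply pow_nonzero; exact H0.
Qed.

Definition mean_integral (V : R -> R -> R) (b0 b1 b2 : R) : R :=
  RInt (fun t => weighted V (conic b0 b1 b2 t) t) 0 (2 * PI).

Lemma continuous_along_conic (F : R -> R -> R) (b0 b1 b2 t : R) :
  continuity_2d_pt F (conic b0 b1 b2 t) t -> continuous (fun t => F (conic b0 b1 b2 t) t) t.
Proof.
intros HF. apply (continuous_comp_2 (fun t => conic b0 b1 b2 t) (fun t => t) F).
- apply (ex_derive_continuous (K := R_AbsRing) (V := R_NormedModule)). unfold conic.
  auto_derive. exact I.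
- apply continuous_id.
- exact (proj1 (continuity_2d_pt_filterlim _ _ _) HF).
Qed.

Lemma RInt_conic_linear (F : R -> R) (l0 l1 l2 x y : R) :
  (forall t, continuous F t) ->
  RInt (fun t => F t * conic l0 l1 l2 t) x y =
    l0 * RInt F x y - l1 * RInt (fun t => F t * sin t) x y
    - l2 * RInt (fun t => F t * cos t) x y.
Proof.
intros HF.
assert (HI : forall h : R -> R, (forall t, continuous h t) -> is_RInt h x y (RInt h x y)).
{ intros h Hh. apply (RInt_correct (V := R_CompleteNormedModule)).
  apply (ex_RInt_continuous (V := R_CompleteNormedModule)). intros t _. apply Hh. }
assert (Hs : forall t, continuous (fun t => F t * sin t) t).
{ intro t. apply (continuous_mult (K := R_AbsRing)); [apply HF | apply continuous_sin]. }
assert (Hc : forall t, continuous (fun t => F t * cos t) t).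
{ intro t. apply (continuous_mult (K := R_AbsRing)); [apply HF | apply continuous_cos]. }
apply (is_RInt_unique (V := R_CompleteNormedModule)).
apply (is_RInt_ext (V := R_NormedModule)
  (fun t => minus (minus (scal l0 (F t)) (scal l1 (F t * sin t))) (scal l2 (F t * cos t)))).
- intros t _. unfold minus, plus, opp, scal; simpl. unfold mult; simpl. unfold conic. ring.
- apply (is_RInt_minus (V := R_NormedModule)); [apply (is_RInt_minus (V := R_NormedModule)) |];
    apply (is_RInt_scal (V := R_NormedModule)); apply HI; assumption.
Qed.

(** Along the Hamiltonian flow of [D] the integrand changes, up to the factor
    [e b2], by a total derivative in the polar angle: the flow moves the point on the
    conic at the rate [alpha], and [V] changes by the derivative of [W] along
    the Kepler motion. *)
Lemma mean_integral_variation (V Vv Vt W Wv Wt : R -> R -> R) (b0 b1 b2 e kap : R) :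
  let v := conic b0 b1 b2 in
  let dv := fun t => b2 * sin t - b1 * cos t in
  (forall t, is_derive (fun t => V (v t) t) t (Vv (v t) t * dv t + Vt (v t) t)) ->
  (forall t, is_derive (fun t => W (v t) t) t (Wv (v t) t * dv t + Wt (v t) t)) ->
  (forall t, continuous (fun t => Vv (v t) t) t) ->
  (forall u, V u (2 * PI) = V u 0 /\ W u (2 * PI) = W u 0) ->
  (forall t, Vt (v t) t * (e * cos t) = (1 + v t ^ 2) * Wv (v t) t) ->
  (forall t, (1 + v t ^ 2) * (e * cos t) * Vv (v t) t
     + Vt (v t) t * (2 * kap + 2 * e * v t * sin t) = (1 + v t ^ 2) * Wt (v t) t) ->
  RInt (fun t => weighted_dv V Vv (v t) t *
     conic (- 2 * e * b0 * b2) (- 2 * e * b1 * b2 + 2 * kap * b2)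
       (e * (b1 ^ 2 - b2 ^ 2 - b0 ^ 2 - 1) - 2 * kap * b1) t) 0 (2 * PI)
  = e * b2 * mean_integral V b0 b1 b2.
Proof.
intros v dv HV HW HVv Hper Hi1 Hi2. unfold mean_integral. fold v.
set (L := conic _ _ _).
set (alpha := fun t => 2 * kap + 2 * e * v t * sin t + e * cos t * dv t).
(* The primitive: W, minus the weighted potential transported at the rate alpha. It is 2
   PI-periodic, so its derivative integrates to zero. *)
set (S := fun t => W (v t) t - V (v t) t * alpha t / (1 + v t ^ 2)).
set (F := fun t => weighted_dv V Vv (v t) t * L t).
set (G := fun t => weighted V (v t) t).
assert (Hv : forall t, is_derive v t (dv t)).
{ intro t. unfold v, dv, conic. auto_derive; [exact I | ring]. }
assert (Hpos : forall t, 1 + v t ^ 2 <> 0) by (intro t; nra).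
assert (HS : forall t, is_derive S t (F t - e * b2 * G t)).
{ intro t. unfold S.
  assert (Ha : is_derive alpha t (2 * e * (dv t * sin t + v t * cos t)
     - e * sin t * dv t + e * cos t * (b2 * cos t + b1 * sin t))).
  { unfold alpha, dv. pose proof (Hv t) as Hvt.
    eapply is_derive_eq; [auto_derive; [repeat apply conj; try exact I; eexists; exact Hvt
      | reflexivity] |].
    rewrite (is_derive_unique (fun s : R => v s) _ _ Hvt). unfold dv. ring. }
  assert (Hden : is_derive (fun s => 1 + v s ^ 2) t (2 * v t * dv t)).
  { pose proof (Hv t) as Hvt.
    eapply is_derive_eq; [auto_derive; [repeat apply conj; try exact I; eexists; exact Hvt
      | reflexivity] |].
    rewrite (is_derive_unique (fun s : R => v s) _ _ Hvt). ring. }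
  eapply is_derive_eq.
  - apply (is_derive_minus (V := R_NormedModule)); [apply HW |].
    apply (is_derive_div (fun s => V (v s) s * alpha s)); [| exact Hden | apply Hpos].
    apply (is_derive_mult _ _ _ _ _ (HV t) Ha). intros; apply Rmult_comm.
  - unfold minus, plus, opp, mult; simpl. unfold F, G, weighted, weighted_dv.
    specialize (Hi1 t). specialize (Hi2 t). specialize (Hpos t).
    assert (Hw1 : Wv (v t) t = Vt (v t) t * (e * cos t) / (1 + v t ^ 2))
      by (rewrite Hi1; field; exact Hpos).
    assert (Hw2 : Wt (v t) t = ((1 + v t ^ 2) * (e * cos t) * Vv (v t) t
      + Vt (v t) t * (2 * kap + 2 * e * v t * sin t)) / (1 + v t ^ 2))
      by (rewrite Hi2; field; exact Hpos).
    rewrite Hw1, Hw2. unfold alpha.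
    (* L is the change of v at fixed polar angle. Adding the drift alpha times the slope dv gives
       the change of v at the moving point, which is (1 + v^2) e cos t. *)
    assert (HL : L t = (1 + v t ^ 2) * (e * cos t)
      - (2 * kap + 2 * e * v t * sin t + e * cos t * dv t) * dv t).
    { assert (Hc2 : cos t ^ 2 = 1 - sin t ^ 2)
        by (pose proof (sin2_cos2 t) as H; unfold Rsqr in H; lra).
      unfold L, dv, v, conic. ring [Hc2]. }
    rewrite HL. revert Hpos. clear.
    assert (Hc2 : cos t ^ 2 = 1 - sin t ^ 2)
        by (pose proof (sin2_cos2 t) as H; unfold Rsqr in H; lra).
    revert Hc2.
    unfold dv. generalize (Vv (v t) t) (Vt (v t) t) (V (v t) t) (v t) (sin t) (cos t).
    intros pv pt p y s c Hc2 Hpos. field_simplify_eq; [| exact Hpos]. ring [Hc2]. }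
assert (HG : forall t, continuous G t).
{ intro t. unfold G, weighted. apply (continuous_mult (K := R_AbsRing)).
  - eapply is_derive_continuous. apply HV.
  - apply continuous_Rinv_comp; [| apply Hpos].
    apply (continuous_plus (V := R_NormedModule)); [apply continuous_const |].
    apply (continuous_comp v (fun y => y ^ 2)); [eapply is_derive_continuous; apply Hv |].
    apply (ex_derive_continuous (K := R_AbsRing) (V := R_NormedModule)). auto_derive. exact I. }
assert (HF : forall t, continuous F t).
{ intro t. unfold F. apply (continuous_mult (K := R_AbsRing)).
  - assert (HE : forall s : R, Vv (v s) s * / (1 + v s ^ 2)
      - 2 * v s * (G s * / (1 + v s ^ 2)) = weighted_dv V Vv (v s) s).
    { intro s. unfold weighted_dv, G, weighted. field. apply Hpos. }
    apply (continuous_ext _ _ t HE).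
    assert (Hinv : continuous (fun t => / (1 + v t ^ 2)) t).
    { apply continuous_Rinv_comp; [| apply Hpos].
      apply (continuous_plus (V := R_NormedModule)); [apply continuous_const |].
      apply (continuous_comp v (fun y => y ^ 2)); [eapply is_derive_continuous; apply Hv |].
      apply (ex_derive_continuous (K := R_AbsRing) (V := R_NormedModule)). auto_derive.
      exact I. }
    apply (continuous_minus (V := R_NormedModule));
      apply (continuous_mult (K := R_AbsRing)).
    + apply HVv.
    + exact Hinv.
    + apply (continuous_mult (K := R_AbsRing)); [apply continuous_const |].
      eapply is_derive_continuous. apply Hv.
    + apply (continuous_mult (K := R_AbsRing)); [apply HG | exact Hinv].
  - unfold L, conic. apply (ex_derive_continuous (K := R_AbsRing) (V := R_NormedModule)).
    auto_derive. exact I. }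
assert (HIF : is_RInt F 0 (2 * PI) (RInt F 0 (2 * PI))).
{ apply (RInt_correct (V := R_CompleteNormedModule)).
  apply (ex_RInt_continuous (V := R_CompleteNormedModule)). intros t _. apply HF. }
assert (HIG : is_RInt G 0 (2 * PI) (RInt G 0 (2 * PI))).
{ apply (RInt_correct (V := R_CompleteNormedModule)).
  apply (ex_RInt_continuous (V := R_CompleteNormedModule)). intros t _. apply HG. }
assert (HI1 : is_RInt (fun t => F t - e * b2 * G t) 0 (2 * PI)
   (RInt F 0 (2 * PI) - e * b2 * RInt G 0 (2 * PI))).
{ apply (is_RInt_minus (V := R_NormedModule)); [exact HIF |].
  apply (is_RInt_scal (V := R_NormedModule)). exact HIG. }
assert (HI2 : is_RInt (fun t => F t - e * b2 * G t) 0 (2 * PI) (S (2 * PI) - S 0)).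
{ apply (is_RInt_derive (V := R_CompleteNormedModule) S); intros t _; [apply HS |].
  apply (continuous_minus (V := R_NormedModule)); [apply HF |].
  apply (continuous_mult (K := R_AbsRing)); [apply continuous_const | apply HG]. }
assert (HSper : S (2 * PI) = S 0).
{ assert (Ev : v (2 * PI) = v 0)
    by (unfold v, conic; rewrite sin_2PI, cos_2PI, sin_0, cos_0; reflexivity).
  unfold S, alpha, dv. rewrite Ev, (proj1 (Hper _)), (proj2 (Hper _)).
  rewrite sin_2PI, cos_2PI, sin_0, cos_0. reflexivity. }
pose proof (is_RInt_unique (V := R_CompleteNormedModule) _ _ _ _ HI1) as E1.
pose proof (is_RInt_unique (V := R_CompleteNormedModule) _ _ _ _ HI2) as E2.
rewrite HSper in E2. pose proof (eq_trans (eq_sym E1) E2) as E.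
revert E. change (RInt F 0 (2 * PI) - e * b2 * RInt G 0 (2 * PI) = S 0 - S 0 ->
  RInt F 0 (2 * PI) = e * b2 * RInt G 0 (2 * PI)).
intros E. lra.
Qed.

(** * Poisson brackets and differentiation of the average *)

(** The constant potential: the normalising integral M is its [mean_integral], so M obeys the same
    lemmas as N, with zero correction. *)
Definition one (_ _ : R) : R := 1.

Definition beta0 (a m1 x y p q : R) : R := bfac a * m1 / ang a x y p q ^ 2.
Definition beta1 (a m1 x y p q : R) : R :=
  bfac a * lap1 a m1 x y p q / ang a x y p q ^ 2 - a.
Definition beta2 (a m1 x y p q : R) : R :=
  bfac a * lap2 a m1 x y p q / ang a x y p q ^ 2.

(** Existence of an orbit turns the choice in [kepler_flow] into an actual orbit, [orbit_state]
    describes any such orbit, and existence of a minimal period does the same for [kepler_period].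
    The time integral then becomes one over the polar angle. *)
Lemma average_of_can (a m1 m2 f x y p q : R) :
  0 < a -> 0 < m1 -> admissible a m1 x y p q ->
  average a m1 (Vsph2 a m2 f) (of_can x y p q) =
    mean_integral (pot a m2 f) (beta0 a m1 x y p q) (beta1 a m1 x y p q) (beta2 a m1 x y p q)
    / mean_integral one (beta0 a m1 x y p q) (beta1 a m1 x y p q) (beta2 a m1 x y p q).
Proof.
intros Ha Hm Hadm. pose proof Hadm as [Hr [HC [HA HD]]]. pose proof (bfac_pos a) as Hb.
pose proof (epsilon_spec (inhabits (fun _ : R => of_can x y p q)) _
  (kepler_orbit_exists a m1 x y p q Hm Hadm)) as Hflow.
fold (kepler_flow a m1 (of_can x y p q)) in Hflow.
destruct (orbit_state a m1 x y p q _ HC Hflow) as [phi Hphi].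
unfold beta0, beta1, beta2.
set (C := ang a x y p q) in *. set (A1 := lap1 a m1 x y p q) in *.
set (A2 := lap2 a m1 x y p q) in *.
set (g := kepler_flow a m1 (of_can x y p q)) in *.
assert (Hmin := motion_minimal_period a m1 C A1 A2 phi g Hm HC HA
  (fun t => proj1 (Hphi t)) (fun t => proj2 (Hphi t))). cbv zeta in Hmin.
set (T := time_law a m1 (C ^ 2) A1 A2 (2 * PI) / Rabs C) in Hmin.
(* A minimal period is unique: each of two candidates is at most the other. *)
assert (HT : kepler_period a m1 (of_can x y p q) = T).
{ assert (Hspec : is_minimal_period g (kepler_period a m1 (of_can x y p q)))
    by (apply (epsilon_spec (inhabits 0) (is_minimal_period g)); exists T; exact Hmin).
  apply Rle_antisym; [apply Hspec, Hmin | apply Hmin, Hspec]. }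
assert (Hdom := fun t => conic_domain a m1 C A1 A2 t Ha Hm HC HA HD).
set (V := fun t => pot a m2 f (psi a m1 (C ^ 2) A1 A2 t) t).
assert (HV : forall t, Vsph2 a m2 f (pos (g t)) = V (phi t)).
{ intro t. rewrite (proj2 (Hphi t)). unfold kepler_state. cbn [pos of_can]. unfold V.
  rewrite <- Vsph2_polar by apply Hdom. rewrite psiE by (apply pow_nonzero, HC).
  replace (bfac a / (bfac a * inv_radius m1 (C ^ 2) A1 A2 (phi t) + a * sin (phi t)
    - a * sin (phi t))) with (/ inv_radius m1 (C ^ 2) A1 A2 (phi t)).
  - reflexivity.
  - assert (0 < inv_radius m1 (C ^ 2) A1 A2 (phi t)).
    { apply inv_radius_pos; try assumption.
      pose proof (pow2_ge_0 C). pose proof (pow_nonzero C 2 HC). lra. }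
    pose proof (Rmult_lt_0_compat _ _ Hb H). field. split; lra. }
assert (HVc : forall t, continuous V t).
{ intro t. apply (continuous_along_conic (pot a m2 f)).
  apply pot_continuity_2d; apply Hdom. }
assert (HVp : forall t, V (t + 2 * PI) = V t).
{ intro t. unfold V, pot, num2, den2, mix2, psi, conic.
  rewrite sin_shift, cos_shift. reflexivity. }
unfold average. rewrite HT. fold g.
rewrite (RInt_ext _ (fun t => V (phi t))) by (intros t _; apply HV).
unfold T. rewrite (motion_average a m1 C A1 A2 phi V HC (fun t => proj1 (Hphi t)) HVc HVp).
f_equal. f_equal. unfold time_law, mean_integral. apply RInt_ext. intros t _.
unfold weighted, one, time_density, psi, Rdiv. rewrite Rmult_1_l. reflexivity.
Qed.

(** * Differentials of the Kepler elements in a direction (dx, dy, dp, dq) *)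

Section Directional.

Variables a m1 x y p q dx dy dp dq : R.

Definition dvx : R :=
  dp + (dx * (x * p + y * q) + x * (dx * p + x * dp + (dy * q + y * dq))).
Definition dvy : R :=
  (dq + (dy * (x * p + y * q) + y * (dx * p + x * dp + (dy * q + y * dq)))) / bfac a.
Definition deta : R := dy / bfac a.
Definition dang : R :=
  dx * vy a x y p q + x * dvy - (deta * vx x y p q + eta a y * dvx).
Definition drho : R := (x * dx + eta a y * deta) / rho a x y.
Definition dlap1 : R :=
  dang * vx x y p q + ang a x y p q * dvx
  + m1 * ((deta * rho a x y - eta a y * drho) / rho a x y ^ 2).
Definition dlap2 : R :=
  m1 * ((dx * rho a x y - x * drho) / rho a x y ^ 2)
  - (dang * vy a x y p q + ang a x y p q * dvy).
Definition dbeta0 : R := bfac a * m1 * (- (2 * dang) / ang a x y p q ^ 3).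
Definition dbeta1 : R :=
  bfac a * (dlap1 / ang a x y p q ^ 2
    - 2 * lap1 a m1 x y p q * dang / ang a x y p q ^ 3).
Definition dbeta2 : R :=
  bfac a * (dlap2 / ang a x y p q ^ 2
    - 2 * lap2 a m1 x y p q * dang / ang a x y p q ^ 3).
Definition dDint : R :=
  2 * ang a x y p q * dang - 2 * a / bfac a * dlap1.
Definition dkepler : R :=
  kepler_dx a m1 x y p q * dx + kepler_dy a m1 x y p q * dy
  + (1 + x ^ 2 + y ^ 2) * vx x y p q * dp
  + (1 + x ^ 2 + y ^ 2) * (bfac a * vy a x y p q) * dq.

End Directional.

(** Stated for arbitrary curves, so that the four coordinate lines through a point are instances of
    one computation. *)
Lemma C1_along (a m1 s dx dy dp dq : R) (X Y P Q : R -> R) :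
  let x := X s in let y := Y s in let p := P s in let q := Q s in
  C1_at X s dx -> C1_at Y s dy -> C1_at P s dp -> C1_at Q s dq ->
  0 < rho a x y ->
  C1_at (fun t => rho a (X t) (Y t)) s (drho a x y dx dy) /\
  C1_at (fun t => ang a (X t) (Y t) (P t) (Q t)) s (dang a x y p q dx dy dp dq) /\
  C1_at (fun t => lap1 a m1 (X t) (Y t) (P t) (Q t)) s (dlap1 a m1 x y p q dx dy dp dq) /\
  C1_at (fun t => lap2 a m1 (X t) (Y t) (P t) (Q t)) s (dlap2 a m1 x y p q dx dy dp dq).
Proof.
intros x y p q HX HY HP HQ Hr. pose proof (bfac_pos a) as Hb.
assert (HL : C1_at (fun t => X t * P t + Y t * Q t) s
  (dx * p + x * dp + (dy * q + y * dq)))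
  by (apply C1_at_plus; apply C1_at_mult; assumption).
assert (Hvx : C1_at (fun t => vx (X t) (Y t) (P t) (Q t)) s (dvx x y p q dx dy dp dq))
  by exact (C1_at_plus _ _ _ _ _ HP (C1_at_mult _ _ _ _ _ HX HL)).
assert (Hvy : C1_at (fun t => vy a (X t) (Y t) (P t) (Q t)) s (dvy a x y p q dx dy dp dq)).
{ eapply C1_at_eq.
  - exact (C1_at_div _ _ _ _ _ (C1_at_plus _ _ _ _ _ HQ (C1_at_mult _ _ _ _ _ HY HL))
      (C1_at_const (bfac a) s) (Rgt_not_eq _ _ Hb)).
  - unfold dvy. fold x y p q. field. lra. }
assert (Heta : C1_at (fun t => eta a (Y t)) s (deta a dy)).
{ eapply C1_at_eq.
  - exact (C1_at_div _ _ _ _ _ (C1_at_minus _ _ _ _ _ HY (C1_at_const a s))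
      (C1_at_const (bfac a) s) (Rgt_not_eq _ _ Hb)).
  - unfold deta. field. lra. }
assert (Hang : C1_at (fun t => ang a (X t) (Y t) (P t) (Q t)) s (dang a x y p q dx dy dp dq))
  by exact (C1_at_minus _ _ _ _ _ (C1_at_mult _ _ _ _ _ HX Hvy)
      (C1_at_mult _ _ _ _ _ Heta Hvx)).
assert (Hrho : C1_at (fun t => rho a (X t) (Y t)) s (drho a x y dx dy)).
{ eapply C1_at_eq.
  (* The power [t ^ 2] unfolds to [t * (t * 1)]; squares are built with the constant factor 1 so
     that the result matches [rho] by conversion. *)
  - refine (C1_at_sqrt _ _ _ (C1_at_plus _ _ _ _ _
      (C1_at_mult _ _ _ _ _ HX (C1_at_mult _ _ _ _ _ HX (C1_at_const 1 s)))
      (C1_at_mult _ _ _ _ _ Heta (C1_at_mult _ _ _ _ _ Heta (C1_at_const 1 s)))) _).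
    change (0 < x ^ 2 + eta a y ^ 2). rewrite <- rho_sqr. apply pow_lt, Hr.
  - change ((dx * (x * 1) + x * (dx * 1 + x * 0)
      + (deta a dy * (eta a y * 1) + eta a y * (deta a dy * 1 + eta a y * 0)))
      * / (2 * rho a x y) = drho a x y dx dy).
    unfold drho. field. lra. }
refine (conj Hrho (conj Hang (conj _ _))).
- eapply C1_at_eq.
  + exact (C1_at_plus _ _ _ _ _ (C1_at_mult _ _ _ _ _ Hang Hvx)
      (C1_at_mult _ _ _ _ _ (C1_at_const m1 s)
        (C1_at_div _ _ _ _ _ Heta Hrho (Rgt_not_eq _ _ Hr)))).
  + cbv beta. fold x y p q. unfold dlap1. ring.
- eapply C1_at_eq.
  + exact (C1_at_minus _ _ _ _ _
      (C1_at_mult _ _ _ _ _ (C1_at_const m1 s)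
        (C1_at_div _ _ _ _ _ HX Hrho (Rgt_not_eq _ _ Hr)))
      (C1_at_mult _ _ _ _ _ Hang Hvy)).
  + cbv beta. fold x y p q. unfold dlap2. ring.
Qed.

(** The Poisson bracket of two functions given by their differentials,
    [F dx dy dp dq] being the derivative in the direction [(dx, dy, dp, dq)]. *)
Definition bracket (F G : R -> R -> R -> R -> R) : R :=
  (F 1 0 0 0 * G 0 0 1 0 - F 0 0 1 0 * G 1 0 0 0)
  + (F 0 1 0 0 * G 0 0 0 1 - F 0 0 0 1 * G 0 1 0 0).

(** * The Poisson algebra of the Kepler elements *)

(** The energy of the projectively corresponding planar Kepler problem, which appears in the bracket
    of the two Laplace components. *)
Definition planar_energy (a m1 x y p q : R) : R :=
  / 2 * (vx x y p q ^ 2 + vy a x y p q ^ 2) - m1 / rho a x y.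

(** Replaces b, eta and rho by variables subject to polynomial relations and expresses y through
    eta, so that the bracket identities become decidable by [ring] modulo these relations. *)
Ltac abstract_square_roots a x y Hr :=
  let H1 := fresh in let H2 := fresh in let H3 := fresh in let H4 := fresh in
  pose proof (bfac_pos a) as H1; pose proof (bfac_sqr a) as H2;
  pose proof (rho_sqr a x y) as H3;
  assert (H4 : y = a + bfac a * eta a y) by (unfold eta; field; lra);
  revert H4 Hr H1 H2 H3; generalize (bfac a) (eta a y) (rho a x y); clear.

Lemma bracket_lap1_ang (a m1 x y p q : R) : 0 < rho a x y ->
  bracket (dlap1 a m1 x y p q) (dang a x y p q) = lap2 a m1 x y p q.
Proof.
intros Hr.
unfold bracket, dlap1, lap2, drho, dang, deta, dvx, dvy, ang, vx, vy.
abstract_square_roots a x y Hr. intros b h r -> Hr Hb Hb2 Hr2.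
field_simplify_eq; [| lra]. ring [Hb2 Hr2].
Qed.

(** The term a C^2 / b, like - C^3 in the bracket of [lap1] and [lap2], is absent from the planar
    Kepler algebra: C and the Laplace vector are planar, but the canonical structure is that of the
    sphere. *)
Lemma bracket_lap2_ang (a m1 x y p q : R) : 0 < rho a x y ->
  bracket (dlap2 a m1 x y p q) (dang a x y p q) =
    a / bfac a * ang a x y p q ^ 2 - lap1 a m1 x y p q.
Proof.
intros Hr.
unfold bracket, dlap2, lap1, drho, dang, deta, dvx, dvy, ang, vx, vy.
abstract_square_roots a x y Hr. intros b h r -> Hr Hb Hb2 Hr2.
field_simplify_eq; [| lra]. ring [Hb2 Hr2].
Qed.

Lemma bracket_lap1_lap2 (a m1 x y p q : R) : 0 < rho a x y ->
  bracket (dlap1 a m1 x y p q) (dlap2 a m1 x y p q) =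
    ang a x y p q * (2 * planar_energy a m1 x y p q - ang a x y p q ^ 2).
Proof.
intros Hr.
unfold bracket, planar_energy, dlap1, dlap2, drho, dang, deta, dvx, dvy, ang, vx, vy.
abstract_square_roots a x y Hr. intros b h r -> Hr Hb Hb2 Hr2.
field_simplify_eq; [| lra]. ring [Hb2 Hr2].
Qed.

(** The classical relation between eccentricity and energy. It eliminates the energy, so that the
    brackets with D close in b0, b1, b2 and C. *)
Lemma lap_sqr (a m1 x y p q : R) : 0 < rho a x y ->
  lap1 a m1 x y p q ^ 2 + lap2 a m1 x y p q ^ 2 =
    m1 ^ 2 + 2 * planar_energy a m1 x y p q * ang a x y p q ^ 2.
Proof.
intros Hr. unfold lap1, lap2, planar_energy, ang.
generalize (vx x y p q) (vy a x y p q).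
pose proof (rho_sqr a x y) as Hr2. revert Hr2 Hr. generalize (rho a x y) (eta a y). clear.
intros r e Hr2 Hr v w. field_simplify_eq; [| lra]. ring [Hr2].
Qed.

Lemma bracket_kepler_ang (a m1 x y p q : R) : 0 < rho a x y ->
  bracket (dkepler a m1 x y p q) (dang a x y p q) = 0.
Proof.
intros Hr.
unfold bracket, dkepler, kepler_dx, kepler_dy, dang, deta, dvx, dvy, ang, vx, vy.
abstract_square_roots a x y Hr. intros b h r -> Hr Hb Hb2 Hr2.
field_simplify_eq; [| lra]. ring [Hb2 Hr2].
Qed.

Lemma bracket_kepler_lap1 (a m1 x y p q : R) : 0 < rho a x y ->
  bracket (dkepler a m1 x y p q) (dlap1 a m1 x y p q) = 0.
Proof.
intros Hr.
unfold bracket, dkepler, kepler_dx, kepler_dy, dlap1, drho, dang, deta, dvx, dvy, ang, vx, vy.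
abstract_square_roots a x y Hr. intros b h r -> Hr Hb Hb2 Hr2.
field_simplify_eq; [| lra]. ring [Hb2 Hr2].
Qed.

Lemma bracket_kepler_Dint (a m1 x y p q : R) : 0 < rho a x y ->
  bracket (dkepler a m1 x y p q) (dDint a m1 x y p q) = 0.
Proof.
intros Hr. pose proof (bfac_pos a) as Hb.
transitivity (2 * ang a x y p q * bracket (dkepler a m1 x y p q) (dang a x y p q)
  - 2 * a / bfac a * bracket (dkepler a m1 x y p q) (dlap1 a m1 x y p q)).
- unfold bracket, dDint. field. lra.
- rewrite bracket_kepler_ang, bracket_kepler_lap1 by exact Hr. ring.
Qed.

(** By the Leibniz rule everything reduces to brackets among [ang], [lap1] and [lap2]. The constants
    e and kap are the sine and cosine of the central angle between Z1 and Z2. After division by C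
    the right-hand sides are the coefficients expected by [mean_integral_variation]. *)
Lemma bracket_beta_Dint (a m1 x y p q : R) : 0 < rho a x y -> ang a x y p q <> 0 ->
  let b0 := beta0 a m1 x y p q in let b1 := beta1 a m1 x y p q in
  let b2 := beta2 a m1 x y p q in let C := ang a x y p q in
  let e := 2 * a / bfac a ^ 2 in let kap := (1 - a ^ 2) / bfac a ^ 2 in
  bracket (dbeta0 a m1 x y p q) (dDint a m1 x y p q) = C * (- 2 * e * b0 * b2) /\
  bracket (dbeta1 a m1 x y p q) (dDint a m1 x y p q) =
    C * (- 2 * e * b1 * b2 + 2 * kap * b2) /\
  bracket (dbeta2 a m1 x y p q) (dDint a m1 x y p q) =
    C * (e * (b1 ^ 2 - b2 ^ 2 - b0 ^ 2 - 1) - 2 * kap * b1).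
Proof.
intros Hr HC b0 b1 b2 C e kap. pose proof (bfac_pos a) as Hb.
pose proof (bfac_sqr a) as Hb2.
pose proof (bracket_lap1_ang a m1 x y p q Hr) as E1.
pose proof (bracket_lap2_ang a m1 x y p q Hr) as E2.
pose proof (bracket_lap1_lap2 a m1 x y p q Hr) as E3.
pose proof (lap_sqr a m1 x y p q Hr) as E4.
unfold b0, b1, b2, e, kap, beta0, beta1, beta2. fold C in E1, E2, E3, E4 |- *.
set (A1 := lap1 a m1 x y p q) in *. set (A2 := lap2 a m1 x y p q) in *.
set (h := planar_energy a m1 x y p q) in *.
assert (HC' : C <> 0) by exact HC.
assert (Hb0 : bfac a <> 0) by lra.
refine (conj _ (conj _ _)).
- transitivity (bfac a * m1 * (- 2 / C ^ 3) * (2 * a / bfac a)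
    * bracket (dlap1 a m1 x y p q) (dang a x y p q)).
  + unfold bracket, dbeta0, dDint. fold C. field. split; assumption.
  + rewrite E1. field. split; assumption.
- transitivity (bfac a * (2 / C - 4 * a * A1 / (bfac a * C ^ 3))
    * bracket (dlap1 a m1 x y p q) (dang a x y p q)).
  + unfold bracket, dbeta1, dDint. fold C A1. field. split; assumption.
  + rewrite E1. field_simplify_eq; [| split; assumption]. ring [Hb2].
- transitivity (bfac a * (2 / C * bracket (dlap2 a m1 x y p q) (dang a x y p q)
    + 2 * a / bfac a / C ^ 2 * bracket (dlap1 a m1 x y p q) (dlap2 a m1 x y p q)
    - 4 * a * A2 / (bfac a * C ^ 3) * bracket (dlap1 a m1 x y p q) (dang a x y p q))).
  + unfold bracket, dbeta2, dDint. fold C A2. field. split; assumption.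
  + rewrite E1, E2, E3.
    assert (Hm : m1 ^ 2 = A1 ^ 2 + A2 ^ 2 - 2 * h * C ^ 2) by lra.
    field_simplify_eq; [| split; assumption]. ring [Hb2 Hm].
Qed.

(** * Differentiability along curves through an admissible point *)

Section Along.

Variables (a m1 s dx dy dp dq : R) (X Y P Q : R -> R).
Hypotheses (HX : C1_at X s dx) (HY : C1_at Y s dy) (HP : C1_at P s dp) (HQ : C1_at Q s dq).
Hypothesis Hadm : admissible a m1 (X s) (Y s) (P s) (Q s).

Lemma admissible_locally : locally s (fun t => admissible a m1 (X t) (Y t) (P t) (Q t)).
Proof.
destruct Hadm as [Hr [HC [HA HD]]].
destruct (C1_along a m1 s dx dy dp dq X Y P Q HX HY HP HQ Hr) as [Cr [CC [C1 C2]]].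
apply C1_at_continuous in Cr, CC, C1, C2.
set (r := fun t => rho a (X t) (Y t)) in *.
set (C := fun t => ang a (X t) (Y t) (P t) (Q t)) in *.
set (A1 := fun t => lap1 a m1 (X t) (Y t) (P t) (Q t)) in *.
set (A2 := fun t => lap2 a m1 (X t) (Y t) (P t) (Q t)) in *.
assert (Hpow : forall h : R -> R, continuous h s -> continuous (fun t => h t ^ 2) s).
{ intros h Hh. apply (continuous_comp h (fun u => u ^ 2)); [exact Hh |].
  apply (ex_derive_continuous (K := R_AbsRing) (V := R_NormedModule)). auto_derive. exact I. }
assert (L1 : locally s (fun t => 0 < r t)) by exact (Cr _ (locally_gt _ _ Hr)).
assert (L2 : locally s (fun t => C t <> 0)) by exact (CC _ (locally_neq0 _ HC)).
assert (L3 : locally s (fun t => 0 < m1 ^ 2 - (A1 t ^ 2 + A2 t ^ 2))).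
{ assert (Hc : continuous (fun t => m1 ^ 2 - (A1 t ^ 2 + A2 t ^ 2)) s).
  { apply (continuous_minus (V := R_NormedModule)); [apply continuous_const |].
    apply (continuous_plus (V := R_NormedModule)); apply Hpow; assumption. }
  apply (Hc (fun u => 0 < u)). apply locally_gt. unfold A1, A2. lra. }
assert (L4 : locally s (fun t => C t ^ 2 - 2 * a / bfac a * A1 t - 2 * a / bfac a * m1 <> 0)).
{ assert (Hc : continuous (fun t => C t ^ 2 - 2 * a / bfac a * A1 t - 2 * a / bfac a * m1) s).
  { apply (continuous_minus (V := R_NormedModule)); [| apply continuous_const].
    apply (continuous_minus (V := R_NormedModule)); [apply Hpow; assumption |].
    apply (continuous_mult (K := R_AbsRing)); [apply continuous_const | assumption]. }
  apply (Hc (fun u => u <> 0)). apply locally_neq0. unfold C, A1. intro H. apply HD. lra. }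
generalize (filter_and _ _ (filter_and _ _ L1 L2) (filter_and _ _ L3 L4)).
apply filter_imp. intros t [[T1 T2] [T3 T4]].
refine (conj T1 (conj T2 (conj _ _))).
- unfold A1, A2 in T3. lra.
- intro H. apply T4. unfold C, A1. lra.
Qed.

Lemma C1_beta :
  let x := X s in let y := Y s in let p := P s in let q := Q s in
  C1_at (fun t => beta0 a m1 (X t) (Y t) (P t) (Q t)) s (dbeta0 a m1 x y p q dx dy dp dq) /\
  C1_at (fun t => beta1 a m1 (X t) (Y t) (P t) (Q t)) s (dbeta1 a m1 x y p q dx dy dp dq) /\
  C1_at (fun t => beta2 a m1 (X t) (Y t) (P t) (Q t)) s (dbeta2 a m1 x y p q dx dy dp dq).
Proof.
intros x y p q. destruct Hadm as [Hr [HC _]].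
destruct (C1_along a m1 s dx dy dp dq X Y P Q HX HY HP HQ Hr) as [_ [CC [C1 C2]]].
pose proof (C1_at_mult _ _ _ _ _ CC (C1_at_mult _ _ _ _ _ CC (C1_at_const 1 s))) as CC2.
pose proof (pow_nonzero _ 2 HC) as HC2.
refine (conj _ (conj _ _)); eapply C1_at_eq.
- exact (C1_at_div _ _ _ _ _ (C1_at_const (bfac a * m1) s) CC2 HC2).
- cbv beta. fold x y p q. unfold dbeta0. field. exact HC.
- exact (C1_at_minus _ _ _ _ _ (C1_at_div _ _ _ _ _
    (C1_at_mult _ _ _ _ _ (C1_at_const (bfac a) s) C1) CC2 HC2) (C1_at_const a s)).
- cbv beta. fold x y p q. unfold dbeta1. field. exact HC.
- exact (C1_at_div _ _ _ _ _
    (C1_at_mult _ _ _ _ _ (C1_at_const (bfac a) s) C2) CC2 HC2).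
- cbv beta. fold x y p q. unfold dbeta2. field. exact HC.
Qed.

Lemma is_derive_Dint_along :
  is_derive (fun t => Dint a m1 (of_can (X t) (Y t) (P t) (Q t))) s
    (dDint a m1 (X s) (Y s) (P s) (Q s) dx dy dp dq).
Proof.
destruct Hadm as [Hr _]. pose proof (bfac_pos a) as Hb.
destruct (C1_along a m1 s dx dy dp dq X Y P Q HX HY HP HQ Hr) as [_ [CC [C1 _]]].
assert (HE : forall t : R, ang a (X t) (Y t) (P t) (Q t) * (ang a (X t) (Y t) (P t) (Q t) * 1)
   - 2 * a / bfac a * lap1 a m1 (X t) (Y t) (P t) (Q t)
   = Dint a m1 (of_can (X t) (Y t) (P t) (Q t))).
{ intro t. rewrite Dint_of_can. reflexivity. }
apply (is_derive_ext _ _ _ _ HE). apply C1_at_derive. eapply C1_at_eq.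
- exact (C1_at_minus _ _ _ _ _
    (C1_at_mult _ _ _ _ _ CC (C1_at_mult _ _ _ _ _ CC (C1_at_const 1 s)))
    (C1_at_mult _ _ _ _ _ (C1_at_const (2 * a / bfac a) s) C1)).
- cbv beta. unfold dDint. ring.
Qed.

End Along.

(** * The differential of the average and its bracket with D *)

Lemma one_regular (v t : R) :
  is_derive (fun u => one u t) v 0 /\ continuity_2d_pt one v t /\
  continuity_2d_pt (fun _ _ => 0) v t.
Proof.
refine (conj _ (conj _ _)); [| apply continuity_2d_pt_const ..].
exact (is_derive_const (V := R_NormedModule) 1 v).
Qed.

Lemma mean_one_pos (b0 b1 b2 : R) : 0 < mean_integral one b0 b1 b2.
Proof.
unfold mean_integral. apply RInt_gt_0.
- pose proof PI_RGT_0. lra.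
- intros t _. unfold weighted, one. apply Rdiv_lt_0_compat; nra.
- intros t _. apply (continuous_along_conic (weighted one)).
  destruct (one_regular (conic b0 b1 b2 t) t) as [H1 [H2 H3]].
  apply (weighted_regular one (fun _ _ => 0) _ _ H1 H2 H3).
Qed.

Definition mean_variation (V Vv : R -> R -> R) (b0 b1 b2 l0 l1 l2 : R) : R :=
  RInt (fun t => weighted_dv V Vv (conic b0 b1 b2 t) t * conic l0 l1 l2 t) 0 (2 * PI).

Definition regular_at (V Vv : R -> R -> R) (b0 b1 b2 : R) : Prop :=
  forall t, let v := conic b0 b1 b2 t in
    is_derive (fun u => V u t) v (Vv v t) /\
    continuity_2d_pt V v t /\ continuity_2d_pt Vv v t.

Lemma is_derive_mean_integral (V Vv : R -> R -> R) (b0 b1 b2 : R -> R) (s l0 l1 l2 : R) :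
  C1_at b0 s l0 -> C1_at b1 s l1 -> C1_at b2 s l2 ->
  locally s (fun r => regular_at V Vv (b0 r) (b1 r) (b2 r)) ->
  is_derive (fun r => mean_integral V (b0 r) (b1 r) (b2 r)) s
    (mean_variation V Vv (b0 s) (b1 s) (b2 s) l0 l1 l2).
Proof.
intros H0 H1 H2 Hreg.
apply (is_derive_RInt_conic (weighted V) (weighted_dv V Vv) b0 b1 b2); try assumption;
  generalize Hreg; apply filter_imp; intros r Hr t; destruct (Hr t) as [D1 [D2 D3]];
  destruct (weighted_regular V Vv _ t D1 D2 D3) as [E1 [E2 E3]]; auto.
Qed.

(** Linearity in the variations of b0, b1, b2 lets a bracket of an integral be written as a
    combination of the three brackets of the elements. *)
Lemma mean_variation_linear (V Vv : R -> R -> R) (b0 b1 b2 : R) :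
  regular_at V Vv b0 b1 b2 ->
  exists g0 g1 g2, forall l0 l1 l2,
    mean_variation V Vv b0 b1 b2 l0 l1 l2 = l0 * g0 - l1 * g1 - l2 * g2.
Proof.
intros Hreg. do 3 eexists. intros l0 l1 l2.
apply (RInt_conic_linear (fun t => weighted_dv V Vv (conic b0 b1 b2 t) t)).
intro t. apply (continuous_along_conic (weighted_dv V Vv)).
destruct (Hreg t) as [D1 [D2 D3]]. apply (weighted_regular V Vv _ t D1 D2 D3).
Qed.

Lemma pot_regular (a m1 m2 f x y p q : R) : 0 < a -> 0 < m1 -> admissible a m1 x y p q ->
  regular_at (pot a m2 f) (pot_dv a m2 f)
    (beta0 a m1 x y p q) (beta1 a m1 x y p q) (beta2 a m1 x y p q).
Proof.
intros Ha Hm [_ [HC [HA HD]]] t v.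
destruct (conic_domain a m1 _ _ _ t Ha Hm HC HA HD) as [H1 H2].
split; [apply is_derive_pot_v; assumption | apply pot_continuity_2d; assumption].
Qed.

Lemma pot_variation (a m1 m2 f x y p q : R) : 0 < a -> 0 < m1 -> admissible a m1 x y p q ->
  let b0 := beta0 a m1 x y p q in let b1 := beta1 a m1 x y p q in
  let b2 := beta2 a m1 x y p q in
  let e := 2 * a / bfac a ^ 2 in let kap := (1 - a ^ 2) / bfac a ^ 2 in
  mean_variation (pot a m2 f) (pot_dv a m2 f) b0 b1 b2 (- 2 * e * b0 * b2)
    (- 2 * e * b1 * b2 + 2 * kap * b2) (e * (b1 ^ 2 - b2 ^ 2 - b0 ^ 2 - 1) - 2 * kap * b1)
  = e * b2 * mean_integral (pot a m2 f) b0 b1 b2.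
Proof.
intros Ha Hm Hadm b0 b1 b2 e kap.
pose proof (pot_regular a m1 m2 f x y p q Ha Hm Hadm) as Hreg.
destruct Hadm as [_ [HC [HA HD]]].
pose proof (fun t => conic_domain a m1 _ _ _ t Ha Hm HC HA HD) as Hdom.
assert (Hv : forall t, is_derive (conic b0 b1 b2) t (b2 * sin t - b1 * cos t)).
{ intro t. unfold conic. auto_derive; [exact I | ring]. }
apply (mean_integral_variation (pot a m2 f) (pot_dv a m2 f) (pot_dt a m2 f)
  (corr a m2 f) (corr_dv a m2 f) (corr_dt a m2 f)).
- intro t. apply is_derive_pot; [apply Hv | apply Hdom ..].
- intro t. apply is_derive_pot; [apply Hv | apply Hdom ..].
- intro t. apply (continuous_along_conic (pot_dv a m2 f)). apply Hreg.
- intro u. unfold pot, corr, num2, den2, mix2.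
  rewrite sin_2PI, cos_2PI, sin_0, cos_0. split; reflexivity.
- intro t. apply pot_corr; apply Hdom.
- intro t. apply pot_corr; apply Hdom.
Qed.

Lemma one_variation (b0 b1 b2 e kap : R) :
  mean_variation one (fun _ _ => 0) b0 b1 b2 (- 2 * e * b0 * b2)
    (- 2 * e * b1 * b2 + 2 * kap * b2) (e * (b1 ^ 2 - b2 ^ 2 - b0 ^ 2 - 1) - 2 * kap * b1)
  = e * b2 * mean_integral one b0 b1 b2.
Proof.
apply (mean_integral_variation one (fun _ _ => 0) (fun _ _ => 0)
  (fun _ _ => 0) (fun _ _ => 0) (fun _ _ => 0)); try (intro t; ring).
- intro t. rewrite Rmult_0_l, Rplus_0_l. exact (is_derive_const (V := R_NormedModule) 1 t).
- intro t. rewrite Rmult_0_l, Rplus_0_l. exact (is_derive_const (V := R_NormedModule) 0 t).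
- intro t. apply continuous_const.
- intro u. split; reflexivity.
Qed.

Definition average_variation (V Vv : R -> R -> R) (b0 b1 b2 l0 l1 l2 : R) : R :=
  (mean_variation V Vv b0 b1 b2 l0 l1 l2 * mean_integral one b0 b1 b2
   - mean_integral V b0 b1 b2 * mean_variation one (fun _ _ => 0) b0 b1 b2 l0 l1 l2)
  / mean_integral one b0 b1 b2 ^ 2.

Definition daverage (a m1 m2 f x y p q dx dy dp dq : R) : R :=
  average_variation (pot a m2 f) (pot_dv a m2 f)
    (beta0 a m1 x y p q) (beta1 a m1 x y p q) (beta2 a m1 x y p q)
    (dbeta0 a m1 x y p q dx dy dp dq) (dbeta1 a m1 x y p q dx dy dp dq)
    (dbeta2 a m1 x y p q dx dy dp dq).

Lemma is_derive_average_along (a m1 m2 f s dx dy dp dq : R) (X Y P Q : R -> R) :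
  0 < a -> 0 < m1 ->
  C1_at X s dx -> C1_at Y s dy -> C1_at P s dp -> C1_at Q s dq ->
  admissible a m1 (X s) (Y s) (P s) (Q s) ->
  is_derive (fun t => average a m1 (Vsph2 a m2 f) (of_can (X t) (Y t) (P t) (Q t))) s
    (daverage a m1 m2 f (X s) (Y s) (P s) (Q s) dx dy dp dq).
Proof.
intros Ha Hm HX HY HP HQ Hadm.
pose proof (admissible_locally a m1 s dx dy dp dq X Y P Q HX HY HP HQ Hadm) as Hloc.
destruct (C1_beta a m1 s dx dy dp dq X Y P Q HX HY HP HQ Hadm) as [B0 [B1 B2]].
set (N := fun t => mean_integral (pot a m2 f) (beta0 a m1 (X t) (Y t) (P t) (Q t))
  (beta1 a m1 (X t) (Y t) (P t) (Q t)) (beta2 a m1 (X t) (Y t) (P t) (Q t))).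
set (M := fun t => mean_integral one (beta0 a m1 (X t) (Y t) (P t) (Q t))
  (beta1 a m1 (X t) (Y t) (P t) (Q t)) (beta2 a m1 (X t) (Y t) (P t) (Q t))).
(* The quotient formula holds only at admissible points, that is for t near s. *)
apply (is_derive_ext_loc (fun t => N t / M t)).
- generalize Hloc. apply filter_imp. intros t Ht. symmetry.
  apply (average_of_can a m1 m2 f _ _ _ _ Ha Hm Ht).
- apply (is_derive_div N M).
  + apply (is_derive_mean_integral (pot a m2 f) (pot_dv a m2 f) _ _ _ _ _ _ _ B0 B1 B2).
    generalize Hloc. apply filter_imp. intros t Ht. apply pot_regular; assumption.
  + apply (is_derive_mean_integral one (fun _ _ => 0) _ _ _ _ _ _ _ B0 B1 B2).
    apply filter_forall. intros t u. apply one_regular.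
  + apply not_eq_sym, Rlt_not_eq. exact (mean_one_pos _ _ _).
Qed.

Lemma bracket_average_Dint (a m1 m2 f x y p q : R) :
  0 < a -> 0 < m1 -> admissible a m1 x y p q ->
  bracket (daverage a m1 m2 f x y p q) (dDint a m1 x y p q) = 0.
Proof.
intros Ha Hm Hadm. pose proof Hadm as [Hr [HC _]].
set (b0 := beta0 a m1 x y p q). set (b1 := beta1 a m1 x y p q).
set (b2 := beta2 a m1 x y p q).
destruct (bracket_beta_Dint a m1 x y p q Hr HC) as [E0 [E1 E2]].
fold b0 b1 b2 in E0, E1, E2.
pose proof (pot_variation a m1 m2 f x y p q Ha Hm Hadm) as EV. cbv zeta in EV.
fold b0 b1 b2 in EV.
pose proof (one_variation b0 b1 b2 (2 * a / bfac a ^ 2) ((1 - a ^ 2) / bfac a ^ 2)) as EO.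
pose proof (mean_one_pos b0 b1 b2) as HM.
destruct (mean_variation_linear _ _ _ _ _ (pot_regular a m1 m2 f x y p q Ha Hm Hadm))
  as [g0 [g1 [g2 Hg]]].
destruct (mean_variation_linear one (fun _ _ => 0) b0 b1 b2) as [h0 [h1 [h2 Hh]]];
  [intros t u; apply one_regular |].
fold b0 b1 b2 in Hg.
rewrite Hg in EV. rewrite Hh in EO.
unfold daverage, average_variation. fold b0 b1 b2.
set (N := mean_integral (pot a m2 f) b0 b1 b2) in *.
set (M := mean_integral one b0 b1 b2) in *.
transitivity (((g0 * bracket (dbeta0 a m1 x y p q) (dDint a m1 x y p q)
    - g1 * bracket (dbeta1 a m1 x y p q) (dDint a m1 x y p q)
    - g2 * bracket (dbeta2 a m1 x y p q) (dDint a m1 x y p q)) * M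
  - N * (h0 * bracket (dbeta0 a m1 x y p q) (dDint a m1 x y p q)
    - h1 * bracket (dbeta1 a m1 x y p q) (dDint a m1 x y p q)
    - h2 * bracket (dbeta2 a m1 x y p q) (dDint a m1 x y p q))) / M ^ 2).
- unfold bracket. rewrite !Hg, !Hh. field. lra.
- rewrite E0, E1, E2. revert EV EO.
  generalize (- 2 * (2 * a / bfac a ^ 2) * b0 * b2)
    (- 2 * (2 * a / bfac a ^ 2) * b1 * b2 + 2 * ((1 - a ^ 2) / bfac a ^ 2) * b2)
    (2 * a / bfac a ^ 2 * (b1 ^ 2 - b2 ^ 2 - b0 ^ 2 - 1)
      - 2 * ((1 - a ^ 2) / bfac a ^ 2) * b1).
  intros l0 l1 l2 EV EO.
  (* Both numerators have been reduced to C times a variation, and by [EV] and [EO] these are e b2 N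
     and e b2 M, so the two products cancel. *)
  transitivity (ang a x y p q * ((l0 * g0 - l1 * g1 - l2 * g2) * M
    - N * (l0 * h0 - l1 * h1 - l2 * h2)) / M ^ 2); [field; lra |].
  pose proof (bfac_pos a). rewrite EV, EO. field. split; lra.
Qed.

Theorem proposition3p2 :
  forall a m1 m2 f : R, 0 < a -> 0 < m1 ->
  forall z : tpoint, Rs a m1 z ->
    ex_partials (Esph_avg a m1 m2 f) z /\
    ex_partials (Dint a m1) z /\
    poisson (Esph_avg a m1 m2 f) (Dint a m1) z = 0.
Proof.
intros a m1 m2 f Ha Hm z Hz.
pose proof (Rs_admissible a m1 z Ha Hm Hz) as Hadm.
pose proof (EsKep_partials a m1 z (proj1 Hadm)) as HK. cbv zeta in HK.
set (x := can_x z) in *. set (y := can_y z) in *.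
set (p := can_px z) in *. set (q := can_py z) in *.
destruct HK as [K1 [K2 [K3 K4]]].
(* The partial derivatives are those along the four coordinate lines: one coordinate is the
   identity, the other three are constant. The functions [along_x] and its analogues are convertible
   to these compositions. *)
pose proof C1_at_id as Hid. pose proof C1_at_const as Hcst.
assert (D1 : is_derive (along_x (Dint a m1) z) x (dDint a m1 x y p q 1 0 0 0))
  by exact (is_derive_Dint_along a m1 x 1 0 0 0 (fun t => t) (fun _ => y) (fun _ => p)
    (fun _ => q) (Hid _) (Hcst _ _) (Hcst _ _) (Hcst _ _) Hadm).
assert (D2 : is_derive (along_y (Dint a m1) z) y (dDint a m1 x y p q 0 1 0 0))
  by exact (is_derive_Dint_along a m1 y 0 1 0 0 (fun _ => x) (fun t => t) (fun _ => p)
    (fun _ => q) (Hcst _ _) (Hid _) (Hcst _ _) (Hcst _ _) Hadm).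
assert (D3 : is_derive (along_px (Dint a m1) z) p (dDint a m1 x y p q 0 0 1 0))
  by exact (is_derive_Dint_along a m1 p 0 0 1 0 (fun _ => x) (fun _ => y) (fun t => t)
    (fun _ => q) (Hcst _ _) (Hcst _ _) (Hid _) (Hcst _ _) Hadm).
assert (D4 : is_derive (along_py (Dint a m1) z) q (dDint a m1 x y p q 0 0 0 1))
  by exact (is_derive_Dint_along a m1 q 0 0 0 1 (fun _ => x) (fun _ => y) (fun _ => p)
    (fun t => t) (Hcst _ _) (Hcst _ _) (Hcst _ _) (Hid _) Hadm).
pose proof (is_derive_average_along a m1 m2 f x 1 0 0 0 (fun t => t) (fun _ => y)
  (fun _ => p) (fun _ => q) Ha Hm (Hid _) (Hcst _ _) (Hcst _ _) (Hcst _ _) Hadm) as V1.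
pose proof (is_derive_average_along a m1 m2 f y 0 1 0 0 (fun _ => x) (fun t => t)
  (fun _ => p) (fun _ => q) Ha Hm (Hcst _ _) (Hid _) (Hcst _ _) (Hcst _ _) Hadm) as V2.
pose proof (is_derive_average_along a m1 m2 f p 0 0 1 0 (fun _ => x) (fun _ => y)
  (fun t => t) (fun _ => q) Ha Hm (Hcst _ _) (Hcst _ _) (Hid _) (Hcst _ _) Hadm) as V3.
pose proof (is_derive_average_along a m1 m2 f q 0 0 0 1 (fun _ => x) (fun _ => y)
  (fun _ => p) (fun t => t) Ha Hm (Hcst _ _) (Hcst _ _) (Hcst _ _) (Hid _) Hadm) as V4.
assert (E1 : is_derive (along_x (Esph_avg a m1 m2 f) z) x
    (kepler_dx a m1 x y p q + daverage a m1 m2 f x y p q 1 0 0 0))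
  by exact (is_derive_plus (V := R_NormedModule) _ _ _ _ _ K1 V1).
assert (E2 : is_derive (along_y (Esph_avg a m1 m2 f) z) y
    (kepler_dy a m1 x y p q + daverage a m1 m2 f x y p q 0 1 0 0))
  by exact (is_derive_plus (V := R_NormedModule) _ _ _ _ _ K2 V2).
assert (E3 : is_derive (along_px (Esph_avg a m1 m2 f) z) p
    ((1 + x ^ 2 + y ^ 2) * vx x y p q + daverage a m1 m2 f x y p q 0 0 1 0))
  by exact (is_derive_plus (V := R_NormedModule) _ _ _ _ _ K3 V3).
assert (E4 : is_derive (along_py (Esph_avg a m1 m2 f) z) q
    ((1 + x ^ 2 + y ^ 2) * (bfac a * vy a x y p q) + daverage a m1 m2 f x y p q 0 0 0 1))
  by exact (is_derive_plus (V := R_NormedModule) _ _ _ _ _ K4 V4).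
split; [| split].
- refine (conj _ (conj _ (conj _ _))); eexists; [exact E1 | exact E2 | exact E3 | exact E4].
- refine (conj _ (conj _ (conj _ _))); eexists; [exact D1 | exact D2 | exact D3 | exact D4].
- unfold poisson, d_x, d_y, d_px, d_py. fold x y p q.
  rewrite (is_derive_unique _ _ _ D1), (is_derive_unique _ _ _ D2),
    (is_derive_unique _ _ _ D3), (is_derive_unique _ _ _ D4).
  rewrite (is_derive_unique _ _ _ E1), (is_derive_unique _ _ _ E2),
    (is_derive_unique _ _ _ E3), (is_derive_unique _ _ _ E4).
  transitivity (bracket (dkepler a m1 x y p q) (dDint a m1 x y p q)
    + bracket (daverage a m1 m2 f x y p q) (dDint a m1 x y p q)).
  + unfold bracket, dkepler. ring.
  + rewrite bracket_kepler_Dint by apply Hadm.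
    rewrite bracket_average_Dint by assumption. ring.
Qed.
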